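(* Let $Z^*=(Z,Z_0,\{\Phi_\lambda\}_{\lambda\in\Lambda})$ be a finite one-dimensional CW complex with a fixed cellular structure and let $f:Z\to X\subseteq\mathbb{R}^d$ be a $C^2$ homeomorphism (under $Z^*$) with bounded curvature. Let $k:Z\times Z\to\mathbb{R}$ be a continuous kernel that is four-times differentiable on $Z^*$ and satisfies $J(Z,d_k)<\infty$, and assume that all components of $f$ are functions in the RKHS of $k$. Moreover, assume that for each $\lambda\in\Lambda$, with $f_\lambda:=f\circ\Phi_\lambda$, the speed $\|f'_\lambda(t)\|_2=L_\lambda$ is constant in $t\in[0,1]$. Let $\mathbf{a}=(a_1,a_2,\dots)$ be a sequence in $Z$ which is compatible with $Z^*$ and dense for $f$. Write $$f(t)=\left(f^1(t),\dots,f^d(t)\right)^T,\qquad \hat f_n:=\left(\hat f_n^1,\dots,\hat f_n^d\right)^T,$$ where for $j=1,\dots,d$ the function $\hat f_n^j$ is the Gaussian smoothing of $f^j$ given observations $y_{ij}=f^j(a_i)+\zeta_{ij}$, $i=1,\dots,n$, using the kernel $k$, and the $\zeta_{ij}\sim\mathcal{N}(0,\sigma_j^2)$ are independent, for some $\sigma_j>0$. Then for each $\varepsilon>0$ $$\lim_{n\to\infty}\mathbb{P}\left(\left\|\mathrm{ECT}_{\hat f_n}-\mathrm{ECT}_f\right\|<\varepsilon\right)=1.$$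
   Context: A finite one-dimensional CW complex is a space $Z=(Z_0\sqcup\bigsqcup_{\lambda\in\Lambda}[0,1])/\phi$ with $Z_0$ a finite discrete set, $\Lambda$ finite, and $\phi$ a map from the endpoints of the intervals to $Z_0$; $\Phi_\lambda:[0,1]\to Z$ is the map of the $\lambda$-th interval into $Z$. Images of the $\Phi_\lambda$ are the 1-cells. A map $f:Z\to\mathbb{R}^d$ is $C^r$ under $Z^*$ if each $f\circ\Phi_\lambda$ is $C^r$; it has bounded curvature if for some $M$ each curve $f\circ\Phi_\lambda$ has curvature bounded by $M$. A finite set $A\subseteq Z$ is compatible with $Z^*$ if $Z_0\subseteq A$ and $A\setminus Z_0$ contains a point in each 1-cell; then $Z\setminus A$ is a disjoint union of open intervals, and $A$ is $\epsilon$-dense for $f$ if the image under $f$ of each of these intervals has length less than $\epsilon$. An infinite subset (sequence) is compatible and dense for $f$ if it contains an $\epsilon$-dense subset for every $\epsilon>0$. A kernel on $Z$ is a symmetric function $k:Z\times Z\to\mathbb{R}$ with $\sum_{i,j}a_ia_jk(x_i,x_j)\ge0$ for all finite families. Its RKHS is the completion of $\mathrm{span}\{k(\cdot,x):x\in Z\}$ under the inner product induced by $\langle k(\cdot,x),k(\cdot,y)\rangle=k(x,y)$, regarded as a space of functions. $K(X',X'')$ is the Gram matrix $(k(x'_i,x''_j))_{ij}$. A continuous kernel $k$ is $r$-times differentiable on $Z^*$ if for each $\lambda$ the map $(s,t)\mapsto k(\Phi_\lambda(s),\Phi_\lambda(t))$ on $[0,1]^2$ is $r$-times continuously differentiable,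 and for each $\lambda$ and $z\in Z$ the map $s\mapsto k(\Phi_\lambda(s),z)$ on $[0,1]$ is $r$-times continuously differentiable (one-sided limits at boundaries). $d_k(t,s)=\sqrt{k(t,t)+k(s,s)-2k(t,s)}$; $N(Z,\varepsilon,d_k)$ is the minimal number of $d_k$-balls of radius $\varepsilon$ covering $Z$; $J(Z,d_k)=\int_0^\infty\sqrt{\log N(Z,\varepsilon,d_k)}\,d\varepsilon$. Writing $\mathbf{a}_n=(a_1,\dots,a_n)$ and $\mathbf{y}_j=(y_{1j},\dots,y_{nj})^T$, the Gaussian smoothing is $\hat f^j_n(t)=K(t,\mathbf{a}_n)(K(\mathbf{a}_n,\mathbf{a}_n)+\sigma_j^2I_n)^{-1}\mathbf{y}_j$. For $g:Z\to\mathbb{R}^d$, $\mathrm{ECT}_g(v,t)=\chi(g^{-1}\{x\in\mathbb{R}^d:\langle x,v\rangle\le t\})$ for $(v,t)\in S^{d-1}\times\mathbb{R}$, where $\chi$ is the Euler characteristic (set to $\infty$ where not well defined; $\infty\pm\infty=\infty$, $\infty+n=\infty$). The norm is $\|F\|=\sup_{v\in S^{d-1}}\int_{-a}^a|F(v,t)|\,dt$ where $a$ bounds the Euclidean norm of the functions involved; for the difference of the ECTs of two bounded functions on the same $Z$ the value does not depend on $a$.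
   Formalization: The formal theorem adds that the sequence visits infinitely often every 0-cell that is not an endpoint of a 1-cell; without this the claim fails, e.g. for an isolated point observed once with a kernel vanishing between it and the rest of Z. *)

(* Defs.v *)
From HB Require Import structures.
From mathcomp Require Import all_boot all_order all_algebra generic_quotient.
From mathcomp Require Import all_classical all_reals all_analysis.

Set Implicit Arguments.
Unset Strict Implicit.
Unset Printing Implicit Defensive.

Import Order.TTheory GRing.Theory Num.Theory.
Import numFieldNormedType.Exports.

Local Open Scope classical_set_scope.
Local Open Scope ring_scope.
Local Open Scope quotient_scope.

(** * Finite one-dimensional CW complexes *)

(* [attach e false] and [attach e true] are the 0-cells to which the endpoints
   0 and 1 of the [e]-th interval are glued. *)
Record cw_complex : Type := CWComplex {
  cw_vertex : finType;
  cw_edge : finType;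
  attach : cw_edge -> bool -> cw_vertex }.

Section realization.
Variables (R : realType) (W : cw_complex).

Definition unit_itv : set R := `[0, 1].

Definition cw_piece (o : option (cw_edge W)) : topologicalType :=
  if o is Some _ then (unit_itv : topologicalType)
  else discrete_topology (cw_vertex W).

Definition cw_union : topologicalType := {o : option (cw_edge W) & cw_piece o}.

(* Canonical representative of the class of a point of the disjoint union. *)
Definition cw_glue (p : cw_union) : cw_union :=
  match p with
  | existT None x => existT cw_piece None x
  | existT (Some e) t =>
      if set_val (t : unit_itv) == 0 then existT cw_piece None (attach e false)
      else if set_val (t : unit_itv) == 1 then
        existT cw_piece None (attach e true)
      else existT cw_piece (Some e) t
  end.

Definition cw_rel0 (p q : cw_union) : bool := cw_glue p == cw_glue q.

Lemma cw_rel0_refl : reflexive cw_rel0.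
Proof. by move=> p; exact: eqxx. Qed.

Lemma cw_rel0_sym : symmetric cw_rel0.
Proof. by move=> p q; exact: eq_sym. Qed.

Lemma cw_rel0_trans : transitive cw_rel0.
Proof. by move=> q p r /eqP pq /eqP qr; rewrite /cw_rel0 pq qr. Qed.

Definition cw_rel := EquivRel cw_rel0 cw_rel0_refl cw_rel0_sym cw_rel0_trans.

Definition cw_space := {eq_quot cw_rel}.
HB.instance Definition _ := Topological.copy cw_space (quotient_topology cw_space).
HB.instance Definition _ := Quotient.on cw_space.

Definition cw_pt (x : cw_vertex W) : cw_space :=
  \pi_cw_space%qT (existT cw_piece None x).

Lemma clamp_subproof (t : R) : Num.max 0 (Num.min 1 t) \in unit_itv.
Proof.
apply/mem_set; rewrite /unit_itv /= in_itv /= le_max lexx /=.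
by rewrite ge_max ler01 ge_min lexx.
Qed.

(* The characteristic map of the [e]-th 1-cell. Only its values on [0, 1]
   matter; it is extended to the real line by clamping. *)
Definition cw_char (e : cw_edge W) (t : R) : cw_space :=
  \pi_cw_space%qT (existT cw_piece (Some e) (SigSub (clamp_subproof t))).

End realization.
Arguments unit_itv R : clear implicits.
Arguments cw_pt R {W} x.

(** * Homeomorphisms and the Euler characteristic *)

Definition homeomorphism (X Y : topologicalType) (u : X -> Y) : Prop :=
  continuous u /\
  exists2 w : Y -> X, continuous w & cancel u w /\ cancel w u.

Definition homeomorphism_onto (X Y : topologicalType) (f : X -> Y)
    (B : set Y) : Prop :=
  exists2 u : X -> B, homeomorphism u & forall x, f x = set_val (u x).

(* The alternating number of cells of a finite CW structure on the subspace [A],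
   and +oo when there is none; the number of cells does not depend on the chosen
   structure. One-dimensional structures suffice for the subspaces of a graph,
   and a closed subspace of a finite graph has one exactly when its homology is
   finitely generated. *)
Definition euler_char (R : realType) (T : topologicalType) (A : set T) :
    \bar R :=
  xget +oo%E [set c : \bar R | exists W : cw_complex,
    (exists u : cw_space R W -> A, homeomorphism u) /\
    c = ((#|cw_vertex W|)%:R - (#|cw_edge W|)%:R)%:E].

(** * Differentiability on [0, 1] *)

Section calculus.
Variables (R : realType) (V : normedModType R).

(* At the endpoints the limits below are one-sided. *)
Definition quotient01 (h : R -> V) (x : R) : set_system V :=
  (y - x)^-1 *: (h y - h x) @[y --> within (unit_itv R) x^'].

Definition deriv01 (h : R -> V) (x : R) : V := lim (quotient01 h x).

Fixpoint Cr01 (r : nat) (h : R -> V) : Prop :=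
  {within unit_itv R, continuous h} /\
  if r is r'.+1 then
    (forall x, unit_itv R x -> cvg (quotient01 h x)) /\ Cr01 r' (deriv01 h)
  else True.

End calculus.

Fixpoint Cr_square (R : realType) (r : nat) (g : R -> R -> R^o) : Prop :=
  {within unit_itv R `*` unit_itv R, continuous (fun p : R * R => g p.1 p.2)} /\
  if r is r'.+1 then
    [/\ forall s t, unit_itv R s -> unit_itv R t -> cvg (quotient01 (g^~ t) s),
        forall s t, unit_itv R s -> unit_itv R t -> cvg (quotient01 (g s) t),
        Cr_square r' (fun s t => deriv01 (g^~ t) s) &
        Cr_square r' (fun s t => deriv01 (g s) t)]
  else True.

(** * Euclidean geometry of curves *)

Section euclid.
Variables (R : realType) (d : nat).
Implicit Types (x y : 'rV[R]_d) (c : R -> 'rV[R]_d).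

Definition dotr x y : R := \sum_(i < d) x 0 i * y 0 i.
Definition enorm x : R := Num.sqrt (dotr x x).

Definition unit_tangent c (t : R) : 'rV[R]_d :=
  (enorm (deriv01 c t))^-1 *: deriv01 c t.
Definition curvature c (t : R) : R :=
  enorm (deriv01 (unit_tangent c) t) / enorm (deriv01 c t).

Definition curve_length c (s t : R) : \bar R :=
  ereal_sup [set (\sum_(0 <= i < size p)
    enorm (c (nth t (s :: p) i.+1) - c (nth t (s :: p) i)))%:E
    | p in itv_partition s t].

End euclid.

Section maps.
Variables (R : realType) (W : cw_complex) (d : nat).
Notation Z := (cw_space R W).
Implicit Types (f g : Z -> 'rV[R]_d) (A : set Z) (a : nat -> Z).

Definition Cr_cw (r : nat) f : Prop := forall e, Cr01 r (f \o cw_char e).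

Definition bounded_curvature f : Prop :=
  exists M : R, forall e t, unit_itv R t -> curvature (f \o cw_char e) t <= M.

Definition cw_compatible A : Prop :=
  range (@cw_pt R W) `<=` A /\
  forall e, (A `\` range (@cw_pt R W)) `&` (cw_char e @` unit_itv R) !=set0.

(* The components of the complement of a compatible set [A] are the images
   under the characteristic maps of the intervals ]s, t[ between consecutive
   parameters of points of [A]. *)
Definition cw_gap A (e : cw_edge W) (s t : R) : Prop :=
  [/\ 0 <= s, s < t & t <= 1] /\
  [/\ A (cw_char e s), A (cw_char e t) &
      forall u, s < u < t -> ~ A (cw_char e u)].

Definition eps_dense f (eps : R) A : Prop :=
  forall e s t, cw_gap A e s t ->
    (curve_length (f \o cw_char e) s t < eps%:E)%E.

Definition compatible_dense_seq f a : Prop :=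
  forall eps : R, 0 < eps -> exists A : set Z,
    [/\ finite_set A, A `<=` range a, cw_compatible A & eps_dense f eps A].

(** * The Euler characteristic transform *)

Definition ECT g (v : 'rV[R]_d) (t : R) : \bar R :=
  euler_char R [set z | dotr (g z) v <= t].

Definition ECT_norm (a : R) (F : 'rV[R]_d -> R -> \bar R) : \bar R :=
  ereal_sup [set (\int[lebesgue_measure]_(t in `[(- a)%R, a]) `|F v t|)%E
    | v in [set v | enorm v = 1]].

Definition sup_enorm f : R := sup [set enorm (f z) | z in setT].

(* In [\bar R] one has +oo - +oo = -oo; since only the absolute value of the
   difference is used, this agrees with the convention that the difference is
   infinite as soon as one of the terms is. *)
Definition ECT_dist f g : \bar R :=
  ECT_norm (Num.max (sup_enorm f) (sup_enorm g))
    (fun v t => ECT f v t - ECT g v t)%E.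

End maps.

(** * Kernels *)

Section kernels.
Variables (R : realType) (T : Type) (k : T -> T -> R).

Definition is_kernel : Prop :=
  (forall x y, k x y = k y x) /\
  forall (n : nat) (a : 'I_n -> R) (x : 'I_n -> T),
    0 <= \sum_i \sum_j a i * a j * k (x i) (x j).

(* The list [u] stands for the element \sum_(p <- u) p.1 * k(., p.2) of the
   span of the functions k(., x). *)
Definition span_eval (u : seq (R * T)) (z : T) : R :=
  \sum_(p <- u) p.1 * k z p.2.
Definition span_dot (u v : seq (R * T)) : R :=
  \sum_(p <- u) \sum_(q <- v) p.1 * q.1 * k p.2 q.2.
Definition span_sub (u v : seq (R * T)) : seq (R * T) :=
  u ++ [seq (- q.1, q.2) | q <- v].
Definition span_norm (u : seq (R * T)) : R := Num.sqrt (span_dot u u).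

(* Elements of the completion are classes of Cauchy sequences of the span; they
   are regarded as functions through evaluation, which is continuous. *)
Definition in_RKHS (h : T -> R) : Prop :=
  exists u : nat -> seq (R * T),
    (forall eps : R, 0 < eps -> exists N : nat, forall m n : nat,
       (N <= m)%N -> (N <= n)%N -> span_norm (span_sub (u m) (u n)) < eps) /\
    (forall z : T, span_eval (u n) z @[n --> \oo] --> h z).

Definition kernel_dist (t s : T) : R := Num.sqrt (k t t + k s s - 2 * k t s).

Definition covering_number (eps : R) : \bar R :=
  ereal_inf [set (n%:R)%:E | n in [set n : nat |
    exists c : 'I_n -> T, forall z, exists i, kernel_dist (c i) z < eps]].

Definition entropy_integral : \bar R :=
  (\int[lebesgue_measure]_(eps in `]0%R, +oo[)
     sqrte (lne (covering_number eps)))%E.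

Definition gram (m n : nat) (x : 'I_m -> T) (y : 'I_n -> T) : 'M[R]_(m, n) :=
  \matrix_(i, j) k (x i) (y j).

Definition gaussian_smoothing (n : nat) (a : 'I_n -> T) (sigma : R)
    (y : 'cV[R]_n) (t : T) : R :=
  (gram (fun _ : 'I_1 => t) a *m invmx (gram a a + (sigma ^+ 2)%:M) *m y) 0 0.

End kernels.

Definition kernel_differentiable (R : realType) (W : cw_complex) (r : nat)
    (k : cw_space R W -> cw_space R W -> R) : Prop :=
  (forall e, Cr_square r (fun s t => k (cw_char e s) (cw_char e t))) /\
  (forall e z, @Cr01 R R^o r (fun s => k (cw_char e s) z)).

(** * Probability *)

Section probability.
Variables (R : realType) (disp : measure_display) (Omega : measurableType disp).
Variable P : probability Omega R.

Definition mutually_independent (I : choiceType) (X : I -> {RV P >-> R}) : Prop :=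
  forall (s : seq I) (B : I -> set R), uniq s ->
    (forall i, measurable (B i)) ->
    P (\bigcap_(i in [set` s]) (X i @^-1` B i)) =
    (\prod_(i <- s) P (X i @^-1` B i))%E.

(* The probability of [E] when [E] is measurable, possibly up to a null set. *)
Definition inner_probability (E : set Omega) : \bar R :=
  ereal_sup [set P F | F in [set F | measurable F /\ F `<=` E]].

End probability.

(* The smoothing of the curve [f] from its first [n] noisy observations;
   sequences are indexed from 0. *)
Definition smoothed_map (R : realType) (W : cw_complex) (d : nat)
    (k : cw_space R W -> cw_space R W -> R) (sigma : 'I_d -> R)
    (f : cw_space R W -> 'rV[R]_d) (a : nat -> cw_space R W)
    (zeta : nat -> 'I_d -> R) (n : nat) (t : cw_space R W) : 'rV[R]_d :=
  \row_j gaussian_smoothing k (fun i : 'I_n => a i) (sigma j)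
    (\col_i (f (a i) 0 j + zeta i j)) t.

(* Main.v *)
Require Import Defs.
From HB Require Import structures.
From mathcomp Require Import all_boot all_order all_algebra generic_quotient.
From mathcomp Require Import all_classical all_reals all_analysis.
From mathcomp Require Import measurable_realfun.
From mathcomp Require Import ring lra zify.
Set Implicit Arguments.
Unset Strict Implicit.
Unset Printing Implicit Defensive.
Import Order.TTheory GRing.Theory Num.Theory.
Import numFieldNormedType.Exports.
Local Open Scope classical_set_scope.
Local Open Scope ring_scope.

(** The proof has a deterministic half, stability of the Euler characteristic
    transform ([ECT_stability]), and a probabilistic half, consistency of the
    smoothing in the norm that stability asks for ([smoothing_consistent_lip]).

    Stability. Let [h] be a height function on a graph. Where each arc crosses
    the level [t] finitely often, cutting at the crossings makes the sublevel set
    a graph, whose Euler characteristic is the number of vertices minus the number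
    of arcs, whatever the decomposition ([cell_dec_euler_unique]). It differs from
    [chi0], which only sees the heights of the vertices, by at most the number of
    crossings in excess of those forced by the heights of the ends of the arcs
    ([euler_sublevel]). Integrated over the levels, the crossings of an arc number
    at most its Lipschitz constant (Banach's indicatrix, [indicatrix]), while the
    forced ones integrate to the difference of height between its ends. Hence the
    error is small in mean over the levels as soon as each arc is nearly affine
    ([euler_diff_integral]). A map that is C^1 on the cells is nearly affine on the
    arcs of a fine subdivision; so is every map that is close to it both uniformly
    and in Lipschitz seminorm along the cells, and then the two transforms are
    close, uniformly in the direction.

    Consistency. A linear functional of the smoothing error, such as the value at
    a point or a second difference along a cell, is the sum of a bias and of a
    linear combination of the noise. The squared bias and the variance are at most
    constants times the value of the ridge problem that the smoothing weights
    minimise, so any competing weights give a bound ([smoothing_error]). The noise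
    enters through its second moments only, by Chebyshev's inequality
    ([noisy_tail]).
    - For the value at a point, the competitor that averages over many visits of
      the sequence to a small neighbourhood shows that the error tends to 0 in
      probability ([point_deviation]); density of the sequence provides the visits
      ([often_nbhs]).
    - For a second difference with step [r], the zero competitor gives a bound of
      order [r ^+ 4], uniformly in the number of observations, because the kernel
      is four times differentiable ([second_diff_norm]). There are [2 ^ m] second
      differences of step [2 ^- m.+1] on a cell, and asking that they be smaller
      than [(3 / 8) ^+ m] fails with probability of order [(8 / 9) ^+ m]; the sum
      over all levels beyond a large [m0] is small ([kinks_union_tail]).
    Away from these events, small errors at the dyadic points of level [m0] and
    small second differences at all finer levels make the error small and Lipschitz
    with a small constant along each cell ([dyadic_lipschitz]), which is what
    stability needs. *)

(** * Cell decompositions and the realization of a complex *)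

(** A cell structure on a subset of an ambient space, the arcs being parametrised
    by maps on the whole line of which only the restriction to the unit interval
    is a cell. Staying in the ambient space allows arcs to be cut, and two
    structures on the same set to be compared, without forming new gluings. *)
Record cell_dec (R : realType) (T : topologicalType) (A : set T)
    (V I : finType) (x : V -> T) (g : I -> R -> T) : Prop := CellDec {
  cd_cont : forall i, continuous (g i);
  cd_inj : injective x;
  cd_end : forall i (b : bool), exists v, g i b%:R = x v;
  cd_free : forall i (s : R) v, 0 < s < 1 -> g i s <> x v;
  cd_arc : forall i j (s t : R), 0 < s < 1 -> 0 < t < 1 ->
    g i s = g j t -> i = j /\ s = t;
  cd_cover : forall z, A z <->
    (exists v, z = x v) \/ exists i (s : R), 0 < s < 1 /\ z = g i s }.

Lemma existT_inj (I : eqType) (T : I -> Type) i (x y : T i) :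
  existT T i x = existT T i y -> x = y.
Proof.
by move=> /(congr1 (tagged_as (existT T i x))); rewrite !(@tagged_asE I T (existT T i x)).
Qed.

Section cw_space_basics.
Variables (R : realType) (W : cw_complex).
Local Notation Z := (cw_space R W).
Local Open Scope quotient_scope.

Lemma cw_piE (p q : cw_union R W) :
  (\pi_(cw_space R W) p = \pi_(cw_space R W) q) <-> cw_glue p = cw_glue q.
Proof.
have := @eqmodP (cw_union R W) (cw_rel R W) p q.
by move=> h; split=> [/h/eqP//|/eqP/h].
Qed.

Lemma clamp_id (t : R) : 0 <= t <= 1 -> Num.max 0 (Num.min 1 t) = t.
Proof.
by case/andP=> t0 t1; rewrite min_r// max_r.
Qed.

Lemma unit_itvP (t : unit_itv R) : 0 <= set_val t <= 1.
Proof. by have := set_valP t; rewrite /unit_itv /= in_itv. Qed.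

Lemma cw_charE e (t : unit_itv R) :
  \pi_(cw_space R W) (existT (@cw_piece R W) (Some e) t) = cw_char e (set_val t).
Proof.
congr (\pi _); congr (existT _ _ _); apply: val_inj => /=.
by rewrite clamp_id//; exact: unit_itvP.
Qed.

Lemma clamp_continuous :
  continuous (fun t : R => SigSub (@clamp_subproof R t) : unit_itv R).
Proof.
apply: (@continuous_comp_initial _ _ _ set_val) => t.
apply: (@continuous_max R R (cst 0) (cst 1 \min id)); first exact: cvg_cst.
by apply: (@continuous_min R R (cst 1) id); first exact: cvg_cst.
Qed.

Lemma cw_char_continuous e : continuous (@cw_char R W e).
Proof.
move=> t; apply: (@continuous_comp _ _ _
  (fun t : R => SigSub (@clamp_subproof R t) : unit_itv R)
  (fun t => \pi_(cw_space R W) (existT (@cw_piece R W) (Some e) t))).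
  exact: clamp_continuous.
apply: (@continuous_comp _ _ _ (existT (@cw_piece R W) (Some e))).
  exact: existT_continuous.
exact: (@pi_continuous (cw_union R W) (cw_space R W)).
Qed.

Lemma cw_glue_char e (t : R) : 0 <= t <= 1 ->
  cw_glue (existT (@cw_piece R W) (Some e) (SigSub (@clamp_subproof R t))) =
  if t == 0 then existT (@cw_piece R W) None (attach e false) else
  if t == 1 then existT (@cw_piece R W) None (attach e true) else
  existT (@cw_piece R W) (Some e) (SigSub (@clamp_subproof R t)).
Proof. by move=> t01; rewrite /cw_glue (_ : set_val _ = t)// set_valE /= clamp_id. Qed.

Lemma cw_char_end e (b : bool) : @cw_char R W e b%:R = cw_pt R (attach e b).
Proof.
apply/cw_piE; rewrite cw_glue_char; last by case: b; rewrite ?ler01 ?lexx.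
by case: b; rewrite ?eqxx ?oner_eq0.
Qed.

Lemma cw_spaceP (z : Z) :
  (exists v, z = cw_pt R v) \/ exists e s, 0 < s < 1 /\ z = @cw_char R W e s.
Proof.
rewrite -(reprK z); case: (repr z) => -[e|] p; last by left; exists p.
rewrite cw_charE; have /andP[] := unit_itvP p.
set t := set_val p.
rewrite le_eqVlt => /predU1P[<- _|t0].
  by left; exists (attach e false); exact: (cw_char_end e false).
rewrite le_eqVlt => /predU1P[->|t1].
  by left; exists (attach e true); exact: (cw_char_end e true).
by right; exists e, t; rewrite t0.
Qed.

Lemma cw_cell_dec : cell_dec [set: Z] (@cw_pt R W) (@cw_char R W).
Proof.
split.
- exact: cw_char_continuous.
- by move=> v w /cw_piE h; exact: (existT_inj h).
- by move=> e b; exists (attach e b); exact: cw_char_end.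
- move=> e s v /andP[s0 s1] /cw_piE; rewrite cw_glue_char ?ltW//.
  by rewrite gt_eqF// lt_eqF.
- move=> e e' s t /andP[s0 s1] /andP[t0 t1] /cw_piE; rewrite !cw_glue_char ?ltW//.
  rewrite !(gt_eqF s0, gt_eqF t0, lt_eqF s1, lt_eqF t1).
  move=> h; have [ee'] := congr1 (@tag _ _) h.
  by subst e'; split=> //; have := congr1 val (existT_inj h) => /=;
rewrite !clamp_id ?ltW.
- by move=> z; split=> // _; exact: cw_spaceP.
Qed.

Lemma cw_space_compact : compact [set: Z].
Proof.
have -> : [set: Z] = \pi_(cw_space R W) @` [set: cw_union R W].
  by apply/seteqP; split=> // z _; exists (repr z); rewrite ?reprK.
apply: continuous_compact.
  by apply/continuous_subspaceT/(@pi_continuous (cw_union R W) (cw_space R W)).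
apply: sigT_compact => [|[e|]] /=; first exact: finite_finset.
- have -> : [set: unit_itv R] = (fun t : R => SigSub (@clamp_subproof R t)) @` `[0, 1].
    apply/seteqP; split=> // p _; exists (set_val p) => /=.
      by rewrite in_itv /=; exact: unit_itvP.
    by apply: val_inj => /=; rewrite clamp_id//; exact: unit_itvP.
  apply: continuous_compact; last exact: segment_compact.
  exact/continuous_subspaceT/clamp_continuous.
- exact/finite_compact/finite_finset.
Qed.

End cw_space_basics.

(** * Decompositions of Hausdorff sets are realizations *)

(** The inverse is continuous because a closed subset of [X] is compact, and so
    is its image, which is therefore closed in [T]. *)
Lemma compact_bij_homeomorphism (X T : topologicalType) (A : set T)
    (m : X -> T) : compact [set: X] -> hausdorff_space T -> continuous m ->
  injective m -> range m = A -> exists u : X -> A, homeomorphism u.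
Proof.
move=> cX hT cm im <-.
have mr z : range m (m z) by exists z.
pose u (z : X) : range m := SigSub (mem_set (mr z)).
have uK (a : range m) : exists z, u z = a.
  have [z _ mz] := set_valP a; exists z; apply: val_inj; exact: mz.
pose w (a : range m) : X := sval (cid (uK a)).
have wK : cancel w u by move=> a; rewrite /w; case: cid.
have Kw : cancel u w.
  by move=> z; apply: im; have /(congr1 set_val) := wK (u z).
exists u; split; first by apply: (@continuous_comp_initial _ _ _ set_val).
exists w; last by split.
apply/continuous_closedP => C cC.
have -> : w @^-1` C = set_val @^-1` (m @` C).
  apply/seteqP; split=> a /=; first by move=> Cw; exists (w a) => //; have /(congr1 set_val) := wK a.
  case=> z Cz mz; have -> : a = u z by apply: val_inj; exact: (esym mz).
  by rewrite Kw.
apply: (@preimage_closed (range m) T set_val (m @` C)).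
  by move=> a _; exact: initial_continuous.
apply: compact_closed => //; apply: continuous_compact.
  exact: continuous_subspaceT.
exact: (subclosed_compact cC cX).
Qed.

Section realization_of_decompositions.
Variables (R : realType) (T : topologicalType).

Lemma cell_dec_image (X : topologicalType) (V I : finType) (x : V -> X)
    (g : I -> R -> X) (m : X -> T) :
  cell_dec [set: X] x g -> continuous m -> injective m ->
  cell_dec (range m) (m \o x) (fun i => m \o g i).
Proof.
case=> gc xi ge gf ga gcov cm im; split.
- by move=> i s; apply: continuous_comp; [exact: gc|exact: cm].
- exact: inj_comp.
- by move=> i b; have [v gv] := ge i b; exists v; rewrite /= gv.
- by move=> i s v s01 /im; exact: gf.
- by move=> i j s t s01 t01 /im; exact: ga.
- move=> z; split.
    case=> y _ <-; have [[v ->]|[i [s [s01 ->]]]] := (gcov y).1 Logic.I.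
      by left; exists v.
    by right; exists i, s.
  by case=> [[v ->]|[i [s [s01 ->]]]]; eexists.
Qed.

Section existence.
Variables (A : set T) (V I : finType) (x : V -> T) (g : I -> R -> T).
Hypothesis D : cell_dec A x g.

Definition dec_cw : cw_complex := CWComplex (fun i b => sval (cid (cd_end D i b))).

(** The disjoint union of the cells, before gluing, mapped into the ambient space. *)
Definition dec_union_map : cw_union R dec_cw -> T :=
  unstable.sigT_fun (fun o : option (cw_edge dec_cw) =>
    match o return cw_piece R o -> T with
    | None => x
    | Some i => fun t => g i (set_val (t : unit_itv R))
    end).

Lemma dec_union_map_continuous : continuous dec_union_map.
Proof.
apply: sigT_continuous => -[i|] /=.
  move=> t; apply: (@continuous_comp _ _ _ set_val (g i)).
    exact: initial_continuous.
  exact: (cd_cont D).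
move=> v U /= /nbhs_singleton Uv.
by rewrite /nbhs /= => y /= ->.
Qed.

Lemma attachE i b : x (attach (c := dec_cw) i b) = g i b%:R.
Proof. by rewrite /attach /=; case: cid => v /= ->. Qed.

Lemma dec_union_map_glue p : dec_union_map (cw_glue p) = dec_union_map p.
Proof.
case: p => -[i|] // t; rewrite /cw_glue.
case: ifPn => [/eqP t0|_]; first exact: etrans (attachE i false) (congr1 (g i) (esym t0)).
case: ifPn => [/eqP t1|_]; first exact: etrans (attachE i true) (congr1 (g i) (esym t1)).
by [].
Qed.

Lemma cw_glueP (W : cw_complex) (p : cw_union R W) :
  (exists v, cw_glue p = existT (@cw_piece R W) None v) \/
  exists i (t : unit_itv R), 0 < set_val t < 1 /\
    cw_glue p = existT (@cw_piece R W) (Some i) t.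
Proof.
case: p => -[i|] t; last by left; exists t.
rewrite /cw_glue; case: ifPn => [_|t0]; first by left; eexists.
case: ifPn => [_|t1]; first by left; eexists.
right; exists i, t; split=> //; have /andP[] := unit_itvP t.
by rewrite !le_eqVlt (eq_sym 0) (negPf t0) (negPf t1) /= => -> ->.
Qed.

(** The map of the disjoint union identifies exactly the points that are glued:
    two points of the ambient set that coincide are either the same vertex or the
    same interior point of the same arc. *)
Lemma dec_union_map_inj p q :
  dec_union_map p = dec_union_map q -> cw_glue p = cw_glue q.
Proof.
rewrite -(dec_union_map_glue p) -(dec_union_map_glue q).
case: (cw_glueP p) => [[v ->]|[i [t [t01 ->]]]];
  case: (cw_glueP q) => [[w ->]|[j [s [s01 ->]]]]; rewrite /dec_union_map /=.
- by move=> h; congr (existT _ _ _); exact: (cd_inj D h).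
- by move=> h; case: (cd_free D s01 (esym h)).
- by move=> h; case: (cd_free D t01 h).
- move=> h; have [ij /val_inj st] := cd_arc D t01 s01 h.
  by subst j; rewrite st.
Qed.

(** A decomposition determines a gluing, hence an abstract complex, of which the
    decomposed set is a homeomorphic image; this is what connects the number of
    cells of a decomposition with [euler_char]. *)
Lemma cell_dec_homeomorphism : hausdorff_space T ->
  exists u : cw_space R dec_cw -> A, homeomorphism u.
Proof.
move=> hT; pose m (z : cw_space R dec_cw) : T := dec_union_map (repr z).
have mpi p : m (\pi_(cw_space R dec_cw)%qT p) = dec_union_map p.
  rewrite /m -[LHS]dec_union_map_glue -[RHS]dec_union_map_glue.
  by congr (dec_union_map _); apply/cw_piE; rewrite reprK.
have mchar i (s : R) : 0 < s < 1 -> m (cw_char (i : cw_edge dec_cw) s) = g i s.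
  move=> /andP[s0 s1]; apply: etrans (mpi _) _.
  by rewrite -[in RHS](@clamp_id R s) ?ltW.
apply: (@compact_bij_homeomorphism _ _ _ m) => //.
- exact: cw_space_compact.
- apply/(@quotient_continuous (cw_union R dec_cw) (cw_space R dec_cw)).
  have -> : m \o \pi_(cw_space R dec_cw)%qT = dec_union_map.
    by apply/funext => p /=; exact: mpi.
  exact: dec_union_map_continuous.
- move=> z z' /dec_union_map_inj/cw_piE.
  by rewrite !reprK.
- apply/seteqP; split=> z.
    case=> y _ <-; apply/(cd_cover D); case: (cw_spaceP y) => [[v ->]|[i [s [s01 ->]]]].
      by left; exists v; rewrite mpi.
    by right; exists i, s; rewrite mchar.
  case/(cd_cover D) => [[v ->]|[i [s [s01 ->]]]].
    by exists (cw_pt R (v : cw_vertex dec_cw)) => //; rewrite mpi.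
  by exists (cw_char (i : cw_edge dec_cw) s) => //; rewrite mchar.
Qed.

End existence.

End realization_of_decompositions.

(** * Subdivision and invariance of the Euler characteristic *)

Section subdivision.
Variables (R : realType) (T : topologicalType).
Implicit Types (A : set T).

Lemma sum_option (I : finType) (G : option I -> R) :
  \sum_o G o = G None + \sum_i G (Some i).
Proof.
rewrite (bigD1 None) //=; congr (_ + _).
rewrite (reindex_omap Some id) //=; last by case.
by apply: eq_bigl => i; rewrite eqxx.
Qed.

Section split.
Variables (V I : finType) (x : V -> T) (g : I -> R -> T) (i0 : I) (c : R).

(** Cutting the arc [i0] at the parameter [c]: the new vertex [None] is the cut
    point; the initial piece keeps the index of the arc, the final one is [None]. *)
Definition split_pt (o : option V) : T := if o is Some v then x v else g i0 c.

Definition split_src (o : option I) : I := if o is Some i then i else i0.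

Definition split_par (o : option I) (s : R) : R :=
  if o is Some i then (if i == i0 then c * s else s) else c + (1 - c) * s.

Definition split_arc (o : option I) (s : R) : T :=
  g (split_src o) (split_par o s).

Hypothesis c01 : 0 < c < 1.

Lemma split_par01 o s : 0 < s < 1 -> 0 < split_par o s < 1.
Proof.
case/andP: c01 => c0 c1 /andP[s0 s1].
case: o => [i|] /=; last by apply/andP; split; nra.
by case: ifP => _; apply/andP; split; nra.
Qed.

Lemma split_par_inj o o' s t : 0 < s < 1 -> 0 < t < 1 ->
  split_src o = split_src o' -> split_par o s = split_par o' t ->
  o = o' /\ s = t.
Proof.
case/andP: c01 => c0 c1 /andP[s0 s1] /andP[t0 t1].
case: o => [i|]; case: o' => [j|] //=.
- move=> ->; case: ifP => _ // h; split=> //.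
  by apply: (mulfI _ h); rewrite gt_eqF.
- by move=> ->; rewrite eqxx => h; exfalso; nra.
- by move=> <-; rewrite eqxx => h; exfalso; nra.
- move=> _ h; split=> //; have /eqP : (1 - c) * (s - t) = 0 by lra.
  by rewrite mulf_eq0 !subr_eq0 (gt_eqF c1) => /eqP.
Qed.

Lemma split_par_cover i s : 0 < s < 1 -> (i = i0 /\ s = c) \/
  exists o t, [/\ 0 < t < 1, split_src o = i & split_par o t = s].
Proof.
case/andP: c01 => c0 c1 /andP[s0 s1].
have [->|ii0] := eqVneq i i0; last first.
  by right; exists (Some i), s; rewrite /= (negPf ii0) s0.
have [sc|sc|->] := ltgtP s c; last by left.
- right; exists (Some i0), (s / c); rewrite /= eqxx; split=> //.
    by rewrite divr_gt0//= ltr_pdivrMr// mul1r.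
  by rewrite mulrC divfK// gt_eqF.
- right; exists None, ((s - c) / (1 - c)) => /=; split=> //.
    by rewrite divr_gt0 ?subr_gt0//= ltr_pdivrMr ?subr_gt0// mul1r ltrD2r.
  by rewrite mulrC divfK ?subr_eq0 ?gt_eqF// addrC subrK.
Qed.

Lemma cell_dec_split A : cell_dec A x g -> cell_dec A split_pt split_arc.
Proof.
case=> gc xi ge gf ga gcov; case/andP: (c01) => c0 c1; split.
- move=> o s; apply: (@continuous_comp _ _ _ (split_par o)); last exact: gc.
  rewrite /split_par; case: o => [i|]; last first.
    apply: cvgD; first exact: cvg_cst.
    by apply: cvgM; [exact: cvg_cst|exact: cvg_id].
  case: (i == i0); last exact: cvg_id.
  by apply: cvgM; [exact: cvg_cst|exact: cvg_id].
- move=> [v|] [w|] //=; first by move=> /xi ->.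
    by move=> /esym/gf => /(_ c01).
  by move=> /gf => /(_ c01).
- move=> [i|] b; rewrite /split_arc /=; last first.
    case: b; last by exists None; rewrite /= mulr0 addr0.
    by have [v gv] := ge i0 true; exists (Some v); rewrite /= -gv mulr1 addrC subrK.
  have [v gv] := ge i b.
  case: ifP => [/eqP ii0|_]; last by exists (Some v).
  case: b gv => gv; first by exists None; rewrite /= mulr1 ii0.
  by exists (Some v); rewrite mulr0.
- move=> o s [v|] s01 /=; first exact/gf/split_par01.
  move=> /(ga _ _ _ _ (split_par01 o s01) c01)[].
  case/andP: s01 => s0 s1.
  by case: o => [i|] /=; [move=> ->; rewrite eqxx|]; move=> *; nra.
- move=> o o' s t s01 t01 /(ga _ _ _ _ (split_par01 o s01) (split_par01 o' t01))[].
  exact: split_par_inj.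
- move=> z; rewrite gcov; split.
    case=> [[v ->]|[i [s [s01 ->]]]]; first by left; exists (Some v).
    have [[ei es]|[q [t [t01 ei es]]]] := split_par_cover i s01.
      by left; exists None; rewrite ei es.
    by right; exists q, t; rewrite -ei -es.
  case=> [[p ->]|[q [s [s01 ->]]]].
    case: p => [v|] /=; first by left; exists v.
    by right; exists i0, c.
  by right; exists (split_src q), (split_par q s); rewrite split_par01.
Qed.

End split.

(** Each arc [g i] is the affine reparametrisation of a part of length [be i] of
    an arc of [Gam]; as the pieces of an arc of [Gam] fill it up, the lengths add
    up to the number of arcs. *)
Definition subarcs (E I : finType) (Gam : E -> R -> T) (g : I -> R -> T)
    (e : I -> E) (al be : I -> R) : Prop :=
  [/\ forall i, [/\ 0 <= al i, 0 < be i & al i + be i <= 1],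
      forall i s, g i s = Gam (e i) (al i + be i * s) &
      \sum_i be i = #|E|%:R].

(** The points are made vertices one at a time: a point that already is a vertex
    changes nothing, and cutting an arc at an interior point adds one vertex and
    one arc, so that the difference of the two numbers is preserved. *)
Lemma cell_dec_refine A (V0 E : finType) (x0 : V0 -> T) (Gam : E -> R -> T)
    (J : finType) (p : J -> T) :
  cell_dec A x0 Gam -> (forall j, A (p j)) ->
  exists (V I : finType) (x : V -> T) (g : I -> R -> T) e al be,
    [/\ cell_dec A x g, subarcs Gam g e al be,
        range x = range x0 `|` range p & (#|V| + #|E| = #|V0| + #|I|)%N].
Proof.
move=> D Ap.
suff H (s : seq J) : exists (V I : finType) (x : V -> T) (g : I -> R -> T) e al be,
    [/\ cell_dec A x g, subarcs Gam g e al be,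
        range x = range x0 `|` p @` [set` s] & (#|V| + #|E| = #|V0| + #|I|)%N].
  have [V [I [x [g [e [al [be [D' S rx c]]]]]]]] := H (enum J).
  exists V, I, x, g, e, al, be; split=> //; rewrite rx; congr (_ `|` _).
  by apply/seteqP; split=> z [j _ <-]; exists j => //=; rewrite mem_enum.
elim: s => [|j s [V [I [x [g [e [al [be [D' [ab gE sb] rx c]]]]]]]]].
  exists V0, E, x0, Gam, id, (fun=> 0), (fun=> 1); split=> //.
    split.
    - by move=> i /=; split; rewrite ?add0r ?ltr01 ?lexx.
    - by move=> i s /=; rewrite add0r mul1r.
    - by rewrite sumr_const.
  by rewrite set_nil image_set0 setU0.
have pjs : p @` [set` j :: s] = p @` [set` s] `|` [set p j].
  apply/seteqP; split=> z /=.
    move=> [i]; rewrite in_cons => /orP[/eqP-> <-|is_ <-]; first by right.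
    by left; exists i.
  case=> [[i is_ <-]|->]; first by exists i => //=; rewrite in_cons is_ orbT.
  by exists j => //=; rewrite mem_head.
have [[v pv]|[i0 [s0 [s01 ps]]]] := (cd_cover D' (p j)).1 (Ap j).
  exists V, I, x, g, e, al, be; split=> //; rewrite pjs setUA -rx.
  by apply/esym/setUidPl => z ->; rewrite pv; exists v.
exists (option V), (option I), (split_pt x g i0 s0), (split_arc g i0 s0).
exists (fun o => e (split_src i0 o)).
exists (fun o => if o is Some i then al i else al i0 + be i0 * s0).
exists (fun o => if o is Some i then (if i == i0 then be i0 * s0 else be i)
                 else be i0 * (1 - s0)).
case/andP: (s01) => s0_gt0 s0_lt1.
split; last by rewrite !card_option addSn c addnS.
- exact: cell_dec_split.
- split.
  + case=> [i|]; last by have [a0 b0 ab1] := ab i0; split; nra.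
    case: eqP => [->|_]; last exact: ab.
    by have [a0 b0 ab1] := ab i0; split; nra.
  + case=> [i|] t; rewrite /split_arc gE /=; last by congr (Gam _ _); ring.
    by case: eqP => // ->; rewrite mulrA.
  + rewrite sum_option -sb [in RHS](bigD1 i0) //= (bigD1 i0) //= eqxx addrA.
    congr (_ + _); first by ring.
    by apply: eq_bigr => i /negPf ->.
- rewrite pjs setUA -rx; apply/seteqP; split=> z.
    by case=> -[v|] _ <-; [left; exists v|right].
  by case=> [[v _ <-]|->]; [exists (Some v)|exists None].
Qed.

(** An open arc of one decomposition avoids the vertices, hence lies in the union
    of the open arcs of the other. These are pairwise disjoint, and each is open
    and closed in their union; the arc, being connected, stays in one of them. *)
Lemma cell_dec_arc_sub A (V I V' I' : finType) (x : V -> T) (g : I -> R -> T)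
    (x' : V' -> T) (g' : I' -> R -> T) :
  hausdorff_space T -> cell_dec A x g -> cell_dec A x' g' ->
  range x = range x' ->
  forall i, exists j, forall s, 0 < s < 1 ->
    exists2 s', 0 < s' < 1 & g i s = g' j s'.
Proof.
move=> hT D D' rx i.
have xx' s v : 0 < s < 1 -> g i s <> x' v.
  move=> s01 gv; have [w _ xw] : range x (x' v) by rewrite rx; exists v.
  exact: (cd_free D s01 (etrans gv (esym xw))).
have Ag s : 0 < s < 1 -> exists j s', 0 < s' < 1 /\ g i s = g' j s'.
  move=> s01; have /(cd_cover D')[[v /(xx' _ _ s01)[]]|//] : A (g i s).
  by apply/(cd_cover D); right; exists i, s.
have h01 : 0 < (2^-1 : R) < 1 by apply/andP; split; lra.
have [j [t [t01 gt]]] := Ag _ h01.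
have carc k : closed (g' k @` `[0, 1]).
  apply: compact_closed => //; apply: continuous_compact; last exact: segment_compact.
  exact/continuous_subspaceT/(cd_cont D').
have gc : continuous (g i) := cd_cont D (i := i).
(* [B] is closed and open in the open unit interval: on it, being in the arc
   [g' j] amounts to being in the closed arc, and also to avoiding the vertices
   and the other closed arcs. *)
pose B := [set s | 0 < s < 1 /\ exists2 s', 0 < s' < 1 & g i s = g' j s'].
exists j => s s01.
suff : B s by case.
have BE : B = `]0, 1[%classic.
  have /connected_intervalP/(_ B) : is_interval (`]0, 1[ : set R).
    exact: interval_is_interval.
  apply.
  - by exists 2^-1; split=> //; exists t.
  - exists (g i @^-1` ~` (range x' `|` \bigcup_(k in [set k | k != j]) g' k @` `[0, 1])).
      apply: (open_comp _ _) => [y _|]; first exact: gc.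
      apply: closed_openC; apply: closedU.
        apply: compact_closed => //; apply: finite_compact.
        exact/finite_image/finite_finset.
      by apply: closed_bigcup => //; exact: finite_finset.
    apply/seteqP; split=> y /=; rewrite in_itv /=.
      case=> y01 [y' y'01 gy]; split=> //; case=> [[v _]|[k /= /eqP kj [r]]].
        by move/esym; exact: xx'.
      rewrite /= in_itv /= => /andP[]; rewrite le_eqVlt => /predU1P[<- _|r0].
        by have [v ->] := cd_end D' k false; move=> /esym; exact: xx'.
      rewrite le_eqVlt => /predU1P[->|r1].
        by have [v ->] := cd_end D' k true; move=> /esym; exact: xx'.
      have r01 : 0 < r < 1 by rewrite r0.
      by rewrite gy => /(cd_arc D' r01 y'01)[].
    case=> y01 nF; split=> //; have [k [y' [y'01 gy]]] := Ag _ y01.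
    exists y' => //; rewrite gy; have [->//|kj] := eqVneq k j.
    exfalso; apply: nF; right; exists k => //; exists y' => //=.
    by rewrite in_itv /=; case/andP: y'01 => ? ?; rewrite !ltW.
  - exists (g i @^-1` (g' j @` `[0, 1])).
      by apply: preimage_closed => // y _; exact: gc.
    apply/seteqP; split=> y /=; rewrite in_itv /=.
      case=> y01 [y' y'01 gy]; split=> //; exists y' => //=.
      by rewrite in_itv /=; case/andP: y'01 => ? ?; rewrite !ltW.
    case=> y01 [r]; rewrite /= in_itv /= => /andP[].
    rewrite le_eqVlt => /predU1P[<- _|r0].
      by have [v ->] := cd_end D' j false; move=> /esym/xx' => /(_ y01).
    rewrite le_eqVlt => /predU1P[->|r1].
      by have [v ->] := cd_end D' j true; move=> /esym/xx' => /(_ y01).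
    by move=> gr; split=> //; exists r; rewrite ?r0.
by rewrite BE /= in_itv.
Qed.

(** With the same vertices, each arc of one decomposition is contained in an arc
    of the other, and conversely; as the arcs of a decomposition are disjoint, the
    map sending an arc to the one that contains it is injective. *)
Lemma cell_dec_card A (V I V' I' : finType) (x : V -> T) (g : I -> R -> T)
    (x' : V' -> T) (g' : I' -> R -> T) :
  hausdorff_space T -> cell_dec A x g -> cell_dec A x' g' ->
  range x = range x' -> (#|V| <= #|V'|)%N /\ (#|I| <= #|I'|)%N.
Proof.
move=> hT D D' rx; split.
  have h v : exists w, x' w = x v.
    by have [w _ xw] : range x' (x v) by [rewrite -rx; exists v]; exists w.
  apply: (@leq_card _ _ (fun v => sval (cid (h v)))) => v w.
  by case: cid => a /= ea; case: cid => b /= eb ab; apply: (cd_inj D); rewrite -ea ab.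
have H := cell_dec_arc_sub hT D D' rx.
have H' := cell_dec_arc_sub hT D' D (esym rx).
have h01 : 0 < (2^-1 : R) < 1 by apply/andP; split; lra.
apply: (@leq_card _ _ (fun i => sval (cid (H i)))) => i1 i2.
case: cid => j /= Hj; case: cid => j' /= Hj' jj'; subst j'.
have [k Hk] := H' j.
have fwd i : (forall s, 0 < s < 1 -> exists2 s', 0 < s' < 1 & g i s = g' j s') -> i = k.
  move=> Hi; have [s' s'01 e1] := Hi _ h01; have [s'' s''01 e2] := Hk _ s'01.
  by have [] := cd_arc D h01 s''01 (etrans e1 e2).
by rewrite (fwd _ Hj) (fwd _ Hj').
Qed.

(** Refining each decomposition at the vertices of the other leaves both
    differences unchanged and produces two decompositions with the same vertices. *)
Lemma cell_dec_euler_unique A (V I V' I' : finType) (x : V -> T) (g : I -> R -> T)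
    (x' : V' -> T) (g' : I' -> R -> T) :
  hausdorff_space T -> cell_dec A x g -> cell_dec A x' g' ->
  (#|V| + #|I'| = #|V'| + #|I|)%N.
Proof.
move=> hT D D'.
have Ax v : A (x v) by apply/(cd_cover D); left; exists v.
have Ax' v : A (x' v) by apply/(cd_cover D'); left; exists v.
have [V1 [I1 [x1 [g1 [_ [_ [_ [D1 _ rx1 c1]]]]]]]] := cell_dec_refine D Ax'.
have [V2 [I2 [x2 [g2 [_ [_ [_ [D2 _ rx2 c2]]]]]]]] := cell_dec_refine D' Ax.
have rx : range x1 = range x2 by rewrite rx1 rx2 setUC.
have [V12 I12] := cell_dec_card hT D1 D2 rx.
have [V21 I21] := cell_dec_card hT D2 D1 (esym rx).
lia.
Qed.

(** The complex selected by [euler_char] also decomposes [A], through its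
    homeomorphism with [A]. *)
Lemma euler_char_dec A (V I : finType) (x : V -> T) (g : I -> R -> T) :
  hausdorff_space T -> cell_dec A x g ->
  euler_char R A = (#|V|%:R - #|I|%:R)%:E.
Proof.
move=> hT D; rewrite /euler_char; case: xgetP => [c _ [W [[u hu] ->]]|]; last first.
  have [u hu] := cell_dec_homeomorphism D hT.
  by move/(_ (#|V|%:R - #|I|%:R)%:E); case; exists (dec_cw D); split => //; exists u.
have [cu [w _ [uK wK]]] := hu.
have D' := @cell_dec_image R T _ _ _ _ _ (set_val \o u) (cw_cell_dec R W).
have cc : continuous (set_val \o u).
  by move=> y; apply: continuous_comp; [exact: cu|exact: initial_continuous].
have ui : injective (set_val \o u).
  by move=> y z /= /val_inj/(can_inj uK).
have ru : range (set_val \o u) = A.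
  apply/seteqP; split=> z; first by case=> y _ <-; exact: set_valP.
  move=> Az; exists (w (SigSub (mem_set Az))) => //=.
  by rewrite wK.
have := cell_dec_euler_unique hT D (eq_rect _ (fun B => cell_dec B _ _) (D' cc ui) _ ru).
move=> h; congr EFin.
by apply/eqP; rewrite subr_eq -addrA [- _ + _]addrC addrA eq_sym subr_eq -!natrD h.
Qed.

End subdivision.

(** * Euler characteristics of sublevel sets *)

Section sublevel.
Variables (R : realType).

(** By the intermediate value theorem. The parameter [b] may be an end of the
    interval, where [u] is allowed to equal [t]. *)
Lemma sign_const (u : R -> R) (t : R) : continuous u ->
  (forall s, 0 < s < 1 -> u s != t) ->
  forall a b, 0 < a < 1 -> 0 <= b <= 1 -> u a <= t -> u b <= t.
Proof.
move=> uc ut a b a01 b01; rewrite le_eqVlt (negPf (ut _ a01)) /= => uat.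
rewrite leNgt; apply/negP => tub.
case/andP: (a01) => a0 a1; case/andP: b01 => b0 b1.
have key c : Num.min a b <= c <= Num.max a b -> u c <> t.
  move=> cab uct; have [c01|c01] := boolP (0 < c < 1).
    by move: (ut _ c01); rewrite uct eqxx.
  have : c = b.
    by move: cab c01; rewrite ge_min le_max; case: (ltgtP c b) => // cb; lra.
  by move=> cb; move: tub; rewrite -cb uct ltxx.
have [ab|ba] := leP a b.
  have [|c] := @IVT R u a b t ab (continuous_subspaceT uc).
    by rewrite ge_min le_max (ltW uat) (ltW tub) orbT.
  by rewrite in_itv /= => cab; apply: key; rewrite min_l// max_r.
have [|c] := @IVT R u b a t (ltW ba) (continuous_subspaceT uc).
  by rewrite ge_min le_max (ltW uat) (ltW tub) orbT.
by rewrite in_itv /= => cab; apply: key; rewrite min_r ?max_l// ltW.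
Qed.

Lemma sign_const_ge (u : R -> R) (t : R) : continuous u ->
  (forall s, 0 < s < 1 -> u s != t) ->
  forall a b, 0 < a < 1 -> 0 <= b <= 1 -> t <= u a -> t <= u b.
Proof.
move=> uc ut a b a01 b01 tua; rewrite -lerN2.
apply: (@sign_const (\- u) (- t)) a01 b01 _ => [s|s s01|]; last by rewrite /= lerN2.
  by apply: continuousN; exact: uc.
by rewrite /= eqr_opp; exact: ut.
Qed.

Variable (T : topologicalType).
Variables (h : T -> R) (t : R).
Hypothesis hc : continuous h.

(** If the level is attained at vertices only, each open arc lies entirely on one
    side of it, which can be read off at the midpoint of the arc. *)
Lemma cell_dec_sublevel (V I : finType) (x : V -> T) (g : I -> R -> T) :
  cell_dec setT x g -> (forall z, h z = t -> range x z) ->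
  cell_dec [set z | h z <= t]
    (fun v : {v | h (x v) <= t} => x (val v))
    (fun i : {i | h (g i 2^-1) <= t} => g (val i)).
Proof.
move=> D lev.
have h01 : 0 < (2^-1 : R) < 1 by apply/andP; split; lra.
have hgc i : continuous (h \o g i).
  by move=> s; apply: continuous_comp; [exact: (cd_cont D)|exact: hc].
have nl i s : 0 < s < 1 -> (h \o g i) s != t.
  by move=> s01; apply/eqP => /lev [v _ /esym]; exact: (cd_free D).
split.
- by move=> i; exact: (cd_cont D).
- by move=> v w /(cd_inj D)/val_inj.
- move=> [i hi] b; have [v gv] := cd_end D i b.
  have hv : h (x v) <= t.
    rewrite -gv; apply: (sign_const (hgc i) (nl i) h01) hi.
    by case: b {gv}; rewrite ?ler01 ?lexx.
  by exists (exist _ v hv).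
- by move=> i s v; exact: (cd_free D).
- by move=> i j s r s01 r01 /(cd_arc D s01 r01)[/val_inj -> ->].
- move=> z; split=> [hz|].
    have [[v zv]|[i [s [s01 zs]]]] := (cd_cover D z).1 Logic.I.
      have hv : h (x v) <= t by rewrite -zv.
      by left; exists (exist _ v hv).
    have hi : h (g i 2^-1) <= t.
      apply: (sign_const (hgc i) (nl i) s01); last by rewrite /= -zs.
      by case/andP: h01 => ? ?; rewrite !ltW.
    by right; exists (exist _ i hi), s.
  case=> [[[v hv] ->]|[[i hi] [s [s01 ->]]]] //=.
  by apply: (sign_const (hgc i) (nl i) h01) hi; case/andP: s01 => ? ?; rewrite !ltW.
Qed.

Definition betw (a b : R) : bool := (a < t < b) || (b < t < a).

(** The Euler characteristic that the sublevel set has if the height is monotone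
    along each arc: an arc then belongs to the sublevel set exactly when both its
    ends do, and otherwise the part of it in the sublevel set is empty or retracts
    to an end. *)
Definition chi0 (V I : finType) (x : V -> T) (g : I -> R -> T) : R :=
  \sum_v (h (x v) <= t)%R%:R - \sum_i ((h (g i 0) <= t) && (h (g i 1) <= t))%:R.

(** The number of crossings of the level in the interior of an arc, listed by
    [l i], minus the one that is forced when the ends lie strictly on either side.
    The middle term covers the arcs whose ends lie on the level, since the interior
    of such an arc may lie above the level. *)
Definition excess (I : finType) (g : I -> R -> T) (l : I -> seq R) (i : I) : R :=
  (size (l i))%:R + ((h (g i 0) == t) && (h (g i 1) == t))%:R
  - (betw (h (g i 0)) (h (g i 1)))%:R.

Lemma card_sigR (I : finType) (P : pred I) :
  #|{: {i | P i}}|%:R = \sum_i (P i)%:R :> R.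
Proof. by rewrite card_sig -sum1_card natr_sum big_mkcond /=; apply: eq_bigr => i _; rewrite inE; case: (P i). Qed.

(** Without interior crossings, [chi0] counts an arc wrongly only if both its ends
    are on the level and its interior is above. *)
Lemma euler_sublevel_uncrossed (V I : finType) (x : V -> T) (g : I -> R -> T) :
  hausdorff_space T -> cell_dec setT x g ->
  (forall i s, 0 < s < 1 -> h (g i s) != t) ->
  exists c : R, euler_char R [set z | h z <= t] = c%:E /\
    0 <= c - chi0 x g <= \sum_i excess g (fun=> [::]) i.
Proof.
move=> hT D nl.
have h01 : 0 < (2^-1 : R) < 1 by apply/andP; split; lra.
have lev z : h z = t -> range x z.
  have [[v ->]|[i [s [s01 ->]]]] := (cd_cover D z).1 Logic.I; first by exists v.
  by move/eqP => e; move: (nl i s s01); rewrite e.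
have hgc i : continuous (h \o g i).
  by move=> s; apply: continuous_comp; [exact: (cd_cont D)|exact: hc].
exists (#|{: {v | h (x v) <= t}}|%:R - #|{: {i | h (g i 2^-1) <= t}}|%:R); split.
  exact: euler_char_dec hT (cell_dec_sublevel D lev).
have e (p q r : R) : p - q - (p - r) = r - q by ring.
rewrite !card_sigR /chi0 e -sumrB.
have key i : 0 <= (((h (g i 0) <= t) && (h (g i 1) <= t))%:R - (h (g i 2^-1) <= t)%R%:R : R)
   <= excess g (fun=> [::]) i.
  have l0 : 0 <= (0 : R) <= 1 by rewrite lexx ler01.
  have l1 : 0 <= (1 : R) <= 1 by rewrite lexx ler01.
  have le0 := sign_const (hgc i) (nl i) h01 l0.
  have le1 := sign_const (hgc i) (nl i) h01 l1.
  have ge0 := sign_const_ge (hgc i) (nl i) h01 l0.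
  have ge1 := sign_const_ge (hgc i) (nl i) h01 l1.
  rewrite /excess /betw /=; case: (leP (h (g i 2^-1)) t) => hi.
    move: (le0 hi) (le1 hi) => /= a0 a1.
    rewrite a0 a1 [t < h (g i 0)]ltNge a0 [t < h (g i 1)]ltNge a1 /= !andbF /=.
    by apply/andP; split; first lra; case: (_ && _) => /=; lra.
  move: (ge0 (ltW hi)) (ge1 (ltW hi)) => /= a0 a1.
  rewrite [h (g i 0) < t]ltNge a0 [h (g i 1) < t]ltNge a1 /= !eq_le a0 a1 !andbT.
  by apply/andP; split; case: (_ && _) => /=; lra.
by rewrite sumr_ge0 ?ler_sum// => i _; have /andP[] := key i.
Qed.

(** Cutting an arc at a crossing changes neither the sublevel set nor the validity
    of the bound, as a comparison of [chi0] and [excess] before and after the cut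
    shows; the number of interior crossings decreases by one at each cut. *)
Lemma euler_sublevel (V I : finType) (x : V -> T) (g : I -> R -> T)
    (l : I -> seq R) :
  hausdorff_space T -> cell_dec setT x g -> (forall i, uniq (l i)) ->
  (forall i s, (s \in l i) = (0 < s < 1) && (h (g i s) == t)) ->
  exists c : R, euler_char R [set z | h z <= t] = c%:E /\
    0 <= c - chi0 x g <= \sum_i excess g l i.
Proof.
move=> hT.
move sn : (\sum_i size (l i))%N => n; elim: n => [|n IHn] in V I x g l sn *.
  move=> D _ lP; have l0 : l = fun=> [::].
    apply/funext => i; apply/nilP; rewrite /nilp.
    by move/eqP: sn; rewrite sum_nat_eq0 => /forallP/(_ i).
  rewrite l0; apply: euler_sublevel_uncrossed => // i s s01.
  by apply/negP => e; have := lP i s; rewrite s01 e l0.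
move=> D lu lP.
have [i0 li0] : exists i0, l i0 != [::].
  apply/existsP; apply: contraPT sn => /existsPn l0; rewrite big1// => i _.
  by have /negPn/eqP -> := l0 i.
case E : (l i0) li0 => [//|p l'] _.
have := lP i0 p; rewrite E mem_head => /esym/andP[p01 /eqP hp].
case/andP: (p01) => p0 p1.
have p1' : 1 - p != 0 by rewrite subr_eq0 gt_eqF.
have := lu i0; rewrite E /= => /andP[pl' ul'].
(* The crossings of the two pieces, in their own parameters. *)
pose l2 (o : option I) : seq R := match o with
  | Some i => if i == i0 then [seq q / p | q <- l i0 & q < p] else l i
  | None => [seq (q - p) / (1 - p) | q <- l i0 & p < q] end.
have sl : (size [seq q / p | q <- l i0 & (q < p)%R] +
    size [seq (q - p) / (1 - p) | q <- l i0 & (p < q)%R])%N = size l'.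
  rewrite E /= ltxx !size_map !size_filter.
  have -> : count (fun q => p < q) l' = count (predC (fun q => q < p)) l'.
    apply: eq_in_count => q ql /=; rewrite -leNgt le_eqVlt.
    by case: eqP => // pq; move: pl'; rewrite pq ql.
  exact: count_predC.
have s2 : (\sum_o size (l2 o) = n)%N.
  rewrite (bigD1 None) //= (reindex_omap Some id) /=; last by case.
  under eq_bigl do rewrite eqxx.
  move: sn; rewrite (bigD1 i0) //= [in X in _ -> X](bigD1 i0) //= eqxx.
  rewrite (_ : size (l i0) = (size l').+1) ?E// addSn => -[<-].
  rewrite addnA [(_ + size [seq _ / p | _ <- _ & _])%N]addnC -E sl.
  by congr addn; apply: eq_bigr => i /negPf ->.
have [||c [ec cE]] := IHn _ _ _ _ l2 s2 (cell_dec_split i0 p01 D).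
- move=> [i|] /=.
    case: ifP => _ //; rewrite map_inj_uniq ?filter_uniq//.
    by apply: mulIf; rewrite invr_eq0 gt_eqF.
  rewrite map_inj_uniq ?filter_uniq// => a b /(mulIf _) ab.
  by apply/(addIr (- p))/ab; rewrite invr_eq0.
- move=> [i|] s; rewrite /split_arc /=.
    case: (eqVneq i i0) => [->|_]; last exact: lP.
    apply/mapP/andP => [[q]|[/andP[s0 s1] hs]].
      rewrite mem_filter lP => /and3P[qp /andP[q0 q1] hq] ->.
      by rewrite divr_gt0//= ltr_pdivrMr// mul1r qp mulrC divfK// gt_eqF.
    exists (p * s); last by rewrite [p * s]mulrC mulfK// gt_eqF.
    rewrite mem_filter lP hs andbT.
    by apply/andP; split; [|apply/andP; split]; nra.
  apply/mapP/andP => [[q]|[/andP[s0 s1] hs]].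
    rewrite mem_filter lP => /and3P[qp /andP[q0 q1] hq] ->.
    rewrite divr_gt0 ?subr_gt0//= ltr_pdivrMr ?subr_gt0// mul1r ltrD2r q1.
    by rewrite [(1 - p) * _]mulrC divfK// [p + _]addrC subrK.
  exists (p + (1 - p) * s).
    rewrite mem_filter lP hs andbT.
    by apply/andP; split; [|apply/andP; split]; nra.
  by rewrite addrAC subrr add0r [(1 - p) * s]mulrC mulfK.
exists c; split=> //; move: cE.
pose F i : R := ((h (g i 0) <= t) && (h (g i 1) <= t))%:R.
pose S := \sum_(i | i != i0) F i.
pose S' := \sum_(i | i != i0) excess g l i.
have ev : \sum_o (h (split_pt x g i0 p o) <= t)%R%:R =
    1 + \sum_v (h (x v) <= t)%R%:R :> R by rewrite sum_option /= hp lexx.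
have e1 : \sum_o ((h (split_arc g i0 p o 0) <= t) &&
      (h (split_arc g i0 p o 1) <= t))%:R =
    (h (g i0 1) <= t)%R%:R + ((h (g i0 0) <= t)%R%:R + S) :> R.
  rewrite sum_option (bigD1 i0) //= /split_arc /= eqxx !mulr0 !mulr1 addr0.
  rewrite [p + (1 - p)]addrC subrK hp lexx andbT /=; congr (_ + (_ + _)).
  by apply: eq_bigr => i /negPf ->.
have e2 : \sum_i F i = F i0 + S by rewrite (bigD1 i0).
have e3 : \sum_o excess (split_arc g i0 p) l2 o =
    (size (l2 None))%:R + (h (g i0 1) == t)%:R
    + ((size (l2 (Some i0)))%:R + (h (g i0 0) == t)%:R + S').
  rewrite sum_option (bigD1 i0) //= /excess /split_arc /= eqxx !mulr0 !mulr1 addr0.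
  rewrite [p + (1 - p)]addrC subrK hp eqxx andbT /= /betw ltxx !andbF /= !subr0.
  congr (_ + (_ + _)); apply: eq_bigr => i /negPf ii0.
  by rewrite /excess ii0.
have e4 : \sum_i excess g l i = excess g l i0 + S' by rewrite (bigD1 i0).
have e5 : (size (l i0))%:R = 1 + (size (l2 None))%:R + (size (l2 (Some i0)))%:R :> R.
  by rewrite -addrA -natrD addnC /l2 eqxx sl E /= -natr1 addrC.
rewrite /chi0 ev e1 e2 e3 e4 {1}/excess e5 /F /betw.
by case: (ltgtP (h (g i0 0)) t) => h0; case: (ltgtP (h (g i0 1)) t) => h1 /=;
  move=> /andP[? ?]; apply/andP; split; lra.
Qed.

End sublevel.

(** * Counting crossings of levels *)

Section indicatrix.
Variable R : realType.
Notation mu := (@lebesgue_measure R).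

(** The integral of a nonnegative function is a supremum over the simple functions
    below it, so that it is monotone for arbitrary functions, such as the distance
    between two Euler characteristics as a function of the level. *)
Lemma le_integral_setT (f g : R -> \bar R) (D : set R) :
  (forall t, 0 <= f t)%E -> (forall t, f t <= g t)%E ->
  (\int[mu]_(t in D) f t <= \int[mu]_t g t)%E.
Proof.
move=> f0 fg; rewrite !ge0_integralE; last 2 first.
- by move=> t _; exact: le_trans (fg t).
- by move=> t _; exact: f0.
apply: ereal_sup_le => _ [h /= hf <-]; exists h => //= t.
apply: (le_trans (hf t)); rewrite patch_setT; apply: le_trans (fg t).
by rewrite /patch; case: ifP.
Qed.

Lemma near_all_seq (T : eqType) (F : set_system nat) {FF : Filter F} (l : seq T)
    (Q : T -> nat -> Prop) :
  (forall x, x \in l -> \forall n \near F, Q x n) ->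
  \forall n \near F, forall x, x \in l -> Q x n.
Proof.
elim: l => [|x l IHl] H; first exact: nearW.
have Hx := H x (mem_head _ _).
have /IHl Hl : forall y, y \in l -> \forall n \near F, Q y n.
  by move=> y yl; apply: H; rewrite in_cons yl orbT.
apply: filterS2 Hx Hl => n hx hl y.
by rewrite in_cons => /orP[/eqP->|] //; exact: hl.
Qed.

(** The number of intervals, among [n.+1] equal ones, whose image may contain [t]:
    a function with Lipschitz constant [lam] stays on such an interval within
    [lam / (2 * n.+1)] of its value at the midpoint. *)
Definition cell_count (u : R -> R) (lam : R) (n : nat) (t : R) : R :=
  \sum_(j < n.+1) (`|t - u ((j%:R + 2^-1) / n.+1%:R)| <=
                   lam / (2 * n.+1%:R))%R%:R.

(** Solutions that are more than the length of an interval apart lie in different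
    intervals, each of which is counted. *)
Lemma distinct_cells (u : R -> R) (lam t : R) (l : seq R) (n : nat) :
  (forall s s', 0 <= s <= 1 -> 0 <= s' <= 1 ->
    `|u s - u s'| <= lam * `|s - s'|) -> 0 <= lam -> uniq l ->
  (forall s, s \in l -> 0 <= s < 1 /\ u s = t) ->
  (forall s, s \in l -> forall s', s' \in l -> s != s' ->
     n.+1%:R^-1 < `|s - s'|) ->
  (size l)%:R <= cell_count u lam n t.
Proof.
move=> ulip lam0 ul lP lsep.
pose c (s : R) : 'I_n.+1 := inord (Num.truncn (n.+1%:R * s)).
have N0 : 0 < n.+1%:R :> R by rewrite ltr0n.
have cP s : s \in l -> (c s)%:R <= n.+1%:R * s < (c s)%:R + 1.
  move=> /lP[/andP[s0 s1] _]; have Ns0 : 0 <= n.+1%:R * s by rewrite mulr_ge0// ltW.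
  rewrite inordK; first by rewrite natr1; exact: truncn_itv.
  by rewrite truncn_lt_nat// -[ltRHS]mulr1 ltr_pM2l.
have cinj : {in l &, injective c}.
  move=> s s' sl s'l cc; apply/eqP; apply/negPn/negP => /(lsep s sl s' s'l).
  have := cP s sl; have := cP s' s'l; rewrite cc.
  move: (c s')%:R => k /andP[h1 h2] /andP[h3 h4].
  apply/negP; rewrite -leNgt -[leRHS]mul1r ler_pdivlMr//.
  rewrite -[X in _ * X](gtr0_norm N0) -normrM ler_norml.
  by apply/andP; split; nra.
rewrite /cell_count -natr_sum ler_nat -(size_map c).
rewrite -big_mkcond sum1_card cardE.
apply: uniq_leq_size; first by rewrite map_inj_in_uniq.
move=> _ /mapP[s sl ->]; rewrite mem_enum /in_mem /=.
have /andP[h1 h2] := cP s sl; have [/andP[s0 s1] us] := lP s sl.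
set k : R := (c s)%:R in h1 h2 *.
have k0 : 0 <= k by rewrite ler0n.
have kN : k + 1 <= n.+1%:R by rewrite natr1 ler_nat.
have m01 : 0 <= (k + 2^-1) / n.+1%:R <= 1.
  by rewrite divr_ge0 ?(ltW N0)//= ?ler_pdivrMr//; lra.
rewrite -us; apply: le_trans (ulip _ _ _ m01) _; first by rewrite s0 ltW.
apply: ler_wpM2l => //; rewrite invfM -(ler_pM2r N0) divfK ?gt_eqF//.
rewrite -[X in _ * X](gtr0_norm N0) -normrM mulrBl divfK ?gt_eqF// ler_norml.
by apply/andP; split; lra.
Qed.

Lemma cell_count_ge0 u lam n t : 0 <= cell_count u lam n t.
Proof. exact: sumr_ge0. Qed.

Lemma cell_countE u lam n t :
  cell_count u lam n t = \sum_(j < n.+1)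
    \1_(`[u ((j%:R + 2^-1) / n.+1%:R) - lam / (2 * n.+1%:R),
          u ((j%:R + 2^-1) / n.+1%:R) + lam / (2 * n.+1%:R)]) t.
Proof.
apply: eq_bigr => j _; rewrite indicE mem_setE in_itv /=.
by rewrite ler_distl.
Qed.

Lemma measurable_cell_count u lam n :
  measurable_fun [set: R] (EFin \o cell_count u lam n).
Proof.
apply/measurable_EFinP.
rewrite (funext (cell_countE u lam n)).
by apply: measurable_sum => j; exact: measurable_indic.
Qed.

Lemma integral_indic_itv (a b : R) : a <= b ->
  (\int[mu]_t (\1_(`[a, b] : set R) t)%:E = (b - a)%:E)%E.
Proof.
move=> ab; rewrite integral_indic// setIT.
apply: etrans (lebesgue_measure_itv `[a, b]) _ => /=; rewrite lte_fin.
case: ifPn => [_|]; first by rewrite -EFinB.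
by rewrite -leNgt => ba; congr EFin; lra.
Qed.

Lemma integral_cell_count u lam n : 0 <= lam ->
  (\int[mu]_t (cell_count u lam n t)%:E = lam%:E)%E.
Proof.
move=> lam0; under eq_integral do rewrite cell_countE -sumEFin.
rewrite ge0_integral_sum//; last first.
  by move=> j; apply/measurable_EFinP; exact: measurable_indic.
rewrite (eq_bigr (fun=> (lam / n.+1%:R)%:E)) => [|j _]; last first.
  rewrite integral_indic_itv; last by rewrite lerD2l; apply: (@le_trans _ _ 0); rewrite ?oppr_le0 divr_ge0// mulr_ge0.
  congr EFin; have : n.+1%:R != 0 :> R by rewrite pnatr_eq0.
  by move: (n.+1%:R) (u _) => N c N0; field.
rewrite sumEFin; congr EFin; rewrite sumr_const card_ord -[LHS]mulr_natr.
by rewrite divfK// pnatr_eq0.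
Qed.

(** Banach's bound on the number of solutions of [u s = t], integrated over [t].
    Each [cell_count] has integral [lam]; their inferior limit has integral at most
    [lam] by Fatou's lemma, and dominates the length of every list of solutions. The
    parameter 1 is left out because the intervals that are counted contain their
    left ends only. *)
Lemma indicatrix (u : R -> R) (lam : R) : 0 <= lam ->
  (forall s s', 0 <= s <= 1 -> 0 <= s' <= 1 ->
    `|u s - u s'| <= lam * `|s - s'|) ->
  exists G : R -> \bar R, [/\ measurable_fun [set: R] G, forall t, (0 <= G t)%E,
    (\int[mu]_t G t <= lam%:E)%E &
    forall t l, uniq l -> (forall s, s \in l -> 0 <= s < 1 /\ u s = t) ->
      ((size l)%:R%:E <= G t)%E].
Proof.
move=> lam0 ulip.
pose Gn n t : \bar R := (cell_count u lam n t)%:E.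
have Gn0 n t : (0 <= Gn n t)%E by rewrite lee_fin cell_count_ge0.
exists (fun t => limn_einf (Gn ^~ t)); split.
- apply: (@emeasurable_fun_cvg _ _ _ _ (fun n t => einfs (Gn ^~ t) n)).
    by apply: measurable_fun_einfs => n; exact: measurable_cell_count.
  by move=> t _; rewrite limn_einf_lim; exact: is_cvg_einfs.
- move=> t; rewrite limn_einf_lim; apply: lime_ge; first exact: is_cvg_einfs.
  by apply: nearW => n; apply: le_ereal_inf_tmp => _ [k _ <-].
- have mG n : measurable_fun [set: R] (Gn n) by exact: measurable_cell_count.
  apply: le_trans (fatou mu measurableT mG (fun n t _ => Gn0 n t)) _.
  rewrite limn_einf_lim; apply: lime_le; first exact: is_cvg_einfs.
  apply: nearW => n; apply: ge_ereal_inf; exists (\int[mu]_t Gn n t)%E.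
    by exists n => /=.
  by rewrite integral_cell_count.
- move=> t l ul lP; rewrite limn_einf_lim; apply: lime_ge; first exact: is_cvg_einfs.
  have : \forall n \near \oo, forall s, s \in l -> forall s', s' \in l -> s != s' ->
      n.+1%:R^-1 < `|s - s'| :> R.
    apply: near_all_seq => s sl; apply: near_all_seq => s' s'l.
    have [->|ss'] := eqVneq s s'; first exact: nearW.
    have d0 : 0 < `|s - s'| by rewrite normr_gt0 subr_eq0.
    exists (Num.truncn `|s - s'|^-1) => // n /= hn _.
    rewrite -[ltRHS]invrK ltf_pV2 ?posrE ?invr_gt0//.
    by apply: lt_le_trans (truncnS_gt _) _; rewrite ler_nat ltnS.
  case=> N _ HN; exists N => // n /= Nn; apply: le_ereal_inf_tmp => _ [k /= nk <-].
  by rewrite lee_fin; apply: (distinct_cells ulip lam0 ul lP); apply: HN => /=; apply: leq_trans nk.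
Qed.

End indicatrix.

Section fold.
Variable R : realType.
Notation mu := (@lebesgue_measure R).

Lemma betwE (a b t : R) : betw t a b = (t \in `]Num.min a b, Num.max a b[).
Proof.
rewrite /betw in_itv /= gt_min lt_max.
by case: (ltgtP a t) => //; case: (ltgtP b t).
Qed.

Lemma integral_betw (a b : R) :
  (\int[mu]_t (\1_([set t | betw t a b]) t)%:E = `|a - b|%:E)%E.
Proof.
have -> : [set t | betw t a b] = `]Num.min a b, Num.max a b[%classic.
  by apply/seteqP; split=> t /=; rewrite betwE.
rewrite integral_indic// setIT.
apply: etrans (lebesgue_measure_itv `]Num.min a b, Num.max a b[) _ => /=.
rewrite lte_fin; case: (ltgtP a b) => [ab|ab|->].
- by rewrite ab -EFinB ltr0_norm ?subr_lt0// opprB.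
- by rewrite ab -EFinB gtr0_norm ?subr_gt0.
- by rewrite ltxx subrr normr0.
Qed.

(** [H] is the indicatrix minus the indicator of the levels strictly between
    [u 0] and [u 1]; on these the indicatrix is at least 1 by the intermediate value
    theorem, and their measure is [`|u 0 - u 1|]. The indicatrix counts the solution
    0, which pays for the term where both ends are on the level. Where it is finite,
    there are finitely many solutions. *)
Lemma fold_excess (u : R -> R) (lam : R) : 0 <= lam -> continuous u ->
  (forall s s', 0 <= s <= 1 -> 0 <= s' <= 1 ->
    `|u s - u s'| <= lam * `|s - s'|) ->
  exists H : R -> \bar R, [/\ measurable_fun [set: R] H,
    forall t, (0 <= H t)%E, (\int[mu]_t H t <= (lam - `|u 0 - u 1|)%:E)%E,
    (forall t l, uniq l -> (forall s, s \in l -> 0 < s < 1 /\ u s = t) ->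
      (((size l)%:R + ((u 0 == t) && (u 1 == t))%:R - (betw t (u 0) (u 1))%:R)%:E
        <= H t)%E) &
    forall t, (H t < +oo)%E -> exists2 l, uniq l &
      forall s, (s \in l) = (0 < s < 1) && (u s == t)].
Proof.
move=> lam0 uc /(indicatrix lam0)[G [mG G0 iG Gl]].
pose B t : \bar R := (\1_([set t | betw t (u 0) (u 1)]) t)%:E.
have BE t : B t = (betw t (u 0) (u 1))%:R%:E.
  by rewrite /B indicE; congr ((_ : bool)%:R%:E); apply/idP/idP; rewrite inE.
have mB : measurable_fun [set: R] B.
  apply/measurable_EFinP/measurable_indic.
  have -> : [set t | betw t (u 0) (u 1)] =
      `]Num.min (u 0) (u 1), Num.max (u 0) (u 1)[%classic.
    by apply/seteqP; split=> t /=; rewrite betwE.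
  exact: measurable_itv.
have l01 : 0 <= (1 : R) by exact: ler01.
have GB t : (B t <= G t)%E.
  rewrite BE; case: (boolP (betw _ _ _)) => bt; last exact: G0.
  have [|c] := @IVT R u 0 1 t l01 (continuous_subspaceT uc).
    by move: bt; rewrite betwE in_itv /= => /andP[/ltW-> /ltW->].
  rewrite in_itv /= => /andP[c0 c1] uct.
  apply: (Gl t [:: c]) => // s; rewrite inE => /eqP ->; split=> //; rewrite c0 /=.
  rewrite lt_neqAle c1 andbT; apply/eqP => c1'; move: bt.
  by rewrite /betw -uct c1' ltxx !andbF.
have D0 t : (0 <= G t - B t)%E by rewrite sube_ge0 ?GB// BE orbT.
exists (fun t => G t - B t)%E; split.
- exact: emeasurable_funB.
- exact: D0.
- have : (\int[mu]_t G t = \int[mu]_t (G t - B t) + \int[mu]_t B t)%E.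
    have B0 t : (0 <= B t)%E by rewrite BE lee_fin.
    rewrite -(ge0_integralD mu measurableT (fun t _ => D0 t)
      (emeasurable_funB mG mB) (fun t _ => B0 t) mB).
    by apply: eq_integral => t _; rewrite subeK// BE.
  rewrite integral_betw => e; move: iG; rewrite e.
  by rewrite EFinB leeBrDr.
- move=> t l ul lP; rewrite BE EFinB; apply: leeB => //.
  case: (boolP (_ && _)) => [/andP[/eqP u0 /eqP u1]|_]; last first.
    rewrite addr0; apply: Gl => // s /lP[/andP[s0 s1] us].
    by rewrite ltW.
  rewrite natr1; apply: (Gl t (0 :: l)) => /=.
    by rewrite ul andbT; apply/negP => /lP[]; rewrite ltxx.
  move=> s; rewrite in_cons => /orP[/eqP->|/lP[/andP[s0 s1] us]].
    by rewrite lexx ltr01.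
  by rewrite ltW.
- move=> t; rewrite BE => Gfin.
  have {Gfin} Gfin : (G t < +oo)%E.
    by rewrite -(@subeK _ (G t) (betw t (u 0) (u 1))%:R%:E)// lte_add_pinfty// ltry.
  (* A list of solutions of maximal size contains all of them. *)
  pose Q n := `[< exists l, [/\ uniq l, size l = n &
    forall s, s \in l -> 0 < s < 1 /\ u s = t] >].
  have Q0 : exists n, Q n by exists 0%N; apply/asboolP; exists [::].
  have Qb n : Q n -> (n <= Num.truncn (fine (G t)))%N.
    move=> /asboolP[l [ul <- lP]].
    have := Gl t l ul; have : (G t \is a fin_num) by rewrite ge0_fin_numE.
    case: (G t) (G0 t) => // r r0 _ /=; rewrite lee_fin => h.
    rewrite truncn_ge_nat// h// => s /lP[/andP[s0 s1] us].
    by rewrite ltW.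
  case: (ex_maxnP Q0 Qb) => n /asboolP[l [ul sl lP]] nmax.
  exists l => // s; apply/idP/idP => [/lP[-> ->]|/andP[s01 /eqP us]].
    by rewrite eqxx.
  apply/negPn/negP => sl'.
  have : Q n.+1.
    apply/asboolP; exists (s :: l); split=> /=; [by rewrite sl'|by rewrite sl|].
    by move=> r; rewrite in_cons => /orP[/eqP->|/lP].
  by move=> /nmax; rewrite ltnn.
Qed.

End fold.

(** * Mean difference of Euler characteristics over the levels *)

Section euler_difference.
Variable R : realType.
Notation mu := (@lebesgue_measure R).

Definition jump (a b : R) : R -> R := \1_(`[Num.min a b, Num.max a b[).

Lemma jumpE a b t : jump a b t = `|(a <= t)%R%:R - (b <= t)%R%:R|.
Proof.
rewrite /jump indicE mem_setE in_itv /= ge_min lt_max.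
by case: (leP a t) => ?; case: (leP b t) => ? /=; rewrite ?subrr ?subr0 ?sub0r ?normrN ?normr0 ?normr1.
Qed.

Lemma measurable_jump a b : measurable_fun [set: R] (EFin \o jump a b).
Proof. by apply/measurable_EFinP; exact: measurable_indic. Qed.

Lemma integral_jump a b : (\int[mu]_t (jump a b t)%:E = `|a - b|%:E)%E.
Proof.
rewrite integral_indic// setIT.
apply: etrans (lebesgue_measure_itv `[Num.min a b, Num.max a b[) _ => /=.
rewrite lte_fin; case: (ltgtP a b) => [ab|ab|->].
- by rewrite ab -EFinB ltr0_norm ?subr_lt0// opprB.
- by rewrite ab -EFinB gtr0_norm ?subr_gt0.
- by rewrite ltxx subrr normr0.
Qed.

Variables (T : topologicalType) (V I : finType) (x : V -> T) (g : I -> R -> T).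
Hypotheses (hT : hausdorff_space T) (D : cell_dec setT x g).

(** A vertex is counted differently for the levels between its two heights, and an
    arc for those between the larger heights of its ends. *)
Lemma chi0_diff (h h' : T -> R) t :
  `|chi0 h t x g - chi0 h' t x g| <= \sum_v jump (h (x v)) (h' (x v)) t +
    \sum_i jump (Num.max (h (g i 0)) (h (g i 1)))
                (Num.max (h' (g i 0)) (h' (g i 1))) t.
Proof.
rewrite /chi0 opprB addrACA [- _ + _]addrC addrACA -!sumrB.
apply: (le_trans (ler_normD _ _)); apply: lerD; apply: (le_trans (ler_norm_sum _ _ _));
  apply: ler_sum => i _; rewrite jumpE// !ge_max.
by rewrite distrC.
Qed.

Definition arc_lip (h : T -> R) (lam : I -> R) : Prop :=
  forall i, 0 <= lam i /\ forall s s', 0 <= s <= 1 -> 0 <= s' <= 1 ->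
    `|h (g i s) - h (g i s')| <= lam i * `|s - s'|.

Lemma sublevel_excess (h : T -> R) (lam : I -> R) : continuous h ->
  arc_lip h lam -> exists H : R -> \bar R, [/\ measurable_fun [set: R] H,
    forall t, (0 <= H t)%E,
    (\int[mu]_t H t <= (\sum_i (lam i - `|h (g i 0) - h (g i 1)|))%:E)%E &
    forall t, (H t < +oo)%E -> exists2 c : R,
      euler_char R [set z | h z <= t] = c%:E &
      (`|c - chi0 h t x g|%:E <= H t)%E].
Proof.
move=> hc hl.
have hgc i : continuous (h \o g i).
  by move=> s; apply: continuous_comp; [exact: (cd_cont D)|exact: hc].
pose F i := fold_excess (hl i).1 (hgc i) (hl i).2.
pose H i := sval (cid (F i)).
have HP i := svalP (cid (F i)).
have H0 i t : (0 <= H i t)%E by have [_ h0 _ _ _] := HP i; exact: h0.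
exists (fun t => (\sum_i H i t)%E); split.
- by apply: emeasurable_sum => i; have [] := HP i.
- by move=> t; apply: sume_ge0 => i _; exact: H0.
- have mH i : measurable_fun [set: R] (H i) by have [] := HP i.
  rewrite (ge0_integral_sum mu measurableT mH (fun i t _ => H0 i t)).
  by rewrite -sumEFin; apply: lee_sum => i _; have [_ _ h1 _ _] := HP i.
- move=> t Hfin.
  have Hi i : (H i t < +oo)%E.
    apply: le_lt_trans Hfin; rewrite (bigD1 i)//=; apply: leeDl; apply: sume_ge0 => j _.
    exact: H0.
  have L i : exists l, uniq l /\
      forall s, (s \in l) = (0 < s < 1) && (h (g i s) == t).
    by have [_ _ _ _ /(_ t (Hi i))[l ul lP]] := HP i; exists l.
  pose l i := sval (cid (L i)).
  have [|i s|c [ec /andP[c0 c1]]] := euler_sublevel (t := t) hc (l := l) hT D.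
  + by move=> i; rewrite /l; case: cid => ? [].
  + by rewrite /l; case: cid => ? [].
  exists c => //; rewrite ger0_norm//; apply: (@le_trans _ _ (\sum_i excess h t g l i)%:E).
    by rewrite lee_fin.
  rewrite -sumEFin; apply: lee_sum => i _; have [_ _ _ + _] := HP i; apply.
    by rewrite /l; case: cid => ? [].
  move=> s; rewrite /l; case: cid => li [_ /= ->] /andP[s01 /eqP <-].
  by [].
Qed.

(** Where the dominating functions of [sublevel_excess] are finite, both Euler
    characteristics are within these of their [chi0]; elsewhere the bound is
    infinite. *)
Lemma euler_diff_integral (h h' : T -> R) (lam lam' : I -> R) :
  continuous h -> continuous h' -> arc_lip h lam -> arc_lip h' lam' ->
  forall S : set R,
  (\int[mu]_(t in S) `|euler_char R [set z | (h z <= t)%R] -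
                       euler_char R [set z | (h' z <= t)%R]| <=
   (\sum_v `|h (x v) - h' (x v)| +
    \sum_i `|Num.max (h (g i 0)) (h (g i 1)) - Num.max (h' (g i 0)) (h' (g i 1))| +
    (\sum_i (lam i - `|h (g i 0) - h (g i 1)|) +
     \sum_i (lam' i - `|h' (g i 0) - h' (g i 1)|)))%:E)%E.
Proof.
move=> hc h'c hl h'l S.
have [H [mH H0 iH HP]] := sublevel_excess hc hl.
have [H' [mH' H'0 iH' H'P]] := sublevel_excess h'c h'l.
pose J1 t : \bar R := (\sum_v (jump (h (x v)) (h' (x v)) t)%:E)%E.
pose J2 t : \bar R := (\sum_i (jump (Num.max (h (g i 0)) (h (g i 1)))
                 (Num.max (h' (g i 0)) (h' (g i 1))) t)%:E)%E.
have mJ1 : measurable_fun [set: R] J1.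
  by apply: emeasurable_sum => v; exact: measurable_jump.
have mJ2 : measurable_fun [set: R] J2.
  by apply: emeasurable_sum => v; exact: measurable_jump.
have j0 a b t : (0 <= (jump a b t)%:E)%E by rewrite lee_fin jumpE.
have J10 t : (0 <= J1 t)%E by apply: sume_ge0.
have J20 t : (0 <= J2 t)%E by apply: sume_ge0.
have iJ1 : (\int[mu]_t J1 t = (\sum_v `|h (x v) - h' (x v)|)%:E)%E.
  rewrite ge0_integral_sum//; last by move=> v; exact: measurable_jump.
  by rewrite -sumEFin; apply: eq_bigr => v _; rewrite integral_jump.
have iJ2 : (\int[mu]_t J2 t = (\sum_i `|Num.max (h (g i 0)) (h (g i 1)) -
    Num.max (h' (g i 0)) (h' (g i 1))|)%:E)%E.
  rewrite ge0_integral_sum//; last by move=> v; exact: measurable_jump.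
  by rewrite -sumEFin; apply: eq_bigr => v _; rewrite integral_jump.
apply: (@le_trans _ _ (\int[mu]_t ((J1 t + J2 t) + (H t + H' t)))%E).
  apply: le_integral_setT => t //.
  have [Ht|] := ltP (H t) +oo%E; last first.
    rewrite leye_eq => /eqP ->; rewrite addye; last by rewrite gt_eqF// (lt_le_trans _ (H'0 t)).
    by rewrite addey ?leey// gt_eqF// (lt_le_trans _ (adde_ge0 (J10 t) (J20 t))).
  have [H't|] := ltP (H' t) +oo%E; last first.
    rewrite leye_eq => /eqP ->; rewrite [(H t + _)%E]addey; last by rewrite gt_eqF// (lt_le_trans _ (H0 t)).
    by rewrite addey ?leey// gt_eqF// (lt_le_trans _ (adde_ge0 (J10 t) (J20 t))).
  have [c -> cH] := HP t Ht; have [c' -> cH'] := H'P t H't.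
  rewrite -EFinB abse_EFin.
  apply: (@le_trans _ _ (`|chi0 h t x g - chi0 h' t x g|%:E +
     (`|c - chi0 h t x g|%:E + `|c' - chi0 h' t x g|%:E))%E).
    rewrite -!EFinD lee_fin [`|c' - _|]distrC.
    have -> : c - c' = chi0 h t x g - chi0 h' t x g +
        (c - chi0 h t x g + (chi0 h' t x g - c')) by ring.
    by apply: le_trans (ler_normD _ _) _; rewrite lerD2l; exact: ler_normD.
  apply: leeD; last exact: leeD.
  by rewrite /J1 /J2 !sumEFin -EFinD lee_fin chi0_diff.
rewrite (ge0_integralD mu measurableT
  (fun t _ => adde_ge0 (J10 t) (J20 t)) (emeasurable_funD mJ1 mJ2)
  (fun t _ => adde_ge0 (H0 t) (H'0 t)) (emeasurable_funD mH mH')).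
rewrite ge0_integralD// ge0_integralD// !EFinD; apply: leeD; last exact: leeD.
by rewrite iJ1 iJ2.
Qed.

End euler_difference.

(** * Calculus on the unit interval *)

Section calculus01.
Variable R : realType.

(** The scalar form of the convergence of [quotient01]. *)
Definition diffq_cvg (h : R -> R) (x l : R) : Prop :=
  (y - x)^-1 * (h y - h x) @[y --> within (unit_itv R) x^'] --> l.

(** Near an interior point the restriction to the unit interval is immaterial. *)
Lemma diffq_is_derive (h : R -> R) (x l : R) : 0 < x < 1 ->
  diffq_cvg h x l -> is_derive x 1 h l.
Proof.
move=> x01 hx.
have sh : (fun r : R => r + x) @ 0^' --> within (unit_itv R) x^'.
  move=> U /= [e /= e0 HU].
  have : \forall r \near (0 : R), `|r| < Num.min e (Num.min x (1 - x)).
    exists (Num.min e (Num.min x (1 - x))).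
      by rewrite /= !lt_min e0 /=; case/andP: x01 => ? ?; rewrite subr_gt0; apply/andP.
    by move=> r /=; rewrite sub0r normrN.
  apply: filterS => r /=; rewrite !lt_min => /and3P[re r1 r2] r0.
  apply: (HU (r + x)) => /=.
  - by rewrite opprD addrCA subrr addr0 normrN.
  - by apply: contra_neq r0 => /eqP; rewrite -subr_eq0 addrK => /eqP.
  - rewrite /unit_itv /= in_itv /=; move: r1 r2; rewrite !ltr_norml => /andP[? ?] /andP[? ?].
    by apply/andP; split; lra.
have key : r^-1 *: ((h \o shift x) (r *: (1 : R)) - h x) @[r --> 0^'] --> l.
  have := cvg_comp _ _ sh hx; apply: cvg_trans.
  apply: near_eq_cvg; apply: nearW => r /=.
  by rewrite addrK [r *: 1]mulr1.
by split; [apply/cvg_ex; exists l|exact: cvg_lim key].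
Qed.

Lemma diffq_mvt (h D : R -> R) (a b : R) : 0 <= a -> a < b -> b <= 1 ->
  {within unit_itv R, continuous h} ->
  (forall x, 0 < x < 1 -> diffq_cvg h x (D x)) ->
  exists2 c, a < c < b & h b - h a = D c * (b - a).
Proof.
move=> a0 ab b1 hc hD.
have [||c] := @MVT R h D a b ab.
- move=> x; rewrite in_itv /= => /andP[ax xb].
  by apply: diffq_is_derive; [|apply: hD]; rewrite (le_lt_trans a0)//= (lt_le_trans xb).
- apply: continuous_subspaceW hc => x; rewrite /unit_itv /= !in_itv /= => /andP[ax xb].
  by rewrite (le_trans a0)//= (le_trans xb).
by rewrite in_itv /= => cab e; exists c.
Qed.

Lemma diffq_lip (h D : R -> R) (C : R) : {within unit_itv R, continuous h} ->
  (forall x, 0 < x < 1 -> diffq_cvg h x (D x)) ->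
  (forall x, 0 < x < 1 -> `|D x| <= C) ->
  forall s s', 0 <= s <= 1 -> 0 <= s' <= 1 -> `|h s - h s'| <= C * `|s - s'|.
Proof.
move=> hc hD DC s s'; wlog ss' : s s' / s' < s.
  move=> H; case: (ltgtP s s') => [ss' s01 s'01|ss'|-> _ _].
  - by rewrite distrC [X in _ * X]distrC; exact: H.
  - exact: H.
  - by rewrite !subrr normr0 mulr0.
move=> /andP[s0 s1] /andP[s'0 s'1].
have [c /andP[c1 c2] ->] := diffq_mvt s'0 ss' s1 hc hD.
rewrite normrM ler_wpM2r// DC// (le_lt_trans s'0)//=; exact: lt_le_trans s1.
Qed.

(** Uniform continuity, from the compactness of the interval. *)
Lemma heine01 (D : R -> R) : {within unit_itv R, continuous D} ->
  forall eta, 0 < eta -> exists2 rho, 0 < rho & forall x y,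
    0 <= x <= 1 -> 0 <= y <= 1 -> `|x - y| <= rho -> `|D x - D y| <= eta.
Proof.
move=> Dc eta eta0.
pose P (rho x : R) := 0 <= x <= 1 -> forall y, 0 <= y <= 1 -> `|x - y| <= rho ->
  `|D x - D y| <= eta.
have /compact_near_coveringP := @segment_compact R 0 1.
move=> /(_ R (0 : R)^'+ P _)[].
  move=> x; rewrite /= in_itv /= => x01.
  have Dx : D y @[y --> within (unit_itv R) (nbhs x)] --> D x.
    by move/subspace_continuousP : Dc; apply; rewrite /unit_itv /= in_itv.
  have eta2 : 0 < eta / 2 by rewrite divr_gt0.
  move/cvgrPdist_lt : Dx => /(_ _ eta2) [e /= e0 He].
  have e2 : 0 < e / 2 by rewrite divr_gt0.
  exists (ball x (e / 2), [set rho | rho < e / 2]); first split => /=.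
  - exact: nbhsx_ballx.
  - by exists (e / 2) => //= r /=; rewrite sub0r normrN => + r0; rewrite gtr0_norm.
  case=> x' rho /= [xx' re] x'01 y y01 x'y.
  have h1 : `|D x - D x'| < eta / 2.
    apply: He => /=; last by rewrite /unit_itv /= in_itv.
    by apply: lt_trans xx' _; rewrite ltr_pdivrMr// ltr_pMr// ltr1n.
  have h2 : `|D x - D y| < eta / 2.
    apply: He => /=; last by rewrite /unit_itv /= in_itv.
    rewrite -(subrK x' x) -addrA; apply: le_lt_trans (ler_normD _ _) _.
    rewrite [e]splitr; apply: ltr_leD => //; exact: ltW (le_lt_trans x'y re).
  rewrite -(subrK (D x) (D x')) -addrA; apply: le_trans (ler_normD _ _) _.
  by rewrite distrC [leRHS]splitr; apply: lerD; apply: ltW.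
move=> rho /= rho0 H; exists (rho / 2) => [|x y x01 y01 xy]; first by rewrite divr_gt0.
apply: (H (rho / 2)) => //=.
- by rewrite sub0r normrN gtr0_norm ?divr_gt0// ltr_pdivrMr// ltr_pMr// ltr1n.
- by rewrite divr_gt0.
Qed.

(** By the mean value theorem and the uniform continuity of the derivative, the
    slopes of all chords near [r] are close to the derivative at [r]. *)
Lemma near_affine (h D : R -> R) : {within unit_itv R, continuous h} ->
  {within unit_itv R, continuous D} ->
  (forall x, 0 < x < 1 -> diffq_cvg h x (D x)) ->
  forall eta, 0 < eta -> exists2 rho, 0 < rho & forall r s s',
    0 <= r <= 1 -> 0 <= s <= 1 -> 0 <= s' <= 1 ->
    `|s - r| <= rho -> `|s' - r| <= rho ->
    `|h s - h s' - (s - s') * D r| <= eta * `|s - s'|.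
Proof.
move=> hc Dc hD eta eta0; have [rho rho0 Drho] := heine01 Dc eta0.
exists rho => // r s s'; wlog ss' : s s' / s' < s.
  move=> H; case: (ltgtP s s') => [ss' r01 s01 s'01 a b|ss'|-> *].
  - rewrite -normrN opprB [`|s - s'|]distrC.
    rewrite (_ : _ - (_ - _) = h s' - h s - (s' - s) * D r); last by ring.
    exact: H.
  - exact: H.
  - by rewrite !subrr mul0r subrr normr0 mulr0.
move=> r01 /andP[s0 s1] /andP[s'0 s'1] sr s'r.
have [c /andP[c1 c2] ->] := diffq_mvt s'0 ss' s1 hc hD.
rewrite mulrC -mulrBr normrM mulrC ler_wpM2r//; apply: Drho => //.
  by apply/andP; split; lra.
by move: sr s'r; rewrite !ler_norml => /andP[? ?] /andP[? ?]; apply/andP; split; lra.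
Qed.

(** The second difference is [r] times the difference of two values of the
    derivative at points less than [2 * r] apart. *)
Lemma second_difference (h D D2 : R -> R) (C : R) :
  {within unit_itv R, continuous h} -> {within unit_itv R, continuous D} ->
  (forall x, 0 < x < 1 -> diffq_cvg h x (D x)) ->
  (forall x, 0 < x < 1 -> diffq_cvg D x (D2 x)) ->
  (forall x, 0 < x < 1 -> `|D2 x| <= C) ->
  forall x r, 0 < r -> 0 <= x - r -> x + r <= 1 ->
  `|h (x + r) - 2 * h x + h (x - r)| <= 2 * C * r ^+ 2.
Proof.
move=> hc Dc hD hD2 D2C x r r0 xr0 xr1.
have x0 : 0 <= x by lra.
have x1 : x <= 1 by lra.
have xr : x < x + r by lra.
have rx : x - r < x by lra.
have [c /andP[c1 c2] ec] := diffq_mvt x0 xr xr1 hc hD.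
have [b /andP[b1 b2] eb] := diffq_mvt xr0 rx x1 hc hD.
have -> : h (x + r) - 2 * h x + h (x - r) = r * (D c - D b).
  by move: ec eb; lra.
have C0 : 0 <= C by apply: le_trans (normr_ge0 _) (D2C 2^-1 _); apply/andP; split; lra.
have Dcb : `|D c - D b| <= C * `|c - b|.
  by apply: (diffq_lip Dc hD2 D2C); apply/andP; split; lra.
rewrite normrM gtr0_norm// expr2 mulrA [leRHS]mulrC ler_wpM2l ?(ltW r0)//.
apply: (le_trans Dcb); rewrite [2 * C]mulrC -mulrA ler_wpM2l//.
by rewrite ler_norml; apply/andP; split; lra.
Qed.

End calculus01.

(** * Stability of the Euler characteristic transform *)

Lemma injective_hausdorff (X Y : topologicalType) (u : X -> Y) :
  continuous u -> injective u -> hausdorff_space Y -> hausdorff_space X.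
Proof.
move=> uc ui; rewrite !open_hausdorff => hY x y xy.
have uxy : u x != u y by apply: contra_neq xy => /ui.
have [[A B] /= [xA yB] [oA oB AB]] := hY _ _ uxy.
exists (u @^-1` A, u @^-1` B) => /=.
  by split; rewrite inE /=; [rewrite inE in xA|rewrite inE in yB].
split; [exact: open_comp|exact: open_comp|].
by rewrite -preimage_setI (eqP AB) preimage_set0.
Qed.

Lemma finite_uniform_pos (R : realType) (F : finType) (Q : F -> R -> Prop) :
  (forall x, exists2 rho, 0 < rho & Q x rho) ->
  (forall x r r', r' <= r -> Q x r -> Q x r') ->
  exists2 rho, 0 < rho & forall x, Q x rho.
Proof.
move=> H mon; pose r x := s2val (cid2 (H x)).
exists (\big[Num.min/1]_x r x).
  by apply: lt_bigmin => // x _; exact: (s2valP (cid2 (H x))).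
move=> x; apply: (mon x (r x)); last exact: (s2valP' (cid2 (H x))).
exact: bigmin_le.
Qed.

Lemma cvg_sumR (R : realType) (T : Type) (F : set_system T) {FF : Filter F}
    (J : Type) (r : seq J) (u : J -> T -> R) (l : J -> R) :
  (forall j, u j z @[z --> F] --> l j) ->
  \sum_(j <- r) u j z @[z --> F] --> \sum_(j <- r) l j.
Proof.
move=> ul; elim: r => [|j r IHr].
  by under eq_fun do rewrite big_nil; rewrite big_nil; exact: cvg_cst.
by under eq_fun do rewrite big_cons; rewrite big_cons; exact: cvgD.
Qed.

Section stability.
Variables (R : realType) (W : cw_complex) (d : nat).
Notation Z := (cw_space R W).
Implicit Types f p : Z -> 'rV[R]_d.

Lemma Cr01_coord (c : R -> 'rV[R]_d) r j : Cr01 r.+1 c ->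
  [/\ {within unit_itv R, continuous (fun s => c s 0 j)},
      {within unit_itv R, continuous (fun s => deriv01 c s 0 j)} &
      forall x, 0 <= x <= 1 -> diffq_cvg (fun s => c s 0 j) x (deriv01 c x 0 j)].
Proof.
have cj : continuous (fun M : 'rV[R]_d => M 0 j) by exact: coord_continuous.
case=> cc [cv Cr]; split.
- move=> x; apply: (@continuous_comp (subspace (unit_itv R)) _ _ c
    (fun M : 'rV[R]_d => M 0 j)); [exact: cc|exact: cj].
- have dc : {within unit_itv R, continuous (deriv01 c)} by case: r Cr => [|r] [].
  move=> x; apply: (@continuous_comp (subspace (unit_itv R)) _ _ (deriv01 c)
    (fun M : 'rV[R]_d => M 0 j)); [exact: dc|exact: cj].
move=> x x01; have xI : unit_itv R x by rewrite /unit_itv /= in_itv.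
rewrite /diffq_cvg (_ : (fun y : R => _) = (fun M : 'rV[R]_d => M 0 j) \o
    (fun y => (y - x)^-1 *: (c y - c x))); last by apply/funext => y /=; rewrite !mxE.
by apply: continuous_cvg; [exact: cj|exact: cv x xI].
Qed.

Lemma dotrB (x y v : 'rV[R]_d) : dotr (x - y) v = dotr x v - dotr y v.
Proof.
by rewrite /dotr -sumrB; apply: eq_bigr => i _; rewrite !mxE mulrBl.
Qed.

Lemma dotr_unit (x v : 'rV[R]_d) (C : R) : enorm v = 1 ->
  (forall j, `|x 0 j| <= C) -> `|dotr x v| <= d%:R * C.
Proof.
move=> v1 xC.
have vv : dotr v v = 1.
  have vv0 : 0 <= dotr v v by apply: sumr_ge0 => i _; rewrite -expr2 sqr_ge0.
  by rewrite -[LHS]sqr_sqrtr// -/(enorm v) v1 expr1n.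
have vj j : `|v 0 j| <= 1.
  rewrite -(ler_sqr (x := `|_|)) ?nnegrE// expr1n real_normK ?num_real//.
  rewrite -vv /dotr (bigD1 j)//= expr2 lerDl; apply: sumr_ge0 => i _.
  by rewrite -expr2 sqr_ge0.
apply: (le_trans (ler_norm_sum _ _ _)).
rewrite mulr_natl -[in leRHS](card_ord d) -sumr_const.
apply: ler_sum => j _; rewrite normrM -[leRHS]mulr1.
exact: ler_pM.
Qed.

Lemma dotr_continuous (X : topologicalType) (f : X -> 'rV[R]_d) v :
  (forall j, continuous (fun z => f z 0 j)) -> continuous (fun z => dotr (f z) v).
Proof.
move=> fc z; apply: cvg_sumR => j.
by apply: (@cvgM _ _ (nbhs z) _ (fun z => f z 0 j) (cst (v 0 j))); [exact: fc|exact: cvg_cst].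
Qed.

Section near_affine_arcs.
Variables (V I : finType) (x : V -> Z) (g : I -> R -> Z).

(** The defect [kap i] is measured in the Lipschitz seminorm, since it has to control
    the Lipschitz constant of [h] on the arc as well as the chord. *)
Definition arc_affine (h : Z -> R) (om kap : I -> R) : Prop :=
  forall i, 0 <= kap i /\ forall s s', 0 <= s <= 1 -> 0 <= s' <= 1 ->
    `|h (g i s) - h (g i s') - (s - s') * om i| <= kap i * `|s - s'|.

(** The Lipschitz constant of a nearly affine arc exceeds the difference of height
    between its ends by little, which is what makes its crossings of a level few
    on average. *)
Lemma arc_affine_lip h om kap : arc_affine h om kap ->
  arc_lip g h (fun i => `|om i| + kap i) /\
  forall i, `|om i| + kap i - `|h (g i 0) - h (g i 1)| <= 2 * kap i.
Proof.
move=> H; split=> i; have [k0 Hi] := H i.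
  split=> [|s s' s01 s'01]; first by rewrite addr_ge0.
  rewrite -[h (g i s) - _](subrK ((s - s') * om i)).
  apply: le_trans (ler_normD _ _) _; rewrite [leRHS]mulrDl [leLHS]addrC; apply: lerD; last exact: Hi.
  by rewrite normrM mulrC.
have l0 : 0 <= (0 : R) <= 1 by rewrite lexx ler01.
have l1 : 0 <= (1 : R) <= 1 by rewrite lexx ler01.
have := Hi 0 1 l0 l1; rewrite sub0r mulN1r opprK normrN normr1 mulr1 => h1.
have := ler_normB (h (g i 0) - h (g i 1) + om i) (h (g i 0) - h (g i 1)).
rewrite addrAC subrr add0r; lra.
Qed.

End near_affine_arcs.

(** The cells are cut at the points of a grid so fine that [f] is nearly affine on
    each piece, with a defect proportional to the length of the piece. The defects
    add up to a multiple of the number of cells, however fine the grid, so that they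
    are small before [del] is chosen according to the number of pieces. *)
Theorem ECT_stability f : continuous f -> injective f -> Cr_cw 1 f ->
  forall eps, 0 < eps -> exists2 del, 0 < del & forall p,
    (forall j, continuous (fun z => p z 0 j)) ->
    (forall z j, `|p z 0 j - f z 0 j| <= del) ->
    (forall e j s s', 0 <= s <= 1 -> 0 <= s' <= 1 ->
      `|(p (cw_char e s) 0 j - f (cw_char e s) 0 j) -
        (p (cw_char e s') 0 j - f (cw_char e s') 0 j)| <= del * `|s - s'|) ->
    (ECT_dist p f < eps%:E)%E.
Proof.
move=> fc fi fC1 eps eps0.
have fc' j : continuous (fun z => f z 0 j).
  by move=> z; apply: (@continuous_comp _ _ _ f (fun M : 'rV[R]_d => M 0 j)); [exact: fc|exact: coord_continuous].
have hZ : hausdorff_space Z.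
  by apply: (injective_hausdorff fc fi); exact: norm_hausdorff.
pose E := cw_edge W.
(* In each component both maps have defect at most [eta + del] per unit length,
   and the bound counts twice the defects of each of them: the constants make the
   total, with the change of heights at the vertices, at most [3 / 4 * eps]. *)
pose eta := eps / (8 * (d%:R * #|E|%:R + 1)).
have dE0 : 0 <= d%:R * #|E|%:R :> R by rewrite mulr_ge0.
have eta0 : 0 < eta by rewrite divr_gt0// mulr_gt0// ltr_wpDl.
pose D e j s := deriv01 (f \o cw_char e) s 0 j.
pose Q (ej : E * 'I_d) (rho : R) := forall r s s',
    0 <= r <= 1 -> 0 <= s <= 1 -> 0 <= s' <= 1 ->
    `|s - r| <= rho -> `|s' - r| <= rho ->
    `|f (cw_char ej.1 s) 0 ej.2 - f (cw_char ej.1 s') 0 ej.2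
      - (s - s') * D ej.1 ej.2 r| <= eta * `|s - s'|.
have [rho rho0 HQ] : exists2 rho, 0 < rho & forall ej, Q ej rho.
  apply: finite_uniform_pos => [[e j]|ej r r' rr' H u s s' u01 s01 s'01 h1 h2].
    have [c1 c2 c3] := Cr01_coord j (fC1 e).
    apply: (near_affine c1 c2 _ eta0) => y /andP[y0 y1].
    by apply: c3; rewrite !ltW.
  by apply: H => //; [exact: le_trans h1 _|exact: le_trans h2 _].
pose N := (Num.truncn rho^-1).+1.
have N0 : 0 < N%:R :> R by rewrite ltr0n.
have Nrho : N%:R^-1 <= rho.
  by rewrite -[leRHS]invrK lef_pV2 ?posrE ?invr_gt0//; apply/ltW/truncnS_gt.
pose grid (ej : E * 'I_N.+1) : Z := cw_char ej.1 (ej.2%:R / N%:R).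
have [V [I [x [g [ei [al [be [DD [ab gE sb] rx _]]]]]]]] :=
  cell_dec_refine (cw_cell_dec R W) (p := grid) (fun=> Logic.I).
(* A longer piece would have a grid point in its interior. *)
have beN i : be i <= rho.
  apply: le_trans Nrho; rewrite leNgt; apply/negP => Nbe.
  have [a0 b0 ab1] := ab i.
  have Nbe1 : 1 < N%:R * be i by rewrite mulrC -ltr_pdivrMr// div1r.
  pose j := (Num.truncn (N%:R * al i)).+1.
  have /andP[j1 j2] : N%:R * al i < j%:R <= N%:R * al i + 1.
    rewrite truncnS_gt /j -natr1 lerD2r truncn_le.
    by rewrite mulr_ge0// ltW.
  have jN : (j < N.+1)%N.
    rewrite -(ltr_nat R) -natr1; apply: le_lt_trans j2 _; rewrite ltrD2r.
    by rewrite -[ltRHS]mulr1 ltr_pM2l//; lra.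
  have : range x (grid (ei i, Ordinal jN)) by rewrite rx; right; exists (ei i, Ordinal jN).
  case=> v _; pose s := (j%:R / N%:R - al i) / be i.
  have s01 : 0 < s < 1.
    rewrite divr_gt0//=; last by rewrite subr_gt0 ltr_pdivlMr// mulrC.
    rewrite ltr_pdivrMr// mul1r ltrBlDl ltr_pdivrMr// mulrDl.
    by rewrite [al i * _]mulrC [be i * _]mulrC; lra.
  have -> : grid (ei i, Ordinal jN) = g i s.
    rewrite gE /grid /=; congr cw_char.
    by rewrite /s [be i * _]mulrC divfK ?gt_eqF// [al i + _]addrC subrK.
  by move=> /esym; exact: (cd_free DD s01).
pose cVI : R := #|V|%:R + #|I|%:R + 2 * #|E|%:R.
have cVI0 : 0 <= cVI by rewrite !addr_ge0// mulr_ge0.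
pose del := eps / (4 * (d%:R * cVI + 1)).
have dc0 : 0 <= d%:R * cVI by rewrite mulr_ge0.
have del0 : 0 < del by rewrite divr_gt0// mulr_gt0// ltr_wpDl.
exists del => // p pc pf plip.
have arc01 i s : 0 <= s <= 1 -> 0 <= al i + be i * s <= 1.
  by case/andP=> s0 s1; have [a0 b0 ab1] := ab i; apply/andP; split; nra.
have affine v : enorm v = 1 ->
    arc_affine g (fun z => dotr (f z) v)
      (fun i => be i * dotr (\row_j D (ei i) j (al i)) v)
      (fun i => d%:R * (eta * be i)).
  move=> v1 i; have [a0 b0 ab1] := ab i; split.
    by rewrite mulr_ge0// mulr_ge0 ?ltW.
  move=> s s' s01 s'01; rewrite -mulrA.
  have -> : dotr (f (g i s)) v - dotr (f (g i s')) v -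
      (s - s') * (be i * dotr (\row_j D (ei i) j (al i)) v) =
      dotr (f (g i s) - f (g i s') - ((s - s') * be i) *: \row_j D (ei i) j (al i)) v.
    rewrite dotrB dotrB mulrA; congr (_ - _); rewrite /dotr mulr_sumr.
    by apply: eq_bigr => j _; rewrite !mxE mulrA.
  apply: dotr_unit => // j; rewrite !mxE !gE.
  have e1 : (s - s') * be i = (al i + be i * s) - (al i + be i * s') by ring.
  rewrite e1 -[eta * be i * _]mulrA.
  have -> : be i * `|s - s'| = `|(al i + be i * s) - (al i + be i * s')|.
    by rewrite -e1 normrM mulrC (gtr0_norm b0).
  have al01 : 0 <= al i <= 1 by rewrite a0; lra.
  have dist r : 0 <= r <= 1 -> `|al i + be i * r - al i| <= rho.
    move=> /andP[r0 r1]; rewrite addrAC subrr add0r ger0_norm ?mulr_ge0 ?(ltW b0)//.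
    by apply: le_trans (beN i); rewrite ler_piMr// ltW.
  by apply: (HQ (ei i, j)) => //=; [exact: arc01|exact: arc01|exact: dist|exact: dist].
have affine' v : enorm v = 1 ->
    arc_affine g (fun z => dotr (p z) v)
      (fun i => be i * dotr (\row_j D (ei i) j (al i)) v)
      (fun i => d%:R * ((eta + del) * be i)).
  move=> v1 i; have [a0 b0 ab1] := ab i; split.
    by rewrite mulr_ge0// mulr_ge0 ?ltW// addr_gt0.
  move=> s s' s01 s'01; have [_ /(_ s s' s01 s'01)] := affine v v1 i.
  have -> : d%:R * ((eta + del) * be i) * `|s - s'| =
      d%:R * (eta * be i) * `|s - s'| + d%:R * (del * be i) * `|s - s'| by ring.
  move=> H.
  have -> : dotr (p (g i s)) v - dotr (p (g i s')) v -
      (s - s') * (be i * dotr (\row_j D (ei i) j (al i)) v) =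
      (dotr (f (g i s)) v - dotr (f (g i s')) v -
      (s - s') * (be i * dotr (\row_j D (ei i) j (al i)) v)) +
      dotr ((p (g i s) - f (g i s)) - (p (g i s') - f (g i s'))) v.
    by rewrite !dotrB; ring.
  apply: le_trans (ler_normD _ _) _; apply: lerD; first exact: H.
  rewrite -mulrA; apply: dotr_unit => // j; rewrite !mxE !gE -mulrA.
  have -> : be i * `|s - s'| = `|(al i + be i * s) - (al i + be i * s')|.
    have -> : al i + be i * s - (al i + be i * s') = be i * (s - s') by ring.
    by rewrite normrM (gtr0_norm b0).
  by apply: plip; exact: arc01.
have diff v z : enorm v = 1 -> `|dotr (p z) v - dotr (f z) v| <= d%:R * del.
  by move=> v1; rewrite -dotrB; apply: dotr_unit => // j; rewrite !mxE.
suff H v : enorm v = 1 -> forall S : set R,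
    (\int[lebesgue_measure]_(t in S) `|ECT p v t - ECT f v t| <= (3 / 4 * eps)%:E)%E.
  apply: (@le_lt_trans _ _ (3 / 4 * eps)%:E); last by rewrite lte_fin; lra.
  by apply: ge_ereal_sup => _ [v v1 <-]; exact: H.
move=> v1 S.
have [lip slack] := arc_affine_lip (affine v v1).
have [lip' slack'] := arc_affine_lip (affine' v v1).
have H := euler_diff_integral hZ DD (dotr_continuous (v := v) pc)
  (dotr_continuous (v := v) fc') lip' lip S.
apply: (le_trans H) => {H}.
rewrite lee_fin.
have b1 : \sum_w `|dotr (p (x w)) v - dotr (f (x w)) v| <= #|V|%:R * (d%:R * del).
  by rewrite mulr_natl -sumr_const; apply: ler_sum => w _; exact: diff.
have b2 : \sum_i `|Num.max (dotr (p (g i 0)) v) (dotr (p (g i 1)) v) -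
    Num.max (dotr (f (g i 0)) v) (dotr (f (g i 1)) v)| <= #|I|%:R * (d%:R * del).
  rewrite mulr_natl -sumr_const; apply: ler_sum => i _.
  move: (diff v (g i 0) v1) (diff v (g i 1) v1); rewrite !ler_norml !maxEle.
  move=> /andP[? ?] /andP[? ?].
  by case: ifPn; case: ifPn; rewrite -?ltNge => ? ?; apply/andP; split; lra.
have b3 : \sum_i (`|be i * dotr (\row_j D (ei i) j (al i)) v| + d%:R * ((eta + del) * be i) -
    `|dotr (p (g i 0)) v - dotr (p (g i 1)) v|) <= 2 * (d%:R * ((eta + del) * #|E|%:R)).
  by rewrite -sb !mulr_sumr; apply: ler_sum => i _; exact: slack'.
have b4 : \sum_i (`|be i * dotr (\row_j D (ei i) j (al i)) v| + d%:R * (eta * be i) -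
    `|dotr (f (g i 0)) v - dotr (f (g i 1)) v|) <= 2 * (d%:R * (eta * #|E|%:R)).
  by rewrite -sb !mulr_sumr; apply: ler_sum => i _; exact: slack.
have e1 : eta * (d%:R * #|E|%:R) <= eps / 8.
  rewrite /eta -mulrA ler_wpM2l ?(ltW eps0)// invfM -mulrA ler_piMr ?invr_ge0//.
  by rewrite mulrC ler_pdivrMr ?ltr_wpDl// mul1r lerDl.
have e2 : del * (d%:R * cVI) <= eps / 4.
  rewrite /del -mulrA ler_wpM2l ?(ltW eps0)// invfM -mulrA ler_piMr ?invr_ge0//.
  by rewrite mulrC ler_pdivrMr ?ltr_wpDl// mul1r lerDl.
apply: le_trans (lerD (lerD b1 b2) (lerD b3 b4)) _.
move: e1 e2; rewrite /cVI -/E; clearbody eta del.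
by lra.
Qed.

End stability.

(** * Functionals on a reproducing kernel space *)

Section span.
Variables (R : realType) (T : Type) (k : T -> T -> R).
Implicit Types (u v : seq (R * T)) (h : T -> R).

(** The list [u] as a combination of evaluations at points, acting on arbitrary
    functions; on the span of the kernel it is the inner product with [u]. *)
Definition functional u h : R := \sum_(p <- u) p.1 * h p.2.

Definition span_scale (c : R) u : seq (R * T) := [seq (c * p.1, p.2) | p <- u].

Lemma functional_cat u v h : functional (u ++ v) h = functional u h + functional v h.
Proof. exact: big_cat. Qed.

Lemma functional_scale c u h : functional (span_scale c u) h = c * functional u h.
Proof.
by rewrite /functional big_map mulr_sumr; apply: eq_bigr => p _; rewrite /= mulrA.
Qed.

Lemma span_sub_scale u v : span_sub u v = u ++ span_scale (- 1) v.
Proof.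
by congr (_ ++ _); apply: eq_map => p; rewrite mulN1r.
Qed.

Lemma span_dotE u v : span_dot k u v = functional u (span_eval k v).
Proof.
apply: eq_bigr => p _; rewrite /span_eval mulr_sumr; apply: eq_bigr => q _.
by rewrite mulrA.
Qed.

Lemma span_dot_catl u u' v : span_dot k (u ++ u') v = span_dot k u v + span_dot k u' v.
Proof. by rewrite !span_dotE functional_cat. Qed.

Lemma span_dot_scalel c u v : span_dot k (span_scale c u) v = c * span_dot k u v.
Proof. by rewrite !span_dotE functional_scale. Qed.

Hypothesis hk : is_kernel k.

Lemma span_dotC u v : span_dot k u v = span_dot k v u.
Proof.
rewrite /span_dot exchange_big /=; apply: eq_bigr => p _; apply: eq_bigr => q _.
by rewrite (hk.1 q.2) [q.1 * _]mulrC.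
Qed.

Lemma span_dot_ge0 u : 0 <= span_dot k u u.
Proof.
apply: le_trans (hk.2 (size u) (fun i => (tnth (in_tuple u) i).1)
  (fun i => (tnth (in_tuple u) i).2)) _.
by rewrite /span_dot [leRHS]big_tnth; apply: ler_sum => i _; rewrite [leRHS]big_tnth.
Qed.

Lemma span_dot_comb (c : R) u v :
  span_dot k (u ++ span_scale c v) (u ++ span_scale c v) =
  span_dot k u u + 2 * c * span_dot k u v + c ^+ 2 * span_dot k v v.
Proof.
rewrite span_dot_catl span_dot_scalel.
rewrite [span_dot k u _]span_dotC [span_dot k v _]span_dotC.
rewrite !span_dot_catl !span_dot_scalel [span_dot k v u]span_dotC; ring.
Qed.

Lemma discriminant_le (A B C : R) : 0 <= C ->
  (forall c, 0 <= A + 2 * c * B + c ^+ 2 * C) -> B ^+ 2 <= A * C.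
Proof.
rewrite le_eqVlt => /predU1P[<- H|C0 H].
  have [->|B0] := eqVneq B 0; first by rewrite mulr0 expr0n.
  have := H (- (A + 1) / (2 * B)); rewrite mulr0 addr0.
  have -> : 2 * (- (A + 1) / (2 * B)) * B = - (A + 1) by field.
  lra.
have := H (- B / C).
have -> : A + 2 * (- B / C) * B + (- B / C) ^+ 2 * C = A - B ^+ 2 / C.
  by field; rewrite gt_eqF.
by rewrite subr_ge0 ler_pdivrMr.
Qed.

Lemma span_CS u v : span_dot k u v ^+ 2 <= span_dot k u u * span_dot k v v.
Proof.
by apply: discriminant_le => [|c]; [exact: span_dot_ge0|]; rewrite -span_dot_comb; exact: span_dot_ge0.
Qed.

(** Functionals act on an element of the space by inner products, so that the
    Cauchy-Schwarz inequality bounds them; it passes to the limit along a Cauchy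
    sequence of the span, whose norms are bounded. *)
Lemma RKHS_bound h : in_RKHS k h -> exists2 C, 0 <= C &
  forall u, functional u h ^+ 2 <= C * span_dot k u u.
Proof.
case=> s [cs hs]; have [N HN] := cs 1 ltr01.
(* [`|s m|^2 <= 2 * `|s m - s N|^2 + 2 * `|s N|^2], by the parallelogram law. *)
exists (2 + 2 * span_dot k (s N) (s N)).
  by rewrite addr_ge0// mulr_ge0// span_dot_ge0.
move=> u; set C := _ + _.
have sC m : (N <= m)%N -> span_dot k (s m) (s m) <= C.
  move=> Nm; have := HN m N Nm (leqnn _).
  rewrite /span_norm span_sub_scale => sub1.
  have h1 : span_dot k (s m ++ span_scale (-1) (s N)) (s m ++ span_scale (-1) (s N)) <= 1.
    by rewrite -(sqr_sqrtr (span_dot_ge0 _)) expr_le1 ?sqrtr_ge0 ?ltW.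
  have h2 := span_dot_ge0 (s m ++ span_scale (- 2) (s N)).
  by move: h1 h2; rewrite !span_dot_comb /C; lra.
have cv : functional u (span_eval k (s n)) @[n --> \oo] --> functional u h.
  by apply: cvg_sumR => p; apply: cvgM; [exact: cvg_cst|exact: hs].
have cv2 : functional u (span_eval k (s n)) * functional u (span_eval k (s n))
    @[n --> \oo] --> functional u h * functional u h by exact: cvgM.
rewrite expr2 -(cvg_lim _ cv2)//.
apply: limr_le; first by apply/cvg_ex; eexists; exact: cv2.
exists N => // m /= Nm; rewrite -span_dotE -expr2.
apply: (le_trans (span_CS _ _)); rewrite mulrC ler_wpM2r ?span_dot_ge0//.
exact: sC.
Qed.

End span.

(** * Smoothing weights as ridge minimisers *)

Section smoothing.
Variables (R : realType) (T : Type) (k : T -> T -> R).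
Hypothesis hk : is_kernel k.
Variables (n : nat) (a : 'I_n -> T) (sigma : R).
Hypothesis sigma_gt0 : 0 < sigma.
Implicit Types (phi : seq (R * T)) (w : 'rV[R]_n).

Local Notation M := (gram k a a + (sigma ^+ 2)%:M).

Definition weighted_pts w : seq (R * T) := [seq (w 0 i, a i) | i <- enum 'I_n].

(** The squared norm of the error made when the functional [phi] is replaced by the
    evaluations at the data points with weights [w], plus the variance of the noise
    that these weights carry. *)
Definition ridge phi w : R :=
  span_dot k (phi ++ span_scale (- 1) (weighted_pts w))
             (phi ++ span_scale (- 1) (weighted_pts w))
  + sigma ^+ 2 * \sum_i w 0 i ^+ 2.

Lemma functional_weighted w h : functional (weighted_pts w) h = \sum_i w 0 i * h (a i).
Proof. by rewrite /functional big_map big_enum. Qed.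

(** The quadratic part of [ridge], as a bilinear form. *)
Definition bil w w' : R := (w *m M *m w'^T) 0 0.

Lemma bilE w w' : bil w w' = span_dot k (weighted_pts w) (weighted_pts w') +
  sigma ^+ 2 * \sum_i w 0 i * w' 0 i.
Proof.
rewrite /bil mulmxDr mulmxDl mxE; congr (_ + _).
  rewrite span_dotE functional_weighted mxE.
  under eq_bigr => j _ do rewrite mxE mulr_suml.
  rewrite exchange_big /=; apply: eq_bigr => i _.
  rewrite /span_eval big_map big_enum /= mulr_sumr; apply: eq_bigr => j _.
  by rewrite !mxE; ring.
rewrite mul_mx_scalar -scalemxAl mxE mxE; congr (_ * _).
by apply: eq_bigr => i _; rewrite mxE.
Qed.

Lemma bilC w w' : bil w w' = bil w' w.
Proof.
by rewrite !bilE span_dotC//; congr (_ + _ * _); apply: eq_bigr => i _; rewrite mulrC.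
Qed.

Lemma bil_ge0 w : 0 <= bil w w.
Proof.
rewrite bilE addr_ge0 ?span_dot_ge0// mulr_ge0 ?sqr_ge0// sumr_ge0// => i _.
by rewrite -expr2 sqr_ge0.
Qed.

(** The form [bil] is positive definite, as the sum of a positive semidefinite form
    and of a positive multiple of the sum of squares. *)
Lemma gram_unit : M \in unitmx.
Proof.
rewrite -row_free_unit -kermx_eq0; apply/rowV0P => w /sub_kermxP wM.
have : bil w w = 0 by rewrite /bil wM mul0mx mxE.
rewrite bilE => e.
have s0 : \sum_i w 0 i * w 0 i = 0.
  have h1 := span_dot_ge0 hk (weighted_pts w).
  have h2 : 0 <= \sum_i w 0 i * w 0 i.
    by apply: sumr_ge0 => i _; rewrite -expr2 sqr_ge0.
  have h3 : 0 < sigma ^+ 2 by rewrite exprn_gt0.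
  apply/eqP; rewrite eq_le h2 andbT leNgt; apply/negP => h4.
  by have h5 := mulr_gt0 h3 h4; clear wM; lra.
apply/rowP => i; rewrite mxE; apply/eqP; rewrite -sqrf_eq0 expr2.
move/eqP: s0; rewrite psumr_eq0; last by move=> j _; rewrite -expr2 sqr_ge0.
by move/allP/(_ i); rewrite mem_index_enum => /(_ isT).
Qed.

Definition kernel_row phi : 'rV[R]_n := \row_i functional phi (fun z => k z (a i)).

(** The weights that the smoothing gives to the observations, for the functional [phi]. *)
Definition ridge_opt phi : 'rV[R]_n := kernel_row phi *m invmx M.

Lemma functional_smoothing phi (y : 'cV[R]_n) :
  functional phi (gaussian_smoothing k a sigma y) =
  \sum_i ridge_opt phi 0 i * y i 0.
Proof.
transitivity ((ridge_opt phi *m y) 0 0); last by rewrite mxE.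
have -> : ridge_opt phi *m y =
    \sum_(p <- phi) p.1 *: (gram k (fun _ : 'I_1 => p.2) a *m invmx M *m y).
  under eq_bigr do rewrite scalemxAl scalemxAl.
  rewrite -!mulmx_suml /ridge_opt; congr (_ *m _ *m _).
  by apply/rowP => i; rewrite mxE summxE; apply: eq_bigr => p _; rewrite !mxE.
by rewrite summxE; apply: eq_bigr => p _; rewrite mxE.
Qed.

(** The linear term is a product with [ridge_opt], which completes the square. *)
Lemma ridgeE phi w : ridge phi w =
  span_dot k phi phi - 2 * bil w (ridge_opt phi) + bil w w.
Proof.
have -> : bil w (ridge_opt phi) = span_dot k phi (weighted_pts w).
  rewrite bilC /bil /ridge_opt mulmxKV ?gram_unit// mxE span_dotC//.
  rewrite span_dotE functional_weighted; apply: eq_bigr => i _.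
  rewrite !mxE mulrC; congr (_ * _); apply: eq_bigr => p _.
  by rewrite hk.1.
rewrite /ridge span_dot_comb// bilE.
have -> : \sum_i w 0 i ^+ 2 = \sum_i w 0 i * w 0 i.
  by apply: eq_bigr => i _; rewrite expr2.
by ring.
Qed.

Lemma bilB w w' : bil (w - w') (w - w') = bil w w - 2 * bil w w' + bil w' w'.
Proof.
have bB u v z : bil (u - v) z = bil u z - bil v z.
  by rewrite /bil !mulmxBl !mxE.
by rewrite !bB [bil w (_ - _)]bilC [bil w' (_ - _)]bilC !bB [bil w' w]bilC; ring.
Qed.

Lemma ridge_opt_le phi w : ridge phi (ridge_opt phi) <= ridge phi w.
Proof.
rewrite !ridgeE -subr_ge0.
set q := span_dot _ _ _; set w0 := ridge_opt phi.
have -> : q - 2 * bil w w0 + bil w w - (q - 2 * bil w0 w0 + bil w0 w0) =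
  bil (w - w0) (w - w0) by rewrite bilB; ring.
exact: bil_ge0.
Qed.

(** [b] is the bias and [w] the weights of the noise. The bias is bounded by the
    norm of the error on the functional, and both this norm and the variance are
    parts of the minimal value of [ridge], to which any [v] may be compared. *)
Lemma smoothing_error (h : T -> R) (C : R) phi :
  0 <= C -> (forall u, functional u h ^+ 2 <= C * span_dot k u u) ->
  exists b (w : 'I_n -> R),
    (forall y : 'cV[R]_n,
      functional phi (gaussian_smoothing k a sigma (\col_i (h (a i) + y i 0)))
        - functional phi h = b + \sum_i w i * y i 0) /\
    forall v, b ^+ 2 <= C * ridge phi v /\
      \sum_i w i ^+ 2 <= ridge phi v / sigma ^+ 2.
Proof.
move=> C0 hC; pose w0 := ridge_opt phi.
exists (- functional (phi ++ span_scale (- 1) (weighted_pts w0)) h), (fun i => w0 0 i).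
split=> [y|v].
  rewrite functional_smoothing functional_cat functional_scale functional_weighted.
  under eq_bigr => i _ do rewrite [(\col__ _) _ _]mxE mulrDr.
  by rewrite big_split /=; ring.
have le0 := ridge_opt_le phi v; have s2 : 0 < sigma ^+ 2 by rewrite exprn_gt0.
have ws0 : 0 <= \sum_i w0 0 i ^+ 2 by apply: sumr_ge0 => i _; rewrite sqr_ge0.
split.
  rewrite sqrrN; apply: (le_trans (hC _)); rewrite ler_wpM2l//.
  by apply: le_trans le0; rewrite /ridge lerDl mulr_ge0// ltW.
rewrite ler_pdivlMr// mulrC; apply: le_trans le0.
by rewrite /ridge lerDr span_dot_ge0.
Qed.

Lemma ridge0 phi : ridge phi 0 = span_dot k phi phi.
Proof.
rewrite ridgeE.
have b0 u : bil 0 u = 0 by rewrite /bil !mul0mx mxE.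
by rewrite !b0 mulr0 subr0 addr0.
Qed.

(** With equal weights on a set of data points where the kernel is nearly constant,
    the functional is well approximated and the variance of the noise is divided by
    the number of points. *)
Lemma ridge_average (z : T) (B : {set 'I_n}) (eps kap : R) :
  0 <= eps -> (0 < #|B|)%N -> `|k z z - kap| <= eps ->
  (forall i, i \in B -> `|k z (a i) - kap| <= eps) ->
  (forall i j, i \in B -> j \in B -> `|k (a i) (a j) - kap| <= eps) ->
  ridge [:: (1, z)] (\row_i (#|B|%:R^-1 * (i \in B)%:R)) <=
    4 * eps + sigma ^+ 2 / #|B|%:R.
Proof.
move=> eps0 B0 kzz kza kaa.
set w := \row_i _; set m : R := #|B|%:R.
have m0 : 0 < m by rewrite ltr0n.
have avg (F : 'I_n -> R) : \sum_i w 0 i * F i = m^-1 * \sum_(i in B) F i.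
  rewrite mulr_sumr [RHS]big_mkcond /=; apply: eq_bigr => i _.
  by rewrite mxE; case: (i \in B); rewrite ?mulr1// mulr0 mul0r.
have avgle (F : 'I_n -> R) : (forall i, i \in B -> `|F i - kap| <= eps) ->
    `|m^-1 * \sum_(i in B) F i - kap| <= eps.
  move=> FB; have -> : m^-1 * \sum_(i in B) F i - kap =
      m^-1 * \sum_(i in B) (F i - kap).
    by rewrite sumrB sumr_const mulrBr -[kap *+ _]mulr_natl mulKf// gt_eqF.
  rewrite normrM gtr0_norm ?invr_gt0// mulrC ler_pdivrMr//.
  apply: (le_trans (ler_norm_sum _ _ _)).
  by apply: (le_trans (ler_sum _ FB)); rewrite sumr_const mulr_natr.
have sw : \sum_i w 0 i ^+ 2 = m^-1.
  under eq_bigr do rewrite expr2.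
  rewrite avg (eq_bigr (fun=> m^-1)); last by move=> i iB; rewrite mxE iB mulr1.
  by rewrite sumr_const -[_ *+ _]mulr_natl mulKf// gt_eqF.
rewrite /ridge sw lerD2r span_dot_comb//.
have -> : span_dot k [:: (1, z)] [:: (1, z)] = k z z.
  by rewrite /span_dot !big_seq1 /= !mul1r.
have e1 : span_dot k [:: (1, z)] (weighted_pts w) = m^-1 * \sum_(i in B) k z (a i).
  rewrite -avg span_dotC// span_dotE functional_weighted; apply: eq_bigr => i _.
  by rewrite /span_eval big_seq1 /= mul1r hk.1.
have e2 : span_dot k (weighted_pts w) (weighted_pts w) =
    m^-1 * \sum_(i in B) (m^-1 * \sum_(j in B) k (a i) (a j)).
  rewrite span_dotE functional_weighted -avg; apply: eq_bigr => i _; congr (_ * _).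
  by rewrite -avg /span_eval big_map big_enum.
have := avgle (fun i => k z (a i)) kza.
have := avgle (fun i => m^-1 * \sum_(j in B) k (a i) (a j)) (fun i iB => avgle _ (kaa i ^~ iB)).
rewrite -e1 -e2; move: kzz.
rewrite !ler_norml => /andP[? ?] /andP[? ?] /andP[? ?]; lra.
Qed.

End smoothing.

(** * Moments of Gaussian noise *)

(** Gives a function with a proof of measurability the structure that pushforward
    measures require. *)
Definition mfun_of d d' (X : measurableType d) (Y : measurableType d')
    (phi : X -> Y) (mphi : measurable_fun [set: X] phi) : {mfun X >-> Y} :=
  HB.pack phi (isMeasurableFun.Build _ _ _ _ phi mphi).

Section gaussian_moments.
Variable R : realType.
Notation mu := (@lebesgue_measure R).
Local Open Scope ereal_scope.

Lemma lebesgue_measure_opp (A : set R) : measurable A ->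
  mu (-%R @^-1` A) = mu A.
Proof.
move=> mA; apply/esym.
pose o : {mfun measurableTypeR R >-> measurableTypeR R} :=
  @mfun_of _ _ (measurableTypeR R) (measurableTypeR R) -%R (@oppr_measurable R [set: R]).
apply: (@lebesgue_measure_unique R (pushforward mu o) _ A mA) => _ [[a b] _ <-].
suff : mu `]a, b]%classic = mu (-%R @^-1` `]a, b]%classic) by [].
have -> : -%R @^-1` `]a, b] = `[(- b)%R, (- a)%R[%classic.
  apply/seteqP; split=> x /=; rewrite !in_itv /= => /andP[h1 h2]; apply/andP; split; lra.
apply: etrans (lebesgue_measure_itv `]a, b]) _.
apply: esym; apply: etrans (lebesgue_measure_itv `[(- b)%R, (- a)%R[) _.
by rewrite /= !lte_fin ltrN2; case: ifP => // _; rewrite -!EFinB; congr EFin; ring.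
Qed.

Variable s : R.
Hypothesis s_gt0 : (0 < s)%R.

Lemma normal_pdf_even x : normal_pdf 0 s (- x) = normal_pdf 0 s x.
Proof.
by rewrite !normal_pdfE ?gt_eqF// /normal_fun !subr0 sqrrN.
Qed.

Lemma normal_prob_opp (A : set R) : measurable A ->
  normal_prob 0 s (-%R @^-1` A) = normal_prob 0 s A.
Proof.
move=> mA; rewrite /normal_prob.
pose o : {mfun measurableTypeR R >-> measurableTypeR R} :=
  @mfun_of _ _ (measurableTypeR R) (measurableTypeR R) -%R (@oppr_measurable R [set: R]).
have -> : \int[mu]_(x in A) (normal_pdf 0 s x)%:E =
    \int[pushforward mu o]_(x in A) (normal_pdf 0 s x)%:E.
  by apply: eq_measure_integral => B mB _; exact: (esym (lebesgue_measure_opp mB)).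
rewrite ge0_integral_pushforward//.
- by apply: eq_integral => x _; rewrite /= normal_pdf_even.
- by apply/measurable_funTS/measurable_EFinP; exact: measurable_normal_pdf.
- by move=> x _; rewrite lee_fin normal_pdf_ge0.
Qed.

(** The density is almost everywhere the Radon-Nikodym derivative, for which the
    change of variables holds. *)
Lemma ge0_integral_normal_prob (f : R -> \bar R) :
  (forall x, 0 <= f x) -> measurable_fun [set: R] f ->
  \int[normal_prob 0 s]_x f x = \int[mu]_x (f x * (normal_pdf 0 s x)%:E).
Proof.
move=> f0 mf.
rewrite -(Radon_Nikodym_SigmaFinite.change_of_variables (normal_prob_dominates 0 s))//.
have Hf := Radon_Nikodym_SigmaFinite.f_integrable (normal_prob_dominates (R := R) 0 s).
apply: ae_eq_integral => //.
- by apply: emeasurable_funM => //; exact: (measurable_int mu Hf).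
- apply: emeasurable_funM => //; apply/measurable_EFinP; exact: measurable_normal_pdf.
- apply: ae_eqe_mul2l; apply: integral_ae_eq => //.
  + by apply/measurable_EFinP; exact: measurable_normal_pdf.
  + move=> E _ mE.
    by rewrite -Radon_Nikodym_SigmaFinite.f_integral//; exact: normal_prob_dominates.
Qed.

(** The square times the density is at most a multiple of the density of the
    Gaussian law of variance [2 * s ^+ 2], since [y <= expR y]. *)
Lemma normal_second_moment : \int[normal_prob 0 s]_x (x ^+ 2)%:E < +oo.
Proof.
have sq0 (x : R) : 0 <= (x ^+ 2)%:E by rewrite lee_fin sqr_ge0.
have msq : measurable_fun [set: R] (fun x : R => (x ^+ 2)%:E).
  by apply/measurable_EFinP; exact: exprn_measurable.
rewrite (ge0_integral_normal_prob sq0 msq).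
pose r := Num.sqrt (2 * s ^+ 2)%R.
have r2 : (r ^+ 2 = 2 * s ^+ 2)%R by rewrite sqr_sqrtr// mulr_ge0// sqr_ge0.
have r0 : (r != 0)%R by rewrite -sqrf_eq0 r2 mulf_neq0// sqrf_eq0 gt_eqF.
pose C := (4 * s ^+ 2 * normal_peak s / normal_peak r)%R.
have pr : (0 < normal_peak r)%R by exact: normal_peak_gt0.
have C0 : (0 <= C)%R.
  apply: divr_ge0; last exact: normal_peak_ge0.
  by apply: mulr_ge0; [apply: mulr_ge0; [|exact: sqr_ge0]|exact: normal_peak_ge0].
apply: (@le_lt_trans _ _ (\int[mu]_x (C%:E * (normal_pdf 0 r x)%:E))).
  have mp (t : R) : measurable_fun [set: R] (fun x => (normal_pdf 0 t x)%:E).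
    by apply/measurable_EFinP; exact: measurable_normal_pdf.
  apply: ge0_le_integral => //.
  - by move=> x _; rewrite mule_ge0 ?sq0// lee_fin normal_pdf_ge0.
  - exact: emeasurable_funM msq (mp s).
  - exact: emeasurable_funM (measurable_cst _) (mp r).
  - move=> x _; have s2 : (s != 0)%R by rewrite gt_eqF.
    rewrite -!EFinM lee_fin !normal_pdfE//.
    rewrite /normal_fun !subr0 r2.
    (* Half of the exponent absorbs the square; the other half is the wider density. *)
    pose y := (x ^+ 2 / (4 * s ^+ 2))%R.
    have p2 : (normal_peak r != 0)%R by rewrite gt_eqF.
    have -> : (- x ^+ 2 / (s ^+ 2 *+ 2) = - y - y)%R by rewrite /y; field.
    have -> : (- x ^+ 2 / (2 * s ^+ 2 *+ 2) = - y)%R by rewrite /y; field.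
    rewrite expRD; have -> : (x ^+ 2 = 4 * s ^+ 2 * y)%R by rewrite /y; field.
    have -> : (C * (normal_peak r * expR (- y)) =
      4 * s ^+ 2 * 1 * (normal_peak s * expR (- y)))%R.
      by rewrite /C; field.
    have -> : (4 * s ^+ 2 * y * (normal_peak s * (expR (- y) * expR (- y))) =
      4 * s ^+ 2 * (y * expR (- y)) * (normal_peak s * expR (- y)))%R by ring.
    apply: ler_wpM2r; first by rewrite mulr_ge0 ?normal_peak_ge0 ?expR_ge0.
    apply: ler_wpM2l; first by rewrite mulr_ge0// sqr_ge0.
    rewrite expRN ler_pdivrMr ?expR_gt0// mul1r.
    by apply: le_trans (expR_ge1Dx y); rewrite lerDr.
have -> : \int[mu]_x (C%:E * (normal_pdf 0 r x)%:E) =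
    C%:E * \int[mu]_x (normal_pdf 0 r x)%:E.
  apply: ge0_integralZl_EFin => //.
  - by move=> x _; rewrite lee_fin normal_pdf_ge0.
  - by apply/measurable_EFinP; exact: measurable_normal_pdf.
by rewrite integral_normal_pdf mule1 ltry.
Qed.

End gaussian_moments.

Section centred_gaussian.
Variables (R : realType) (disp : measure_display) (Omega : measurableType disp).
Variable P : probability Omega R.
Local Open Scope ereal_scope.

(** Replacing [U] by [V] changes the sign of the integrand but not the law, so that
    the integral equals its opposite. *)
Lemma antisymmetric_mean0 d (Y : measurableType d) (U V : Omega -> Y) (g : Y -> R) :
  measurable_fun setT U -> measurable_fun setT V -> measurable_fun setT g ->
  (forall C, measurable C -> P (U @^-1` C) = P (V @^-1` C)) ->
  (forall w, g (V w) = (- g (U w))%R) ->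
  P.-integrable setT (fun w => (g (U w))%:E) ->
  \int[P]_w (g (U w))%:E = 0.
Proof.
move=> mU mV mg UV gUV intU.
have mgE : measurable_fun [set: Y] (EFin \o g) by apply/measurable_EFinP.
have intV : P.-integrable setT ((EFin \o g) \o V).
  rewrite (_ : _ \o V = -%E \o (fun w => (g (U w))%:E)); first exact: integrableN.
  by apply/funext => w /=; rewrite gUV.
have eU := integral_pushforward mU mgE intU measurableT.
have eV := integral_pushforward mV mgE intV measurableT.
have eUV : \int[pushforward P U]_y (EFin \o g) y =
           \int[pushforward P V]_y (EFin \o g) y.
  apply: (@eq_measure_integral _ _ _ _ (pushforward P (mfun_of mV)) (pushforward P (mfun_of mU))).
  by move=> C mC _; exact: UV.
move: eUV; rewrite eU eV !preimage_setT => e.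
have : \int[P]_w (g (U w))%:E = (- 1)%:E * \int[P]_w (g (U w))%:E.
  rewrite -integralZl//; apply: (etrans e); apply: eq_integral => w _.
  by rewrite /= gUV -EFinM mulN1r.
have := integrable_fin_num measurableT intU.
case: (\int[P]_w _) => // r _ [rr]; congr EFin; move: rr; rewrite mulN1r; lra.
Qed.

Variables (X : {RV P >-> R}) (s : R).
Hypothesis s_gt0 : (0 < s)%R.
Hypothesis lawX : forall B, measurable B -> P (X @^-1` B) = normal_prob 0 s B.

Definition normal_var : R := fine (\int[normal_prob 0 s]_x (x ^+ 2)%:E).

Lemma normal_varE : \int[normal_prob 0 s]_x (x ^+ 2)%:E = normal_var%:E.
Proof.
rewrite /normal_var fineK// ge0_fin_numE ?normal_second_moment//.
by apply: integral_ge0 => x _; rewrite lee_fin sqr_ge0.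
Qed.

Lemma gaussian_sqr : \int[P]_w (X w ^+ 2)%:E = normal_var%:E.
Proof.
rewrite -normal_varE.
pose X' : {mfun Omega >-> measurableTypeR R} :=
  @mfun_of _ _ Omega (measurableTypeR R) X (measurable_funP X).
have -> : \int[normal_prob 0 s]_x (x ^+ 2)%:E =
    \int[pushforward P X']_(x in [set: measurableTypeR R]) (x ^+ 2)%:E.
  by apply: eq_measure_integral => B mB _; apply: esym; exact: lawX.
rewrite ge0_integral_pushforward//.
- by apply/measurable_EFinP; exact: exprn_measurable.
- by move=> x _; rewrite lee_fin sqr_ge0.
Qed.

Lemma integrable_gaussian_sqr : P.-integrable setT (fun w => (X w ^+ 2)%:E).
Proof.
apply/integrableP; split.
  apply/measurable_EFinP; apply: measurable_funX.
  exact: (measurable_funP X).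
under eq_integral do rewrite gee0_abs ?lee_fin ?sqr_ge0//.
by rewrite gaussian_sqr ltry.
Qed.

Lemma integrable_gaussian : P.-integrable setT (fun w => (X w)%:E).
Proof.
apply: (@le_integrable _ _ _ _ _ measurableT _ (fun w => (1 + X w ^+ 2)%:E)).
- by apply/measurable_EFinP; exact: (measurable_funP X).
- move=> w _; rewrite /= lee_fin [leRHS]ger0_norm; last by rewrite addr_ge0// sqr_ge0.
  by rewrite ler_norml; apply/andP; split; nra.
- under eq_fun do rewrite EFinD; apply: integrableD => //.
    by apply: finite_measure_integrable_cst.
  exact: integrable_gaussian_sqr.
Qed.

Lemma gaussian_mean0 : \int[P]_w (X w)%:E = 0.
Proof.
have mX := measurable_funP X.
apply: (@antisymmetric_mean0 _ _ X (fun w => - X w)%R id) => //.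
- by apply: measurableT_comp => //; exact: oppr_measurable.
- move=> C mC; rewrite lawX// -(normal_prob_opp s_gt0 mC) -lawX//.
  by rewrite -[X in measurable X]setTI; apply: oppr_measurable.
- exact: integrable_gaussian.
Qed.

End centred_gaussian.

Section uncorrelated_pair.
Variables (R : realType) (disp : measure_display) (Omega : measurableType disp).
Variable P : probability Omega R.
Local Open Scope ereal_scope.
Variables (X Y : {RV P >-> R}) (s : R).
Hypothesis s_gt0 : (0 < s)%R.
Hypothesis lawX : forall B, measurable B -> P (X @^-1` B) = normal_prob 0 s B.
Hypothesis lawY : forall B, measurable B -> P (Y @^-1` B) = normal_prob 0 s B.
Hypothesis indep : forall A B, measurable A -> measurable B ->
  P (X @^-1` A `&` Y @^-1` B) = P (X @^-1` A) * P (Y @^-1` B).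

Lemma integrable_gaussian_prod : P.-integrable setT (fun w => (X w * Y w)%:E).
Proof.
apply: (@le_integrable _ _ _ _ _ measurableT _ (fun w => (X w ^+ 2 + Y w ^+ 2)%:E)).
- apply/measurable_EFinP; apply: measurable_funM; exact: measurable_funP.
- move=> w _; rewrite /= lee_fin [leRHS]ger0_norm; last by rewrite addr_ge0// sqr_ge0.
  by rewrite ler_norml; apply/andP; split; nra.
- under eq_fun do rewrite EFinD; apply: integrableD => //.
    exact: (integrable_gaussian_sqr s_gt0 lawX).
  exact: (integrable_gaussian_sqr s_gt0 lawY).
Qed.

(** By independence and symmetry of the Gaussian law, [(X, Y)] and [(- X, Y)] have
    the same law, which is a product measure; the product of the coordinates changes
    sign. *)
Lemma gaussian_uncorrelated : \int[P]_w (X w * Y w)%:E = 0.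
Proof.
have mX := measurable_funP X; have mY := measurable_funP Y.
have mNX : measurable_fun setT (fun w => - X w)%R.
  by apply: measurableT_comp => //; exact: oppr_measurable.
have mopp (A : set R) : measurable A -> measurable ((-%R : R -> R) @^-1` A).
  by move=> mA; rewrite -[X in measurable X]setTI; apply: oppr_measurable.
have mU : measurable_fun setT (fun w => (X w, Y w)) by exact: measurable_fun_pair.
have mV : measurable_fun setT (fun w => (- X w, Y w)%R) by exact: measurable_fun_pair.
apply: (@antisymmetric_mean0 _ _ _ P _ _ (fun w => (X w, Y w)) (fun w => (- X w, Y w)%R)
  (fun p : R * R => p.1 * p.2)%R) => //.
- by apply: measurable_funM => //.
- have HU := @product_measure_unique _ _ _ _ R (distribution P X) (distribution P Y)
    (pushforward P (mfun_of mU)) (fun A B mA mB => indep mA mB).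
  have HV := @product_measure_unique _ _ _ _ R (distribution P X) (distribution P Y)
    (pushforward P (mfun_of mV)).
  move=> C mC; rewrite -[LHS]/(pushforward P (mfun_of mU) C) -HU// HV//.
  move=> A B mA mB.
  transitivity (P (X @^-1` (-%R @^-1` A) `&` Y @^-1` B)) => //.
  rewrite indep//; last exact: mopp.
  congr (_ * _); rewrite lawX; last exact: mopp.
  by rewrite normal_prob_opp// -lawX.
- by move=> w /=; rewrite mulNr.
- exact: integrable_gaussian_prod.
Qed.

End uncorrelated_pair.

Section tail.
Variables (R : realType) (disp : measure_display) (Omega : measurableType disp).
Variable P : probability Omega R.
Variables (n : nat) (zeta : 'I_n -> {RV P >-> R}) (s : R).
Hypothesis s_gt0 : 0 < s.
Hypothesis law : forall i B, measurable B -> P (zeta i @^-1` B) = normal_prob 0 s B.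
Hypothesis indep : forall i j A B, i != j -> measurable A -> measurable B ->
  P (zeta i @^-1` A `&` zeta j @^-1` B) = (P (zeta i @^-1` A) * P (zeta j @^-1` B))%E.

(** The constant 1 is treated as one more variable, uncorrelated with the noise, so
    that the second moment below is a single sum of squares. *)
Let X (o : option 'I_n) (w : Omega) : R := if o is Some i then zeta i w else 1.
Let m (o : option 'I_n) : R := if o is Some i then normal_var s else 1.

Let moments o o' :
  P.-integrable setT (fun w => (X o w * X o' w)%:E) /\
  (\int[P]_w (X o w * X o' w)%:E = ((o == o')%:R * m o)%:E)%E.
Proof.
have int1 : P.-integrable setT (fun _ : Omega => 1%:E).
  exact: finite_measure_integrable_cst.
case: o o' => [i|] [j|] /=.
- have [->|ij] := eqVneq i j.
    have e : (fun w => (zeta j w * zeta j w)%:E) = (fun w => (zeta j w ^+ 2)%:E).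
      by apply/funext => w; rewrite expr2.
    rewrite e eqxx mul1r (gaussian_sqr s_gt0 (law j)); split=> //.
    exact: (integrable_gaussian_sqr s_gt0 (law j)).
  have ind A B : measurable A -> measurable B ->
    P (zeta i @^-1` A `&` zeta j @^-1` B) = (P (zeta i @^-1` A) * P (zeta j @^-1` B))%E.
    by move=> mA mB; exact: indep.
  have -> : (Some i == Some j) = false by exact: negbTE.
  rewrite mul0r (gaussian_uncorrelated s_gt0 (law i) (law j) ind); split=> //.
  exact: (integrable_gaussian_prod s_gt0 (law i) (law j)).
- under eq_fun do rewrite mulr1.
  rewrite mul0r (gaussian_mean0 s_gt0 (law i)); split=> //.
  exact: (integrable_gaussian s_gt0 (law i)).
- under eq_fun do rewrite mul1r.
  rewrite mul0r (gaussian_mean0 s_gt0 (law j)); split=> //.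
  exact: (integrable_gaussian s_gt0 (law j)).
- rewrite !mul1r; split=> //.
  by rewrite integral_cst// mul1e; exact: probability_setT.
Qed.

Variables (b : R) (w : 'I_n -> R).

Definition noisy (om : Omega) : R := b + \sum_i w i * zeta i om.

Lemma measurable_noisy : measurable_fun setT noisy.
Proof.
apply: measurable_funD => //; apply: measurable_sum => i.
by apply: measurable_funM => //; exact: measurable_funP.
Qed.

Let c (o : option 'I_n) : R := if o is Some i then w i else b.

Lemma noisy_second_moment :
  (\int[P]_om (noisy om ^+ 2)%:E = (b ^+ 2 + normal_var s * \sum_i w i ^+ 2)%:E)%E.
Proof.
have YE om : noisy om = \sum_o c o * X o om.
  by rewrite sum_option /= mulr1.
have e om : (noisy om ^+ 2)%:E =
    (\sum_o \sum_o' (c o * c o')%:E * (X o om * X o' om)%:E)%E.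
  under eq_bigr do (under eq_bigr do rewrite -EFinM; rewrite sumEFin).
  rewrite sumEFin; congr EFin; rewrite YE expr2 mulr_suml; apply: eq_bigr => o _.
  by rewrite mulr_sumr; apply: eq_bigr => o' _; ring.
under eq_integral do rewrite e.
have int o o' : P.-integrable setT (fun om => (c o * c o')%:E * (X o om * X o' om)%:E)%E.
  by apply: integrableZl => //; have [] := moments o o'.
rewrite integral_sum//; last by move=> o; exact: integrable_sum.
under eq_bigr => o _.
  rewrite integral_sum//.
  under eq_bigr => o' _.
    rewrite integralZl//; last by have [] := moments o o'.
    rewrite (moments o o').2 -EFinM.
    over.
  rewrite sumEFin (bigD1 o)//= big1 ?addr0; last first.
    by move=> o' /negPf oo'; rewrite eq_sym oo' mul0r mulr0.
  rewrite eqxx mul1r.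
  over.
rewrite sumEFin sum_option /= mulr1 -expr2; congr (_ + _)%:E.
by rewrite mulr_sumr; apply: eq_bigr => i _; rewrite -expr2 mulrC.
Qed.

(** Chebyshev's inequality. *)
Lemma noisy_tail (r : R) : 0 < r ->
  (P [set om | (r <= `|noisy om|)%R] <=
    ((b ^+ 2 + normal_var s * \sum_i w i ^+ 2) / r ^+ 2)%:E)%E.
Proof.
move=> r0; have r2 : 0 < r ^+ 2 by rewrite exprn_gt0.
have mY : measurable_fun setT (fun om => (noisy om ^+ 2)%:E).
  by apply/measurable_EFinP; apply: measurable_funX; exact: measurable_noisy.
have := le_integral_abse P measurableT mY r2.
rewrite setTI; under eq_integral do rewrite gee0_abs ?lee_fin ?sqr_ge0//.
rewrite noisy_second_moment.
have -> : [set om | ((r ^+ 2)%:E <= `|(noisy om ^+ 2)%:E|)%E] =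
    [set om | r <= `|noisy om|].
  apply/seteqP; split=> om /=; rewrite lee_fin normrX ler_pXn2r ?nnegrE//; exact: ltW.
by move=> h; rewrite EFinM lee_pdivlMr// muleC.
Qed.

End tail.

(** * Second differences and smooth kernels *)

Section kernel_smoothness.
Variable R : realType.
Local Notation I := (unit_itv R).

(** The continuity clause of [Cr_square]. *)
Definition cont_sq (g : R -> R -> R) : Prop :=
  {within I `*` I, continuous (fun p : R * R => g p.1 p.2)}.

Lemma slice_cvg (s t : R) : I t ->
  (fun s' : R => (s', t)) @ within I (nbhs s) --> within (I `*` I) (nbhs (s, t)).
Proof.
move=> It U /= [[B C] /= [nB nC] BCU]; rewrite /nbhs /=.
apply: filterS nB => s' Bs' Is'; apply: (BCU (s', t)) => //=.
by split=> //; exact: nbhs_singleton nC.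
Qed.

Lemma slice_cvgr (s t : R) : I s ->
  (fun t' : R => (s, t')) @ within I (nbhs t) --> within (I `*` I) (nbhs (s, t)).
Proof.
move=> Is U /= [[B C] /= [nB nC] BCU]; rewrite /nbhs /=.
apply: filterS nC => t' Ct' It'; apply: (BCU (s, t')) => //=.
by split=> //; exact: nbhs_singleton nB.
Qed.

Lemma cont_sq_slice g t : cont_sq g -> I t -> {within I, continuous (g^~ t)}.
Proof.
move=> /subspace_continuousP gc It; apply/subspace_continuousP => s Is.
apply: (cvg_comp (fun s' : R => (s', t)) (fun p : R * R => g p.1 p.2) (slice_cvg It)).
by apply: (gc (s, t)); split.
Qed.

Lemma cont_sq_slicer g s : cont_sq g -> I s -> {within I, continuous (g s)}.
Proof.
move=> /subspace_continuousP gc Is; apply/subspace_continuousP => t It.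
apply: (cvg_comp (fun t' : R => (s, t')) (fun p : R * R => g p.1 p.2) (slice_cvgr Is)).
by apply: (gc (s, t)); split.
Qed.

Lemma cont_sq_bounded g : cont_sq g -> exists C, forall s t, I s -> I t -> `|g s t| <= C.
Proof.
move=> gc; have cI : compact (I `*` I) by apply: compact_setX; exact: segment_compact.
have /compact_bounded[M [_ HM]] := continuous_compact gc cI.
exists (M + 1) => s t Is It; apply: (HM (M + 1)); first by rewrite ltrDl.
by exists (s, t).
Qed.

Definition dS (g : R -> R -> R) (s t : R) : R := deriv01 (g^~ t : R -> R^o) s.
Definition dT (g : R -> R -> R) (s t : R) : R := deriv01 (g s : R -> R^o) t.

Lemma Cr_squareS r (g : R -> R -> R) : @Cr_square R r.+1 g ->
  [/\ cont_sq g, forall s t, I s -> I t -> diffq_cvg (g^~ t) s (dS g s t),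
      forall s t, I s -> I t -> diffq_cvg (g s) t (dT g s t),
      @Cr_square R r (dS g) & @Cr_square R r (dT g)].
Proof.
case=> c [cs ct rs rt]; split; [exact: c| | |exact: rs|exact: rt].
- by move=> s t Is It; have := cs s t Is It.
- by move=> s t Is It; have := ct s t Is It.
Qed.

Lemma diffq_cvg_second (h1 h2 h3 : R -> R) x l1 l2 l3 :
  diffq_cvg h1 x l1 -> diffq_cvg h2 x l2 -> diffq_cvg h3 x l3 ->
  diffq_cvg (fun s => h1 s - 2 * h2 s + h3 s) x (l1 - 2 * l2 + l3).
Proof.
rewrite /diffq_cvg => c1 c2 c3.
rewrite (_ : (fun y : R => _) = fun y => (y - x)^-1 * (h1 y - h1 x) -
  2 * ((y - x)^-1 * (h2 y - h2 x)) + (y - x)^-1 * (h3 y - h3 x)); last first.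
  by apply/funext => y; ring.
by apply: cvgD => //; apply: cvgB => //; apply: cvgM => //; exact: cvg_cst.
Qed.

Lemma within_second (A : set R) (h1 h2 h3 : R -> R) :
  {within A, continuous h1} -> {within A, continuous h2} ->
  {within A, continuous h3} ->
  {within A, continuous (fun s => h1 s - 2 * h2 s + h3 s)}.
Proof.
move=> c1 c2 c3 s; apply: cvgD; last exact: c3.
by apply: cvgB; [exact: c1|apply: cvgM; [exact: cvg_cst|exact: c2]].
Qed.

(** Two derivatives are used for the second difference in the first variable, and
    two for the one in the second variable. *)
Lemma mixed_difference (g : R -> R -> R) : @Cr_square R 4 g -> exists C, forall x r,
  0 < r -> 0 <= x - r -> x + r <= 1 ->
  let G s := g s (x + r) - 2 * g s x + g s (x - r) in
  `|G (x + r) - 2 * G x + G (x - r)| <= C * r ^+ 4.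
Proof.
move=> H0; have [c0 d0 _ H1 _] := Cr_squareS H0.
have [c1 d1 _ H2 _] := Cr_squareS H1; have [c2 _ d2 _ H3] := Cr_squareS H2.
have [c3 _ d3 _ [c4 _]] := Cr_squareS H3.
have [C HC] := cont_sq_bounded c4.
exists (4 * C) => x r r0 xr0 xr1 /=.
have Ix : I x by rewrite /unit_itv /= in_itv /=; apply/andP; split; lra.
have Ip : I (x + r) by rewrite /unit_itv /= in_itv /=; apply/andP; split; lra.
have Im : I (x - r) by rewrite /unit_itv /= in_itv /=; apply/andP; split; lra.
have Is s : 0 < s < 1 -> I s.
  by rewrite /unit_itv /= in_itv /= => /andP[? ?]; rewrite !ltW.
have -> : 4 * C * r ^+ 4 = 2 * (2 * C * r ^+ 2) * r ^+ 2 by ring.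
apply: (@second_difference R (fun s => g s (x + r) - 2 * g s x + g s (x - r))
  (fun s => dS g s (x + r) - 2 * dS g s x + dS g s (x - r))
  (fun s => dS (dS g) s (x + r) - 2 * dS (dS g) s x + dS (dS g) s (x - r))) => //.
- by apply: within_second; exact: cont_sq_slice.
- by apply: within_second; exact: cont_sq_slice.
- by move=> s /Is s01; apply: diffq_cvg_second; exact: d0.
- by move=> s /Is s01; apply: diffq_cvg_second; exact: d1.
- move=> s /Is s01.
  apply: (@second_difference R (dS (dS g) s) (dT (dS (dS g)) s)
    (dT (dT (dS (dS g))) s)) => //.
  + exact: cont_sq_slicer.
  + exact: cont_sq_slicer.
  + by move=> t /Is t01; exact: d2.
  + by move=> t /Is t01; exact: d3.
  + by move=> t /Is t01; exact: HC.
Qed.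

Variables (T : Type) (k : T -> T -> R) (ph : R -> T).

Definition second_diff (x r : R) : seq (R * T) :=
  [:: (1, ph (x + r)); (- 2, ph x); (1, ph (x - r))].

Lemma functional_second_diff x r h :
  functional (second_diff x r) h = h (ph (x + r)) - 2 * h (ph x) + h (ph (x - r)).
Proof.
by rewrite /functional /second_diff !big_cons big_nil /=; ring.
Qed.

(** The squared norm of a second difference is the kernel, differenced twice in
    each variable. *)
Lemma second_diff_norm : is_kernel k ->
  @Cr_square R 4 (fun s t => k (ph s) (ph t)) -> exists C, forall x r,
  0 < r -> 0 <= x - r -> x + r <= 1 ->
  span_dot k (second_diff x r) (second_diff x r) <= C * r ^+ 4.
Proof.
move=> hk hC; have [C HC] := mixed_difference hC; exists C => x r r0 xr0 xr1.
apply: le_trans (HC x r r0 xr0 xr1).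
rewrite span_dotE functional_second_diff /span_eval /second_diff.
rewrite !big_cons !big_nil /=; apply: le_trans (ler_norm _).
by rewrite le_eqVlt; apply/orP; left; apply/eqP; ring.
Qed.

End kernel_smoothness.

(** * Visits of a dense sequence to open sets *)

Section visits.
Variable R : realType.

Lemma seq_max_exists (l : seq R) : l != [::] ->
  exists2 m, m \in l & forall u, u \in l -> u <= m.
Proof.
elim: l => // x l IHl _; have [->|/IHl[m ml mmax]] := eqVneq l [::].
  by exists x; rewrite ?mem_head// => u; rewrite inE => /eqP ->.
have [xm|mx] := leP x m.
  exists m; first by rewrite in_cons ml orbT.
  by move=> u; rewrite in_cons => /orP[/eqP->//|]; exact: mmax.
exists x; first exact: mem_head.
move=> u; rewrite in_cons => /orP[/eqP->//|/mmax um].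
exact: le_trans um (ltW mx).
Qed.

Lemma finite_set_max (S : set R) : finite_set S -> S !=set0 ->
  exists2 m, S m & forall u, S u -> u <= m.
Proof.
move=> /finite_seqP[l ->] [x /= xl].
have [|m ml mmax] := @seq_max_exists l; last by exists m.
by apply: contraTneq xl => ->.
Qed.

Lemma finite_set_min (S : set R) : finite_set S -> S !=set0 ->
  exists2 m, S m & forall u, S u -> m <= u.
Proof.
move=> fS [x Sx].
have [||m [y Sy <-] H] := @finite_set_max (-%R @` S).
- exact: finite_image.
- by exists (- x); exists x.
by exists y => // u Su; rewrite -lerN2; apply: H; exists u.
Qed.

Lemma enorm_ge0 d (x : 'rV[R]_d) : 0 <= enorm x.
Proof. exact: sqrtr_ge0. Qed.

Lemma enorm_gt0 d (x : 'rV[R]_d) : x != 0 -> 0 < enorm x.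
Proof.
move=> x0; rewrite sqrtr_gt0 lt_neqAle sumr_ge0; last first.
  by move=> i _; rewrite -expr2 sqr_ge0.
rewrite andbT eq_sym psumr_eq0; last by move=> i _; rewrite -expr2 sqr_ge0.
apply: contra_neqN x0 => /allP H; apply/rowP => i; rewrite mxE; apply/eqP.
by have := H i; rewrite mem_index_enum mulf_eq0 orbb => /(_ isT).
Qed.

(** Infinitely many indices fall in [U], expressed by arbitrarily long lists of
    distinct indices. *)
Definition often (T : Type) (a : nat -> T) (U : set T) : Prop :=
  forall M : nat, exists l : seq nat, [/\ uniq l, size l = M & forall i, i \in l -> U (a i)].

Lemma often_card (T : Type) (a : nat -> T) (U : set T) : often a U ->
  forall M, exists n0, forall n, (n0 <= n)%N ->
    (M <= #|[set i : 'I_n | `[< U (a i) >]]%SET|)%N.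
Proof.
move=> oU M; have [l [ul <- lU]] := oU M.
exists (\max_(i <- l) i).+1 => n ln.
have lt_n i : i \in l -> (i < n)%N.
  by move=> il; apply: leq_trans ln; rewrite ltnS; exact: leq_bigmax_seq.
have -> : l = [seq val i | i <- pmap (insub : nat -> option 'I_n) l].
  rewrite (pmap_filter (@insubK _ _ _)); apply/esym/all_filterP/allP => i /lt_n il.
  by rewrite insubT.
rewrite size_map cardE; apply: uniq_leq_size; first exact: pmap_sub_uniq.
move=> i; rewrite mem_pmap_sub => il; rewrite mem_enum inE.
by apply/asboolP; exact: lU.
Qed.

Lemma often_io (T : Type) (a : nat -> T) (U : set T) :
  (forall N : nat, exists n : nat, (N <= n)%N /\ U (a n)) -> often a U.
Proof.
move=> H; elim=> [|M [l [ul sl lU]]]; first by exists [::].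
have [n [ln Un]] := H (\max_(i <- l) i).+1.
exists (n :: l); split=> /=; last first.
- by move=> i; rewrite in_cons => /orP[/eqP->|/lU].
- by rewrite sl.
- rewrite ul andbT; apply/negP => nl.
  by move: ln; rewrite ltnNge leq_bigmax_seq.
Qed.

Lemma often_sub (T : Type) (a : nat -> T) (U U' : set T) : U `<=` U' ->
  often a U -> often a U'.
Proof.
by move=> UU' H M; have [l [ul sl lU]] := H M; exists l; split=> // i /lU/UU'.
Qed.

Variables (W : cw_complex) (d : nat) (f : cw_space R W -> 'rV[R]_d).
Hypothesis fi : injective f.
Variable a : nat -> cw_space R W.
Hypothesis ad : compatible_dense_seq f a.

Let CD := cw_cell_dec R W.

(** Otherwise all compatible subsets of the sequence leave the arc inside one gap. As
    [f] is injective, the images of two interior points [s1] and [t1] differ, and the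
    length of the gap is at least their distance, whatever the subset. *)
Lemma visit_arc (e : cw_edge W) (s0 t0 : R) : 0 <= s0 -> s0 < t0 -> t0 <= 1 ->
  exists i u, s0 < u < t0 /\ a i = cw_char e u.
Proof.
move=> s00 st t01.
pose s1 := (2 * s0 + t0) / 3; pose t1 := (s0 + 2 * t0) / 3.
have s01 : s0 < s1 by rewrite /s1; lra.
have st1 : s1 < t1 by rewrite /s1 /t1; lra.
have t11 : t1 < t0 by rewrite /t1; lra.
have Is : 0 < s1 < 1 by apply/andP; split; lra.
have It : 0 < t1 < 1 by apply/andP; split; lra.
have fne : f (cw_char e t1) - f (cw_char e s1) != 0.
  rewrite subr_eq0; apply/eqP => /fi /(cd_arc CD It Is)[_ ts].
  by move: st1; rewrite ts ltxx.
have [A [finA Aa [A0 A1] dens]] := ad (enorm_gt0 fne).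
apply: contrapT => nex.
have nA u : s0 < u < t0 -> ~ A (cw_char e u).
  by move=> u01 /Aa [i _ ai]; apply: nex; exists i, u.
(* The gap is bounded by the parameters of [A] closest to the two points, which
   exist as [A] is finite and contains the ends of the cell. *)
pose S := [set u : R | 0 <= u <= 1 /\ A (cw_char e u)].
have finS : finite_set S.
  have -> : S = (S `&` [set 0; 1]) `|` (S `&` [set u | 0 < u < 1]).
    rewrite -setIUr; apply/esym/setIidPl => u [/andP[u0 u1] _].
    move: u0 u1; rewrite le_eqVlt => /predU1P[<- _|u0]; first by left; left.
    by rewrite le_eqVlt => /predU1P[->|u1]; [left; right|right; rewrite /= u0].
  rewrite finite_setU; split; first by apply: finite_setIr; exact: finite_set2.
  pose h z := xget (0 : R) [set u | 0 < u < 1 /\ cw_char e u = z].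
  apply: (sub_finite_set _ (finite_image h finA)) => u [[_ Au] u01].
  exists (cw_char e u) => //; rewrite /h; case: xgetP => [v _ [v01 vu]|]; last first.
    by move/(_ u); case.
  by have [] := cd_arc CD v01 u01 vu.
have A0e : A (cw_char e 0).
  by rewrite (cw_char_end R e false); apply: A0; exists (attach e false).
have A1e : A (cw_char e 1).
  by rewrite (cw_char_end R e true); apply: A0; exists (attach e true).
have [||sg [[/andP[sg0 sg1] Asg] sgs] sgmax] := @finite_set_max (S `&` [set u | u <= s1]).
- exact: finite_setIl.
- by exists 0; split; [split; [rewrite lexx ler01|]|rewrite /=; lra].
have [||tg [[/andP[tg0 tg1] Atg] tgt] tgmin] := @finite_set_min (S `&` [set u | t1 <= u]).
- exact: finite_setIl.
- by exists 1; split; [split; [rewrite lexx ler01|]|rewrite /=; lra].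
have sgs' : sg < s1.
  rewrite lt_neqAle sgs andbT; apply/eqP => e1; apply: (nA s1); last by rewrite -e1.
  by apply/andP; split; lra.
have tgt' : t1 < tg.
  rewrite lt_neqAle tgt andbT; apply/eqP => e1; apply: (nA t1); last by rewrite e1.
  by apply/andP; split; lra.
have gap : cw_gap A e sg tg.
  split; split=> //; first by lra.
  move=> u /andP[su ut] Au; have u01 : 0 <= u <= 1 by apply/andP; split; lra.
  have [us|su1] := leP u s1.
    by have := sgmax u (conj (conj u01 Au) us); rewrite leNgt su.
  have [tu|ut1] := leP t1 u.
    by have := tgmin u (conj (conj u01 Au) tu); rewrite leNgt ut.
  by apply: (nA u) => //; apply/andP; split; lra.
have := dens e sg tg gap; rewrite ltNge => /negP; apply.
apply: le_ereal_sup_tmp; eexists.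
  exists [:: s1; t1; tg]; last reflexivity.
  by rewrite /itv_partition /= sgs' st1 tgt' eqxx.
rewrite lee_fin /= !big_nat_recl//= big_geq// addr0.
by rewrite addrCA lerDl addr_ge0// enorm_ge0.
Qed.

(** By halving the interval: the visits to the first half are distinct from a visit
    to the second. *)
Lemma often_arc (e : cw_edge W) (s0 t0 : R) : 0 <= s0 -> s0 < t0 -> t0 <= 1 ->
  often a [set cw_char e u | u in [set u : R | s0 < u < t0]].
Proof.
move=> s00 st t01 M; elim: M s0 t0 s00 st t01 => [|M IHM] s0 t0 s00 st t01.
  by exists [::].
pose m := (s0 + t0) / 2.
have s0m : s0 < m by rewrite /m; lra.
have mt0 : m < t0 by rewrite /m; lra.
have m1 : m <= 1 by lra.
have m0 : 0 <= m by lra.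
have [l [ul sl lU]] := IHM s0 m s00 s0m m1.
have [i [u [/andP[mu ut] ai]]] := visit_arc e m0 mt0 t01.
exists (i :: l); split=> /=; last first.
- move=> j; rewrite in_cons => /orP[/eqP->|/lU[v /andP[sv vm] <-]].
    by exists u => //=; rewrite (lt_trans s0m).
  by exists v => //=; rewrite sv (lt_trans vm).
- by rewrite sl.
- rewrite ul andbT; apply/negP => /lU[v /andP[sv vm]]; rewrite ai => vu.
  have v01 : 0 < v < 1 by apply/andP; split; lra.
  have u01 : 0 < u < 1 by apply/andP; split; lra.
  by have [_ e1] := cd_arc CD v01 u01 vu; move: vm; rewrite e1 ltNge ltW.
Qed.

Hypothesis aiso : forall x : cw_vertex W,
  (forall (e : cw_edge W) (b : bool), attach e b <> x) ->
  forall N : nat, exists n : nat, (N <= n)%N /\ a n = cw_pt R x.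

(** A neighbourhood of a point that is on a cell contains an arc of this cell; the
    only other points are the isolated vertices, which are visited by assumption. *)
Lemma often_nbhs (z : cw_space R W) (U : set (cw_space R W)) : nbhs z U -> often a U.
Proof.
move=> zU.
have arc e s : 0 <= s <= 1 -> z = cw_char e s -> often a U.
  move=> /andP[s0 s1] ze.
  have : nbhs s (@cw_char R W e @^-1` U).
    by have := @cw_char_continuous R W e s U; rewrite -ze => /(_ zU).
  case/nbhs_ballP => r /= r0 rU.
  pose u0 : R := Num.max 0 (s - r); pose u1 : R := Num.min 1 (s + r).
  apply: (@often_sub _ a [set cw_char e u | u in [set u : R | u0 < u < u1]]).
    move=> y [u hu <-]; move: hu; rewrite /= gt_max lt_min => /andP[/andP[u00 su] /andP[u01 us]].
    by apply: rU; rewrite /ball /= ltr_distlC; apply/andP; split; lra.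
  apply: often_arc; rewrite ?le_max ?lexx ?ge_min ?lexx//.
  rewrite gt_max !lt_min ltr01 /=; apply/andP; split; first by lra.
  by apply/andP; split; lra.
case: (cw_spaceP z) => [[v zv]|[e [s [/andP[s0 s1] ze]]]]; last first.
  by apply: (arc e s) => //; rewrite !ltW.
have [[e [b eb]]|niso] := pselect (exists e b, attach (c := W) e b = v).
  apply: (arc e b%:R); first by case: b {eb}; rewrite ?lexx ?ler01.
  by rewrite cw_char_end eb.
apply: often_io => N; have [|n [Nn an]] := aiso (x := v) _ N.
  by move=> e b eb; apply: niso; exists e, b.
by exists n; split=> //; rewrite an -zv; exact: nbhs_singleton.
Qed.

End visits.

(** Continuity of the kernel makes it nearly constant near [z], and the sequence has
    as many points there as desired. *)
Lemma ridge_consistent (R : realType) (Z : topologicalType) (k : Z -> Z -> R)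
    (a : nat -> Z) (sigma : R) (z : Z) :
  is_kernel k -> continuous (fun p : Z * Z => k p.1 p.2) -> 0 < sigma ->
  (forall U, nbhs z U -> often a U) ->
  forall eps, 0 < eps -> exists n0, forall n, (n0 <= n)%N ->
    exists w, ridge k (fun i : 'I_n => a i) sigma [:: (1, z)] w <= eps.
Proof.
move=> hk kc sigma0 oU eps eps0.
have e8 : 0 < eps / 8 by rewrite divr_gt0.
have /cvgrPdist_lt/(_ _ e8)[[A B] /= [nA nB] AB] := kc (z, z).
pose U := A `&` B.
have nU : nbhs z U by exact: filterI.
have Uz : U z by exact: nbhs_singleton nU.
have Uk x y : U x -> U y -> `|k x y - k z z| <= eps / 8.
  by move=> [Ax _] [_ By]; rewrite distrC; apply: ltW; apply: (AB (x, y)).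
(* More than [2 * sigma ^+ 2 / eps] points make the variance less than [eps / 2]. *)
pose M := (Num.truncn (2 * sigma ^+ 2 / eps)).+1.
have [n0 Hn0] := often_card (oU U nU) M.
exists n0 => n /Hn0; set S : {set 'I_n} := finset _ => MS.
have S0 : (0 < #|S|)%N by exact: leq_ltn_trans MS.
exists (\row_i (#|S|%:R^-1 * (i \in S)%:R)).
have SU i : i \in S -> U (a i) by rewrite inE => /asboolP.
apply: (le_trans (@ridge_average _ _ k hk _ _ sigma z S (eps / 8) (k z z) _ S0 _ _ _)).
- exact: ltW.
- exact: Uk.
- by move=> i /SU; exact: Uk.
- by move=> i j /SU ? /SU ?; exact: Uk.
have : sigma ^+ 2 / #|S|%:R <= eps / 2.
  rewrite ler_pdivrMr ?ltr0n// mulrAC ler_pdivlMr// mulrC.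
  have : 2 * sigma ^+ 2 / eps <= #|S|%:R.
    by apply: le_trans (ltW (truncnS_gt _)) _; rewrite ler_nat.
  by rewrite ler_pdivrMr// [eps * _]mulrC.
lra.
Qed.

(** * Dyadic chaining *)

Section chaining.
Variables (R : realType) (u : R -> R) (m0 : nat) (del : R).

Let D (m j : nat) : R := u (j.+1%:R / 2 ^+ m) - u (j%:R / 2 ^+ m).

(** Halving an interval of length [2 ^- m] changes the slope by at most
    [2 ^+ m * (3 / 8) ^+ m = (3 / 4) ^+ m], and [4 * (3 / 4) ^+ m0] is the sum of these
    changes over all levels from [m0] on. *)
Definition chain_lip : R := del + 4 * (3 / 4) ^+ m0.

Let S (m : nat) : R := del + 4 * ((3 / 4) ^+ m0 - (3 / 4) ^+ m).

Hypothesis uc : {within unit_itv R, continuous u}.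
Hypothesis slope0 : forall j, (j < 2 ^ m0)%N -> `|D m0 j| <= del / 2 ^+ m0.
Hypothesis second : forall m j, (m0 <= m)%N -> (j < 2 ^ m)%N ->
  `|u (j.*2.+2%:R / 2 ^+ m.+1) - 2 * u (j.*2.+1%:R / 2 ^+ m.+1)
    + u (j.*2%:R / 2 ^+ m.+1)| <= (3 / 8) ^+ m.

Let pow2_gt0 m : 0 < 2 ^+ m :> R.
Proof. by rewrite exprn_gt0. Qed.

Let slope m j : (m0 <= m)%N -> (j < 2 ^ m)%N -> `|D m j| <= S m / 2 ^+ m.
Proof.
move=> m0m; elim: m m0m j => [|m IHm].
  rewrite leqn0 => /eqP m00 j; have := @slope0 j; rewrite m00 => H /H.
  by rewrite /S m00 subrr mulr0 addr0.
rewrite leq_eqVlt => /predU1P[<- j jm|].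
  by rewrite /S subrr mulr0 addr0; exact: slope0.
rewrite ltnS => m0m j jm.
have j2 : (j./2 < 2 ^ m)%N.
  rewrite -ltn_double -mul2n -[(2 ^ m).*2]mul2n -expnS mul2n.
  by apply: leq_ltn_trans jm; rewrite -[leqRHS]odd_double_half leq_addl.
have := second m0m j2; have := IHm m0m _ j2.
have half (i : nat) : i%:R / 2 ^+ m = i.*2%:R / 2 ^+ m.+1 :> R.
  rewrite exprS -mul2n natrM; have := gt_eqF (pow2_gt0 m).
  by move: (2 ^+ m) (i%:R) => p q /negbT p0; field.
rewrite /D !half doubleS.
set U0 := u (_.*2%:R / _); set U1 := u (_.*2.+1%:R / _); set U2 := u (_.*2.+2%:R / _).
have eS : S m.+1 / 2 ^+ m.+1 = (S m / 2 ^+ m + (3 / 8) ^+ m) / 2.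
  rewrite /S !exprS (_ : 3 / 8 = (3 / 4) / 2 :> R); last by field.
  rewrite [((3 / 4) / 2) ^+ m]expr_div_n; have := gt_eqF (pow2_gt0 m).
  by move: (2 ^+ m) ((3 / 4) ^+ m) ((3 / 4) ^+ m0) => p q q0 /negbT p0; field.
rewrite eS => h1 h2.
have [jo|je] := boolP (odd j).
  have -> : j = (j./2.*2).+1 by rewrite -[LHS]odd_double_half jo.
  rewrite -/U1 -/U2; move: h1 h2; rewrite !ler_norml => /andP[? ?] /andP[? ?].
  by apply/andP; split; lra.
have -> : j = j./2.*2 by rewrite -[LHS]odd_double_half (negPf je).
rewrite -/U1 -/U0; move: h1 h2; rewrite !ler_norml => /andP[? ?] /andP[? ?].
by apply/andP; split; lra.
Qed.

Let dyadic m i j : (m0 <= m)%N -> (i + j <= 2 ^ m)%N ->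
  `|u ((i + j)%:R / 2 ^+ m) - u (i%:R / 2 ^+ m)| <= chain_lip * (j%:R / 2 ^+ m).
Proof.
move=> m0m; elim: j => [|j IHj] ijm.
  by rewrite addn0 subrr normr0 mul0r mulr0.
have ijm' : (i + j < 2 ^ m)%N by rewrite -addnS.
have h1 := IHj (ltnW ijm'); have h2 := slope m0m ijm'.
rewrite addnS -(subrK (u ((i + j)%:R / 2 ^+ m)) (u _)) -addrA.
apply: le_trans (ler_normD _ _) _.
have -> : chain_lip * (j.+1%:R / 2 ^+ m) =
    chain_lip / 2 ^+ m + chain_lip * (j%:R / 2 ^+ m) by rewrite -natr1; ring.
apply: lerD => //; apply: (le_trans h2); rewrite ler_pM2r ?invr_gt0//.
rewrite /S /chain_lip lerD2l ler_pM2l// gerBl exprn_ge0//.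
Qed.

(** The slopes between adjacent dyadic points are bounded at every level, hence so
    are those between arbitrary dyadic points of one level; these points are dense
    and [u] is continuous. *)
Lemma dyadic_lipschitz s s' : 0 <= s <= 1 -> 0 <= s' <= 1 ->
  `|u s - u s'| <= chain_lip * `|s - s'|.
Proof.
wlog ss' : s s' / s' <= s.
  move=> H s01 s'01; have [ss'|ss'] := leP s' s; first exact: H.
  by rewrite distrC [`|s - s'|]distrC; apply: H => //; exact: ltW.
move=> /andP[s0 s1] /andP[s'0 s'1]; rewrite [`|s - s'|]ger0_norm ?subr_ge0//.
have L0 : 0 <= chain_lip.
  apply: addr_ge0; last by rewrite mulr_ge0// exprn_ge0// divr_ge0.
  have := @slope0 0%N; rewrite expn_gt0 => /(_ isT) /(le_trans (normr_ge0 _)).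
  by rewrite pmulr_lge0// invr_gt0.
apply/ler_addgt0Pl => e e0; have e4 : 0 < e / 4 by rewrite divr_gt0.
have [rho rho0 Hrho] := heine01 uc e4.
pose r := Num.min rho (e / (4 * (chain_lip + 1))).
have c0 : 0 < 4 * (chain_lip + 1) by rewrite mulr_gt0// ltr_wpDl.
have r0 : 0 < r by rewrite lt_min rho0 divr_gt0.
pose m := maxn m0 (Num.truncn r^-1).+1.
have m0m : (m0 <= m)%N by exact: leq_maxl.
have mr : (2 ^+ m)^-1 <= r.
  rewrite -[leRHS]invrK lef_pV2 ?posrE ?invr_gt0//; apply: ltW.
  apply: lt_le_trans (truncnS_gt _) _; rewrite -natrX ler_nat.
  by apply: leq_trans (ltnW (ltn_expl _ _)) => //; exact: leq_maxr.
pose q (x : R) := Num.truncn (2 ^+ m * x).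
have qP x : 0 <= x -> (q x)%:R <= 2 ^+ m * x < (q x)%:R + 1.
  by move=> x0; rewrite natr1; apply: truncn_itv; rewrite mulr_ge0// ltW.
have q1 x : 0 <= x <= 1 -> (q x <= 2 ^ m)%N.
  move=> /andP[x0 x1]; have /andP[h _] := qP x x0.
  rewrite -(ler_nat R) natrX; apply: (le_trans h).
  by rewrite -[leRHS]mulr1 ler_pM2l.
have qm x : 0 <= x -> 0 <= x - (q x)%:R / 2 ^+ m <= (2 ^+ m)^-1.
  move=> /qP/andP[h1 h2]; rewrite subr_ge0 ler_pdivrMr// mulrC h1 /=.
  rewrite lerBlDr -[X in X + _]mul1r -mulrDl ler_pdivlMr// mulrC.
  by rewrite addrC ltW.
have qss : (q s' <= q s)%N by apply: le_truncn; rewrite ler_pM2l.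
have qsE : q s = (q s' + (q s - q s'))%N by rewrite subnKC.
have s01 : 0 <= s <= 1 by rewrite s0.
have s'01 : 0 <= s' <= 1 by rewrite s'0.
have h1 := @dyadic m (q s') (q s - q s') m0m.
rewrite -qsE in h1; have {}h1 := h1 (q1 s s01).
pose y : R := (q s)%:R / 2 ^+ m; pose y' : R := (q s')%:R / 2 ^+ m.
have yy : (q s - q s')%:R / 2 ^+ m = y - y' by rewrite natrB// mulrBl.
rewrite yy -/y -/y' in h1.
have /andP[sy1 sy2] := qm s s0; have /andP[sy1' sy2'] := qm s' s'0.
rewrite -/y in sy1 sy2; rewrite -/y' in sy1' sy2'.
have y0 : 0 <= y by rewrite divr_ge0// ltW.
have y'0 : 0 <= y' by rewrite divr_ge0// ltW.
have rrho : r <= rho by rewrite ge_min lexx.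
have hs : `|u s - u y| <= e / 4.
  by apply: Hrho => //; [apply/andP; split|rewrite ger0_norm//]; lra.
have hs' : `|u s' - u y'| <= e / 4.
  by apply: Hrho => //; [apply/andP; split|rewrite ger0_norm//]; lra.
have Lr : chain_lip * r <= e / 4.
  have re : r <= e / (4 * (chain_lip + 1)) by rewrite ge_min lexx orbT.
  rewrite ler_pdivlMr// mulrC mulrA.
  have : r * (4 * (chain_lip + 1)) <= e by rewrite -ler_pdivlMr.
  by move=> h; have := ltW r0; lra.
have Lyy : chain_lip * (y - y') <= chain_lip * (s - s') + chain_lip * r.
  by rewrite -mulrDr ler_wpM2l//; lra.
move: h1 hs hs'; rewrite !ler_norml => /andP[? ?] /andP[? ?] /andP[? ?].
by apply/andP; split; lra.
Qed.

End chaining.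

(** * Tails of the smoothing error *)

Section consistency.
Variables (R : realType) (W : cw_complex) (d : nat).
Local Notation Z := (cw_space R W).
Local Notation E := (cw_edge W).
Variables (f : Z -> 'rV[R]_d) (k : Z -> Z -> R) (a : nat -> Z) (sigma : 'I_d -> R).
Hypothesis k_kernel : is_kernel k.
Hypothesis k_cont : continuous (fun p : Z * Z => k p.1 p.2).
Hypothesis k_C4 : forall e, @Cr_square R 4 (fun s t => k (cw_char e s) (cw_char e t)).
Hypothesis f_RKHS : forall j, in_RKHS k (fun z => f z 0 j).
Hypothesis sigma_gt0 : forall j, 0 < sigma j.
Hypothesis a_often : forall (z : cw_space R W) (U : set (cw_space R W)), nbhs z U -> often a U.
Variables (disp : measure_display) (Omega : measurableType disp).
Variables (P : probability Omega R) (zeta : nat -> 'I_d -> {RV P >-> R}).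
Hypothesis law : forall i j B, measurable B ->
  P (zeta i j @^-1` B) = normal_prob 0 (sigma j) B.
Hypothesis indep : forall i i' j A B, i != i' -> measurable A -> measurable B ->
  P (zeta i j @^-1` A `&` zeta i' j @^-1` B) =
  (P (zeta i j @^-1` A) * P (zeta i' j @^-1` B))%E.

Definition smoothing_err (n : nat) (j : 'I_d) (w : Omega) (z : Z) : R :=
  smoothed_map k sigma f a (fun i j => zeta i j w) n z 0 j - f z 0 j.

Definition deviation (phi : seq (R * Z)) (n : nat) (j : 'I_d) (r : R) : set Omega :=
  [set w | r <= `|functional phi (smoothing_err n j w)|].

(** The functional of the error is a [noisy] variable, to which Chebyshev's
    inequality and the bounds of [smoothing_error] apply. The constant is the same
    for all functionals, so that these tails can be summed over infinitely many. *)
Lemma deviation_tail j : exists2 K, 0 <= K & forall phi n v r, 0 < r ->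
  measurable (deviation phi n j r) /\
  (P (deviation phi n j r) <=
    (K * ridge k (fun i : 'I_n => a i) (sigma j) phi v / r ^+ 2)%:E)%E.
Proof.
have [C C0 hC] := RKHS_bound k_kernel (f_RKHS j).
have s2 : 0 < sigma j ^+ 2 by rewrite exprn_gt0.
have v0 : 0 <= normal_var (sigma j).
  by apply: fine_ge0; apply: integral_ge0 => x _; rewrite lee_fin sqr_ge0.
exists (C + normal_var (sigma j) / sigma j ^+ 2).
  by rewrite addr_ge0// divr_ge0// ltW.
move=> phi n v r r0.
have [b [w [bw vw]]] := @smoothing_error _ _ k k_kernel n (fun i : 'I_n => a i)
  (sigma j) (sigma_gt0 j) (fun z => f z 0 j) C phi C0 hC.
pose ze (i : 'I_n) := zeta i j.
have dev : deviation phi n j r = [set om | r <= `|noisy ze b w om|].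
  suff e om : functional phi (smoothing_err n j om) = noisy ze b w om.
    by apply/seteqP; split=> om; rewrite /deviation /= e.
  have := bw (\col_i zeta i j om).
  rewrite (_ : (\col_i (_ + _)) = \col_i (f (a i) 0 j + zeta i j om)); last first.
    by apply/colP => i; rewrite !mxE.
  have -> : b + \sum_i w i * (\col_i zeta i j om) i 0 = noisy ze b w om.
    by congr (_ + _); apply: eq_bigr => i _; rewrite mxE.
  move=> <-; rewrite /functional -sumrB; apply: eq_bigr => p _.
  by rewrite -mulrBr /smoothing_err /smoothed_map mxE.
have [h1 h2] := vw v.
split.
  rewrite dev; have mY := @measurable_noisy _ _ _ P n ze b w.
  have := measurableT_comp (@normr_measurable R setT) mY.
  move=> mN; rewrite (_ : [set _ | _] = setT `&` (fun om => `|noisy ze b w om|) @^-1` `[r, +oo[).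
    exact: mN.
  by rewrite setTI; apply/seteqP; split=> om /=; rewrite in_itv /= andbT.
have ind i i' A B : i != i' -> measurable A -> measurable B ->
    P (ze i @^-1` A `&` ze i' @^-1` B) = (P (ze i @^-1` A) * P (ze i' @^-1` B))%E.
  by move=> ii' mA mB; apply: indep.
rewrite dev; apply: le_trans (noisy_tail (sigma_gt0 j) (fun i => @law i j) ind b w r0) _.
rewrite lee_fin ler_pM2r ?invr_gt0 ?exprn_gt0// mulrDl; apply: lerD => //.
by rewrite -mulrA ler_wpM2l// mulrC.
Qed.

Lemma P_bigcup_fin (F : finType) (A : F -> set Omega) : (forall x, measurable (A x)) ->
  measurable (\bigcup_x A x) /\ (P (\bigcup_x A x) <= \sum_x P (A x))%E.
Proof.
move=> mA.
have -> : \bigcup_x A x = \big[setU/set0]_(x <- enum F) A x.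
  rewrite -bigcup_seq; apply/seteqP; split=> om [x _ Ax]; exists x => //=.
  by rewrite mem_enum.
rewrite -big_enum /=; elim: (enum F) => [|x l [ml Pl]].
  by rewrite !big_nil measure0.
rewrite !big_cons; split; first exact: measurableU.
by apply: le_trans (measureU2 _ _ _) _ => //; apply: leeD.
Qed.

Lemma finite_uniform_nat (F : finType) (Q : F -> nat -> Prop) :
  (forall x, exists n0, forall n, (n0 <= n)%N -> Q x n) ->
  exists n0, forall n, (n0 <= n)%N -> forall x, Q x n.
Proof.
move=> H; exists (\max_x sval (cid (H x))) => n ln x.
by apply: (svalP (cid (H x))); apply: leq_trans ln; exact: leq_bigmax.
Qed.

(** Each of the finitely many probabilities tends to 0, by [ridge_consistent]. *)
Lemma point_deviation (F : finType) (z : F -> Z) (r eta : R) : 0 < r -> 0 < eta ->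
  exists n0, forall n, (n0 <= n)%N ->
    measurable (\bigcup_(p : F * 'I_d) deviation [:: (1%R, z p.1)] n p.2 r) /\
    (P (\bigcup_(p : F * 'I_d) deviation [:: (1%R, z p.1)] n p.2 r) <= eta%:E)%E.
Proof.
move=> r0 eta0; pose N : R := #|{: F * 'I_d}|%:R.
have N0 : 0 <= N by [].
have r2 : 0 < r ^+ 2 by rewrite exprn_gt0.
have [n0 Hn0] : exists n0, forall n, (n0 <= n)%N -> forall p : F * 'I_d,
    measurable (deviation [:: (1%R, z p.1)] n p.2 r) /\
    (P (deviation [:: (1%R, z p.1)] n p.2 r) <= (eta / (N + 1))%:E)%E.
  apply: finite_uniform_nat => -[x j] /=.
  have [K K0 HK] := deviation_tail j.
  pose e := eta / (N + 1) * r ^+ 2 / (K + 1).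
  have K1 : 0 < K + 1 by rewrite ltr_wpDl.
  have N1 : 0 < N + 1 by rewrite ltr_wpDl.
  have e0 : 0 < e by apply: divr_gt0 => //; apply: mulr_gt0 => //; exact: divr_gt0.
  have [n0 Hn0] := ridge_consistent k_kernel k_cont (sigma_gt0 j) (@a_often (z x)) e0.
  exists n0 => n /Hn0[v hv]; have [m1 m2] := HK [:: (1%R, z x)] n v r r0.
  split=> //; apply: (le_trans m2); rewrite lee_fin ler_pdivrMr//.
  apply: (@le_trans _ _ (K * e)); first by rewrite ler_wpM2l.
  rewrite /e mulrA ler_pdivrMr ?ltr_wpDl// mulrC ler_wpM2l ?lerDl//.
  by rewrite mulr_ge0 ?(ltW r2)// divr_ge0 ?(ltW eta0)// addr_ge0.
exists n0 => n /Hn0 H.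
have [m1 m2] := P_bigcup_fin (fun p => (H p).1).
split=> //; apply: (le_trans m2).
apply: (@le_trans _ _ (\sum_(p : F * 'I_d) (eta / (N + 1))%:E)%E).
  by apply: lee_sum => p _; exact: (H p).2.
rewrite sumEFin lee_fin sumr_const -[X in X <= _]mulr_natr -/N.
by rewrite mulrAC ler_pdivrMr ?ltr_wpDl// ler_wpM2l ?(ltW eta0)// lerDl.
Qed.

Definition node (m i : nat) : R := i%:R / 2 ^+ m.

(** The node [2 * i + 1] of level [m.+1] is the midpoint of the dyadic interval [i]
    of level [m], so that halving this interval is governed by this difference. *)
Definition kink (e : E) (m i : nat) : seq (R * Z) :=
  second_diff (cw_char e) (node m.+1 i.*2.+1) (node m.+1 1).

Definition kinks (m n : nat) : set Omega :=
  \bigcup_(q : 'I_d * E * 'I_(2 ^ m)) deviation (kink q.1.2 m q.2) n q.1.1 ((3 / 8) ^+ m).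

(** The step being [2 ^- m.+1], each of the events has probability of order
    [2 ^- (4 * m) / (3 / 8) ^+ (2 * m) = (4 / 9) ^+ m], and there are [2 ^ m] of them
    for each cell and component. *)
Lemma kinks_tail : exists2 K, 0 <= K & forall m n,
  measurable (kinks m n) /\ (P (kinks m n) <= (K * (8 / 9) ^+ m)%:E)%E.
Proof.
pose HC e := @second_diff_norm R Z k (cw_char e) k_kernel (k_C4 e).
pose C e : R := `|sval (cid (HC e))|.
pose K j := s2val (cid2 (deviation_tail j)).
have K0 j : 0 <= K j by exact: (s2valP (cid2 (deviation_tail j))).
exists (\sum_(q : 'I_d * E) K q.1 * C q.2 / 16).
  by apply: sumr_ge0 => q _; rewrite divr_ge0// mulr_ge0 ?K0// normr_ge0.
move=> m n.
pose bnd (q : 'I_d * E) : R := K q.1 * C q.2 / 16 * (4 / 9) ^+ m.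
have H (q : 'I_d * E * 'I_(2 ^ m)) :
    measurable (deviation (kink q.1.2 m q.2) n q.1.1 ((3 / 8) ^+ m)) /\
    (P (deviation (kink q.1.2 m q.2) n q.1.1 ((3 / 8) ^+ m)) <= (bnd q.1)%:E)%E.
  case: q => -[j e] i /=; pose t : R := (3 / 8) ^+ m.
  have t0 : 0 < t by rewrite exprn_gt0// divr_gt0.
  (* The competitor 0 gives a bound that is uniform in [n]. *)
  have [m1 m2] := s2valP' (cid2 (deviation_tail j)) (kink e m i) n 0 t t0.
  split=> //; apply: (le_trans m2).
  rewrite ridge0// lee_fin -/(K j) ler_pdivrMr ?exprn_gt0//.
  have p0 : 0 < 2 ^+ m.+1 :> R by rewrite exprn_gt0.
  have i2 : (i.*2.+2 <= 2 ^ m.+1)%N.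
    by rewrite expnS mul2n -doubleS leq_double.
  have x0 : 0 <= node m.+1 i.*2.+1 - node m.+1 1.
    by rewrite /node -mulrBl -natrB// divr_ge0// ltW.
  have x1 : node m.+1 i.*2.+1 + node m.+1 1 <= 1.
    by rewrite /node -mulrDl -natrD addn1 ler_pdivrMr// mul1r -natrX ler_nat.
  have n0 : 0 < node m.+1 1 by rewrite divr_gt0.
  have hq := svalP (cid (HC e)) _ _ n0 x0 x1.
  have hq' : span_dot k (kink e m i) (kink e m i) <= C e * node m.+1 1 ^+ 4.
    by apply: (le_trans hq); rewrite ler_wpM2r ?exprn_ge0 ?(ltW n0)// ler_norm.
  apply: (@le_trans _ _ (K j * (C e * node m.+1 1 ^+ 4))); first by rewrite ler_wpM2l.
  rewrite /bnd /= le_eqVlt; apply/orP; left; apply/eqP.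
  have -> : node m.+1 1 ^+ 4 = 16^-1 * (1 / 16) ^+ m.
    rewrite /node expr_div_n expr1n [2 ^+ m.+1]exprS exprMn -exprM mulnC exprM.
    rewrite (_ : 2 ^+ 4 = 16 :> R); last by ring.
    by rewrite expr_div_n expr1n invfM !mul1r.
  have -> : (1 / 16) ^+ m = (4 / 9) ^+ m * t ^+ 2 :> R.
    rewrite /t -exprM mulnC exprM -exprMn; congr (_ ^+ m).
    by field.
  by ring.
have [m1 m2] := P_bigcup_fin (fun q => (H q).1).
split=> //; apply: (le_trans m2).
apply: (@le_trans _ _ (\sum_(q : 'I_d * E * 'I_(2 ^ m)) (bnd q.1)%:E)%E).
  by apply: lee_sum => q _; exact: (H q).2.
rewrite sumEFin lee_fin.
rewrite -(pair_bigA _ (fun q (_ : 'I_(2 ^ m)) => bnd q)) /= mulr_suml.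
apply: ler_sum => q _; rewrite sumr_const card_ord /bnd.
rewrite -[X in X <= _]mulr_natl natrX mulrCA -exprMn.
by rewrite (_ : 2 * (4 / 9) = 8 / 9 :> R)//; field.
Qed.

Lemma kinks_union_tail (eta : R) : 0 < eta -> exists M, forall m0, (M <= m0)%N ->
  forall n, measurable (\bigcup_l kinks (m0 + l) n) /\
    (P (\bigcup_l kinks (m0 + l) n) <= eta%:E)%E.
Proof.
move=> eta0; have [K K0 HK] := kinks_tail.
have q0 : 0 <= 8 / 9 :> R by rewrite divr_ge0.
have q1 : `|8 / 9| < 1 :> R by rewrite ger0_norm// ltr_pdivrMr// mul1r ltr_nat.
have e0 : 0 < eta / (9 * (K + 1)) by rewrite divr_gt0// mulr_gt0// ltr_wpDl.
have /cvgrPdist_lt/(_ _ e0)[M _ HM] := cvg_expr q1.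
exists M => m0 Mm0 n.
(* 9 is the sum of the geometric series of ratio [8 / 9]. *)
have small : K * (8 / 9) ^+ m0 * 9 <= eta.
  have := HM m0 Mm0; rewrite /= sub0r normrN ger0_norm ?exprn_ge0//.
  rewrite ltr_pdivlMr ?mulr_gt0 ?ltr_wpDl// => h.
  have := exprn_ge0 m0 q0; move: h; move: ((8 / 9) ^+ m0) => y h y0; nra.
have mk l : measurable (kinks (m0 + l) n) by exact: (HK _ _).1.
have mU : measurable (\bigcup_l kinks (m0 + l) n) by exact: bigcup_measurable.
split=> //.
apply: (le_trans (measure_sigma_subadditive P mk mU (fun _ h => h))).
have cv : cvgn (fun L => \sum_(0 <= l < L) P (kinks (m0 + l) n))%E.
  by apply: is_cvg_nneseries => l _ _; exact: measure_ge0.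
apply: (lime_le cv); apply: nearW => L; apply: (@le_trans _ _ (\sum_(0 <= l < L) (K * (8 / 9) ^+ (m0 + l))%:E)%E).
  by apply: lee_sum => l _; exact: (HK _ _).2.
rewrite sumEFin lee_fin; apply: le_trans small.
have -> : \sum_(0 <= l < L) K * (8 / 9) ^+ (m0 + l) =
    K * (8 / 9) ^+ m0 * (9 * (1 - (8 / 9) ^+ L)).
  elim: L => [|L IHL]; first by rewrite big_nil expr0 subrr !mulr0.
  by rewrite big_nat_recr//= IHL exprD exprS; field.
rewrite ler_wpM2l ?mulr_ge0 ?exprn_ge0// ler_piMr// gerBl exprn_ge0//.
Qed.

End consistency.

(** * Consistency of the transform *)

Lemma continuous_gaussian_smoothing (R : realType) (Z : topologicalType)
    (k : Z -> Z -> R) (n : nat) (a : 'I_n -> Z) (sigma : R) (y : 'cV[R]_n) :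
  continuous (fun p : Z * Z => k p.1 p.2) ->
  continuous (gaussian_smoothing k a sigma y).
Proof.
move=> kc z.
pose c := invmx (gram k a a + (sigma ^+ 2)%:M) *m y.
have -> : gaussian_smoothing k a sigma y = fun t => \sum_i k t (a i) * c i 0.
  apply/funext => t; rewrite /gaussian_smoothing -mulmxA mxE.
  by apply: eq_bigr => i _; rewrite mxE.
apply: cvg_sumR => i; apply: cvgM; last exact: cvg_cst.
apply: (cvg_comp (fun t => (t, a i)) (fun p => k p.1 p.2)); last exact: (kc (z, a i)).
by apply: cvg_pair; [exact: cvg_id|exact: cvg_cst].
Qed.

Lemma cvg_to_one (R : realType) (F : nat -> \bar R) : (forall n, (F n <= 1)%E) ->
  (forall eta : R, 0 < eta -> exists n0, forall n, (n0 <= n)%N -> (1 - eta%:E <= F n)%E) ->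
  F n @[n --> \oo] --> 1%E.
Proof.
move=> F1 H.
have fin n eta : (1 - eta%:E <= F n)%E -> F n = (fine (F n))%:E.
  by move: (F1 n); case: (F n).
apply/fine_cvgP; split.
  have [n0 Hn0] := H 1 ltr01; exists n0 => // n /= /Hn0 /fin ->.
  exact: fin_numE.
apply/cvgrPdist_le => eta eta0; have [n0 Hn0] := H _ eta0.
exists n0 => // n /= /Hn0 h; have := F1 n; move: (h); rewrite (fin _ _ h) /=.
rewrite -EFinB !lee_fin => h1 h2; rewrite ger0_norm ?subr_ge0//.
by rewrite lerBlDr addrC -lerBlDr.
Qed.

(** The values at the points of level [m0] are so small that the slopes between
    neighbours are at most [del / 4]; chaining adds at most [del / 4] to this. *)
Lemma edge_control (R : realType) (u : R -> R) (m0 : nat) (del : R) : 0 < del ->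
  4 * (3 / 4) ^+ m0 <= del / 4 ->
  {within unit_itv R, continuous u} ->
  (forall j, (j <= 2 ^ m0)%N -> `|u (j%:R / 2 ^+ m0)| <= del / (8 * 2 ^+ m0)) ->
  (forall m j, (m0 <= m)%N -> (j < 2 ^ m)%N ->
    `|u (j.*2.+2%:R / 2 ^+ m.+1) - 2 * u (j.*2.+1%:R / 2 ^+ m.+1)
      + u (j.*2%:R / 2 ^+ m.+1)| <= (3 / 8) ^+ m) ->
  (forall s, 0 <= s <= 1 -> `|u s| <= del) /\
  (forall s s', 0 <= s <= 1 -> 0 <= s' <= 1 -> `|u s - u s'| <= del * `|s - s'|).
Proof.
move=> del0 hm0 uc pts kin.
have p0 : 0 < 2 ^+ m0 :> R by rewrite exprn_gt0.
have p1 : 1 <= 2 ^+ m0 :> R by rewrite exprn_ege1// ler1n.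
have slope0 j : (j < 2 ^ m0)%N ->
    `|u (j.+1%:R / 2 ^+ m0) - u (j%:R / 2 ^+ m0)| <= del / 4 / 2 ^+ m0.
  move=> jm; apply: (le_trans (ler_normB _ _)).
  apply: (le_trans (lerD (pts _ jm) (pts _ (ltnW jm)))).
  rewrite le_eqVlt; apply/orP; left; apply/eqP; field.
  exact: lt0r_neq0.
have lip s s' : 0 <= s <= 1 -> 0 <= s' <= 1 -> `|u s - u s'| <= del / 2 * `|s - s'|.
  move=> s01 s'01; apply: (le_trans (dyadic_lipschitz uc slope0 kin s01 s'01)).
  by rewrite ler_wpM2r// /chain_lip; lra.
split=> [s s01|s s' s01 s'01]; last first.
  by apply: (le_trans (lip _ _ s01 s'01)); rewrite ler_wpM2r//; lra.
have z01 : 0 <= (0 : R) <= 1 by rewrite lexx ler01.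
have h1 := lip s 0 s01 z01.
have := pts 0%N (leq0n _); rewrite mul0r => h2.
have h3 : del / (8 * 2 ^+ m0) <= del / 8.
  rewrite ler_pM2l// lef_pV2 ?posrE ?mulr_gt0//; lra.
rewrite subr0 in h1.
have h4 : del / 2 * `|s| <= del / 2.
  case/andP: s01 => s0 s1; rewrite ler_piMr ?divr_ge0 ?(ltW del0)//.
  by rewrite ger0_norm.
rewrite -[u s](subrK (u 0)); apply: (le_trans (ler_normD _ _)); lra.
Qed.

Section smoothing.
Variables (R : realType) (W : cw_complex) (d : nat).
Local Notation Z := (cw_space R W).
Local Notation E := (cw_edge W).
Variables (f : Z -> 'rV[R]_d) (k : Z -> Z -> R) (a : nat -> Z) (sigma : 'I_d -> R).
Hypothesis f_cont : continuous f.
Hypothesis k_kernel : is_kernel k.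
Hypothesis k_cont : continuous (fun p : Z * Z => k p.1 p.2).
Hypothesis k_C4 : forall e, @Cr_square R 4 (fun s t => k (cw_char e s) (cw_char e t)).
Hypothesis f_RKHS : forall j, in_RKHS k (fun z => f z 0 j).
Hypothesis sigma_gt0 : forall j, 0 < sigma j.
Hypothesis a_often : forall (z : cw_space R W) (U : set (cw_space R W)), nbhs z U -> often a U.
Variables (disp : measure_display) (Omega : measurableType disp).
Variables (P : probability Omega R) (zeta : nat -> 'I_d -> {RV P >-> R}).
Hypothesis law : forall i j B, measurable B ->
  P (zeta i j @^-1` B) = normal_prob 0 (sigma j) B.
Hypothesis indep : forall i i' j A B, i != i' -> measurable A -> measurable B ->
  P (zeta i j @^-1` A `&` zeta i' j @^-1` B) =
  (P (zeta i j @^-1` A) * P (zeta i' j @^-1` B))%E.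

Local Notation err := (smoothing_err f k a sigma zeta).

Lemma continuous_coord j : continuous (fun z => f z 0 j).
Proof.
by move=> z; apply: (@continuous_comp _ _ _ f (fun M : 'rV[R]_d => M 0 j)); [exact: f_cont|exact: coord_continuous].
Qed.

Lemma continuous_smoothed_map (z : nat -> 'I_d -> R) n j :
  continuous (fun t => smoothed_map k sigma f a z n t 0 j).
Proof.
rewrite (_ : (fun t => _) = gaussian_smoothing k (fun i : 'I_n => a i) (sigma j)
  (\col_i (f (a i) 0 j + z i j))); first exact: continuous_gaussian_smoothing.
by apply/funext => t; rewrite mxE.
Qed.

(** [m0] is chosen first, so that second differences of all levels beyond it are
    under control with large probability for every [n]; [n] is taken large only for
    the finitely many points of level [m0] and the vertices. *)
Lemma smoothing_consistent_lip (del eta : R) : 0 < del -> 0 < eta ->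
  exists n0, forall n, (n0 <= n)%N -> exists B : set Omega,
    [/\ measurable B, (P B <= eta%:E)%E & forall om, ~ B om -> forall j,
      (forall z, `|err n j om z| <= del) /\
      (forall e s s', 0 <= s <= 1 -> 0 <= s' <= 1 ->
        `|err n j om (cw_char e s) - err n j om (cw_char e s')| <= del * `|s - s'|)].
Proof.
move=> del0 eta0; have eta2 : 0 < eta / 2 by rewrite divr_gt0.
have [M HM] := kinks_union_tail a k_kernel k_C4 f_RKHS sigma_gt0 law indep eta2.
have q1 : `|3 / 4| < 1 :> R by rewrite ger0_norm// ltr_pdivrMr// mul1r ltr_nat.
have d16 : 0 < del / 16 by rewrite divr_gt0.
have /cvgrPdist_lt/(_ _ d16)[M' _ HM'] := cvg_expr q1.
pose m0 := maxn M M'.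
have hm0 : 4 * (3 / 4) ^+ m0 <= del / 4.
  have := HM' m0 (leq_maxr _ _); rewrite /= sub0r normrN ger0_norm ?exprn_ge0//; lra.
pose r : R := del / (8 * 2 ^+ m0).
have p0 : 0 < 2 ^+ m0 :> R by rewrite exprn_gt0.
have r0 : 0 < r by rewrite divr_gt0// mulr_gt0.
pose pt (o : cw_vertex W + E * 'I_(2 ^ m0).+1) : Z :=
  match o with inl x => cw_pt R x | inr p => cw_char p.1 (node R m0 p.2) end.
have [n0 Hn0] := point_deviation k_kernel k_cont f_RKHS sigma_gt0 a_often law indep pt r0 eta2.
exists n0 => n ln.
have [mA PA] := Hn0 n ln; have [mK PK] := HM m0 (leq_maxl _ _) n.
eexists; split; first exact: measurableU mA mK.
  apply: le_trans (measureU2 _ mA mK) _.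
  by rewrite [eta]splitr EFinD; apply: leeD.
move=> om nB j.
have ptsmall o : `|err n j om (pt o)| < r.
  rewrite ltNge; apply/negP => h; apply: nB; left; exists (o, j) => //.
  by rewrite /deviation /= /functional big_seq1 mul1r.
have ec : continuous (err n j om).
  by move=> z; exact: (cvgB (@continuous_smoothed_map _ n j z) (@continuous_coord j z)).
have edge e : (forall s, 0 <= s <= 1 -> `|err n j om (cw_char e s)| <= del) /\
    (forall s s', 0 <= s <= 1 -> 0 <= s' <= 1 ->
      `|err n j om (cw_char e s) - err n j om (cw_char e s')| <= del * `|s - s'|).
  apply: (@edge_control _ (fun s => err n j om (cw_char e s)) m0 del del0 hm0).
  - apply: continuous_subspaceT => s.
    by apply: (@continuous_comp _ _ _ (@cw_char R W e) (err n j om)); [exact: cw_char_continuous|exact: ec].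
  - move=> i im; have im' : (i < (2 ^ m0).+1)%N by [].
    exact: ltW (ptsmall (inr (e, Ordinal im'))).
  move=> m i m0m im; rewrite leNgt; apply/negP => h; apply: nB; right.
  exists (m - m0)%N => //; rewrite subnKC//; exists (j, e, Ordinal im) => //.
  rewrite /deviation /= /kink functional_second_diff /node -!mulrDl -mulrBl.
  by rewrite -natrD -natrB// addn1 subn1; exact: ltW h.
split=> [z|e]; last exact: (edge e).2.
case: (cw_spaceP z) => [[x ->]|[e [s [/andP[s0 s1] ->]]]]; last first.
  by apply: (edge e).1; rewrite !ltW.
apply: (le_trans (ltW (ptsmall (inl x)))).
rewrite ler_pdivrMr ?mulr_gt0// ler_peMr ?(ltW del0)//.
have : 1 <= 2 ^+ m0 :> R by rewrite exprn_ege1// ler1n.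
lra.
Qed.

End smoothing.

Theorem theorem23
  (R : realType) (W : cw_complex) (d : nat)
  (X : set 'rV[R]_d) (f : cw_space R W -> 'rV[R]_d)
  (f_homeo : homeomorphism_onto f X)
  (f_C2 : Cr_cw 2 f)
  (f_curv : bounded_curvature f)
  (k : cw_space R W -> cw_space R W -> R)
  (k_kernel : is_kernel k)
  (k_cont : continuous
     (fun p : cw_space R W * cw_space R W => k p.1 p.2))
  (k_C4 : kernel_differentiable 4 k)
  (k_entropy : (entropy_integral k < +oo)%E)
  (f_RKHS : forall j : 'I_d, in_RKHS k (fun z => f z 0 j))
  (L : cw_edge W -> R)
  (f_speed : forall (e : cw_edge W) (t : R), 0 <= t <= 1 ->
     enorm (deriv01 (f \o cw_char e) t) = L e)
  (a : nat -> cw_space R W)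
  (a_dense : compatible_dense_seq f a)
  (a_isolated : forall x : cw_vertex W,
     (forall (e : cw_edge W) (b : bool), attach e b <> x) ->
     forall N : nat, exists n : nat, (N <= n)%N /\ a n = cw_pt R x)
  (sigma : 'I_d -> R)
  (sigma_gt0 : forall j, 0 < sigma j)
  (disp : measure_display) (Omega : measurableType disp)
  (P : probability Omega R)
  (zeta : nat -> 'I_d -> {RV P >-> R})
  (zeta_normal : forall (i : nat) (j : 'I_d) (B : set R), measurable B ->
     distribution P (zeta i j) B = normal_prob 0 (sigma j) B)
  (zeta_indep : mutually_independent
     (fun ij : nat * 'I_d => zeta ij.1 ij.2))
  (eps : R) (eps_gt0 : 0 < eps) :
  inner_probability P
    [set w | (ECT_dist
                (smoothed_map k sigma f a (fun i j => zeta i j w) n) f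
              < eps%:E)%E]
    @[n --> \oo] --> 1%E.
Proof.
have f_inj : injective f.
  case: f_homeo => u [_ [w _ [uw _]]] fu x y; rewrite !fu => /val_inj uxy.
  by rewrite -(uw x) uxy uw.
have f_cont : continuous f.
  case: f_homeo => u [uc _] fu; rewrite (_ : f = set_val \o u); last exact/funext.
  by move=> x; apply: continuous_comp; [exact: uc|exact: initial_continuous].
have f_C1 : Cr_cw 1 f by move=> e; case: (f_C2 e) => c [h [c' _]].
have [del del0 stable] := ECT_stability f_cont f_inj f_C1 eps_gt0.
have law i j B : measurable B -> P (zeta i j @^-1` B) = normal_prob 0 (sigma j) B.
  exact: zeta_normal.
have indep i i' j A B : i != i' -> measurable A -> measurable B ->
    P (zeta i j @^-1` A `&` zeta i' j @^-1` B) =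
    (P (zeta i j @^-1` A) * P (zeta i' j @^-1` B))%E.
  move=> ii' mA mB.
  have := @zeta_indep [:: (i, j); (i', j)] (fun q => if q.1 == i then A else B).
  rewrite /= inE xpair_eqE (negPf ii') /= => /(_ isT).
  rewrite !big_cons big_nil mule1 /= eqxx [i' == i]eq_sym (negPf ii') => <-.
    congr (P _); apply/seteqP; split=> om.
      move=> [Aom Bom] q /=; rewrite !inE => /orP[]/eqP -> /=; first by rewrite eqxx.
      by rewrite eq_sym (negPf ii').
    move=> H; split.
      have := H (i, j) (mem_head _ _); by rewrite /= eqxx.
    have := H (i', j); rewrite /= !inE eqxx orbT => /(_ isT).
    by rewrite /= [i' == i]eq_sym (negPf ii').
  by move=> q; case: ifP.
have a_often := often_nbhs f_inj a_dense a_isolated.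
apply: cvg_to_one => [n|eta eta0].
  by apply: ge_ereal_sup => _ [B [mB _] <-]; exact: probability_le1.
have [n0 Hn0] := smoothing_consistent_lip f_cont k_kernel k_cont k_C4.1 f_RKHS
  sigma_gt0 a_often law indep del0 eta0.
exists n0 => n /Hn0[B [mB PB good]].
apply: (@le_trans _ _ (P (~` B))).
  by rewrite probability_setC// leeB.
apply: ereal_sup_ubound; exists (~` B) => //; split; first exact: measurableC.
move=> om /good H; apply: stable => [j|z j|e j].
- exact: continuous_smoothed_map.
- exact: (H j).1.
- exact: (H j).2.
Qed.
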